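(* Let $\Omega\subset\mathbb R^n$ be open, let $V,Z$ be Banach spaces such that $Z$ has the Radon-Nikodým property, and let $X(\Omega)$ be a Banach function space. Let $f:V\to Z$ be Lipschitz continuous and assume that $f(0)=0$ if $|\Omega|=\infty$. Then $f\circ u\in W^1X(\Omega;Z)$ for any $u\in W^1X(\Omega;V)$.
   Context: Banach spaces are real; $|A|$ is Lebesgue measure. $M(\Omega)$ is the set of real-valued measurable functions on $\Omega$ (identified when equal a.e.). A Banach space $X(\Omega)\subset M(\Omega)$ with norm $\|\cdot\|_X$ (put $\|f\|_X=\infty$ if $f\notin X(\Omega)$) is a Banach function space if: (P1) $|f|\le g$, $f\in M(\Omega)$, $g\in X(\Omega)$ imply $f\in X(\Omega)$ and $\|f\|_X\le\|g\|_X$; (P2) $0\le f_n\nearrow f$ a.e. implies $\|f_n\|_X\nearrow\|f\|_X$; (P3) $\chi_A\in X(\Omega)$ for every measurable $A\subset\Omega$ with $|A|<\infty$; (P4) for every measurable $A\subset\Omega$ with $|A|<\infty$ there is $C_A>0$ with $\int_A|f|\,dx\le C_A\|f\chi_A\|_X$ for all $f\in X(\Omega)$. For a Banach space $V$, $X(\Omega;V)$ is the space of strongly measurable $u:\Omega\to V$ with $\|u(\cdot)\|_V\in X(\Omega)$. A function $w\in L^1_{loc}(\Omega;V)$ is the weak partial derivative $\partial_j u$ of $u\in L^1_{loc}(\Omega;V)$ if $\int_\Omega \frac{\partial\varphi}{\partial x_j}u\,dx=-\int_\Omega\varphi w\,dx$ (Bochner integrals) for all $\varphi\in C_0^\infty(\Omega)$.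 $W^1X(\Omega;V)$ is the space of $u\in X(\Omega;V)$ whose weak partial derivatives $\partial_1u,\dots,\partial_nu$ exist and belong to $X(\Omega;V)$. A Banach space $Z$ has the Radon-Nikodým property if for every $\sigma$-finite complete measure space $(S,\Sigma,\mu)$ and every $Z$-valued measure $\nu$ on $\Sigma$ of bounded variation that is absolutely continuous with respect to $\mu$ there is $f\in L^1(S;Z)$ with $\nu(A)=\int_Af\,d\mu$ for all $A\in\Sigma$. Equivalently, every locally absolutely continuous (or every locally Lipschitz) function $\mathbb R\to Z$ is differentiable a.e. *)

(* Defs.v *)
From HB Require Import structures.
From mathcomp Require Import all_boot all_order all_algebra.
From mathcomp Require Import all_classical all_reals all_analysis.

Set Implicit Arguments.
Unset Strict Implicit.
Unset Printing Implicit Defensive.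

Import Order.TTheory GRing.Theory Num.Theory.
Import numFieldNormedType.Exports.

Local Open Scope classical_set_scope.
Local Open Scope ring_scope.

Definition rV_display : measure_display.
Proof. exact: default_measure_display. Qed.

(* A copy of 'rV[R]_n carrying the Borel sigma-algebra, generated by the
   coordinates. There is deliberately no measurable structure on 'rV[R]_n
   itself, so that it cannot be inferred where Lebesgue sets are meant. *)
Definition borel_rV (R : realType) (n : nat) : Type := 'rV[R]_n.

Section borel_rV.
Context {R : realType} (n : nat).

HB.instance Definition _ := Pointed.copy (borel_rV R n) 'rV[R]_n.

Definition rV_coor (i : 'I_n) (x : borel_rV R n) : measurableTypeR R :=
  (x : 'rV[R]_n) ord0 i.

Let rV_set0 : g_sigma_preimage rV_coor set0.
Proof. exact: sigma_algebra0. Qed.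

Let rV_setC A : g_sigma_preimage rV_coor A -> g_sigma_preimage rV_coor (~` A).
Proof. exact: sigma_algebraC. Qed.

Let rV_bigcup (F : (set (borel_rV R n))^nat) :
  (forall i, g_sigma_preimage rV_coor (F i)) ->
  g_sigma_preimage rV_coor (\bigcup_i (F i)).
Proof. exact: sigma_algebra_bigcup. Qed.

HB.instance Definition _ := @isMeasurable.Build rV_display
  (borel_rV R n) (g_sigma_preimage rV_coor) rV_set0 rV_setC rV_bigcup.

Lemma measurable_rV_coor i : measurable_fun [set: borel_rV R n] (rV_coor i).
Proof.
move=> _ Y mY; rewrite setTI; apply: sub_sigma_algebra => /=.
rewrite -bigcup_seq/=; exists i => /=; first by rewrite mem_index_enum.
by exists Y => //; rewrite setTI.
Qed.

Lemma measurable_fun_rVP d (T : measurableType d) (f : T -> borel_rV R n) :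
  (forall i, measurable_fun [set: T] (rV_coor i \o f)) ->
  measurable_fun [set: T] f.
Proof.
move=> mf; have : g_sigma_preimage (fun i => rV_coor i \o f) `<=` measurable.
  apply: smallest_sub; first exact: sigma_algebra_measurable.
  move=> A; rewrite -bigcup_seq /= => -[i _ [B mB <-]]; exact: mf.
by rewrite g_sigma_preimage_comp => sub _ A mA; apply: sub; exists A.
Qed.

End borel_rV.

Section borel_lebesgue_rV_step.
Context {R : realType} (n : nat).
Variable m : {sigma_finite_measure set (borel_rV R n) -> \bar R}.

Definition rV_cons (p : measurableTypeR R * borel_rV R n) : borel_rV R n.+1 :=
  row_mx (const_mx p.1 : 'rV[R]_1) p.2.

Lemma measurable_rV_cons :
  measurable_fun [set: measurableTypeR R * borel_rV R n] rV_cons.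
Proof.
apply: measurable_fun_rVP => i.
case: (@split_ordP 1 n i) => j ->.
  rewrite (_ : _ \o _ = fst); first exact: measurable_fst.
  by apply/funext => p /=; rewrite /rV_coor (@row_mxEl _ 1 1 n) mxE.
rewrite (_ : _ \o _ = rV_coor j \o snd).
  apply: measurableT_comp; first exact: measurable_rV_coor.
  exact: measurable_snd.
by apply/funext => p /=; rewrite /rV_coor (@row_mxEr _ 1 1 n).
Qed.

Definition rV_step : set (borel_rV R n.+1) -> \bar R :=
  pushforward (lebesgue_measure \x m)%E rV_cons.

Let mu : {measure set (borel_rV R n.+1) -> \bar R} :=
  measure_function_pushforward__canonical__measure_function_Measure
    (lebesgue_measure \x m)%E measurable_rV_cons.

Let rV_step0 : rV_step set0 = 0%E.
Proof. exact: (measure0 mu). Qed.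

Let rV_step_ge0 A : (0 <= rV_step A)%E.
Proof. exact: (measure_ge0 mu). Qed.

Let rV_step_sigma_additive : semi_sigma_additive rV_step.
Proof. exact: (@measure_semi_sigma_additive _ _ _ mu). Qed.

HB.instance Definition _ := isMeasure.Build _ _ _ rV_step
  rV_step0 rV_step_ge0 rV_step_sigma_additive.

Let rV_step_sigma_finite : sigma_finite setT rV_step.
Proof.
have /sigma_finiteP[F [TF ndF Foo]] := sigma_finiteT (@lebesgue_measure R).
have /sigma_finiteP[G [TG ndG Goo]] := sigma_finiteT m.
pose tl (x : borel_rV R n.+1) : measurableTypeR R * borel_rV R n :=
  ((x : 'rV[R]_n.+1) ord0 ord0, @rsubmx R 1 1 n x).
have mtl : measurable_fun [set: borel_rV R n.+1] tl.
  apply/measurable_fun_pairP; split; first exact: measurable_rV_coor.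
  apply: measurable_fun_rVP => i.
  rewrite (_ : _ \o _ = rV_coor (@rshift 1 n i)); first exact: measurable_rV_coor.
  by apply/funext => x /=; rewrite /rV_coor mxE.
have tlK : cancel rV_cons tl.
  move=> [x y]; rewrite /tl /rV_cons row_mxKr; congr pair.
  rewrite (_ : ord0 = @lshift 1 n ord0 :> 'I_n.+1); last exact/val_inj.
  by rewrite (@row_mxEl _ 1 1 n) mxE.
have FG : \bigcup_k (F k `*` G k) = setT.
  rewrite -subTset => -[x y] _.
  have [i _ Fix] : (\bigcup_k F k) x by rewrite -TF.
  have [j _ Gjy] : (\bigcup_k G k) y by rewrite -TG.
  exists (maxn i j) => //; split => /=.
  - by move: x Fix; exact/subsetPset/ndF/leq_maxl.
  - by move: y Gjy; exact/subsetPset/ndG/leq_maxr.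
exists (fun k => tl @^-1` (F k `*` G k)).
  by rewrite -preimage_bigcup FG preimage_setT.
move=> k; have [mF Fk] := Foo k; have [mG Gk] := Goo k; split.
  rewrite -[X in measurable X]setTI; apply: mtl => //; exact: measurableX.
rewrite /rV_step /pushforward -comp_preimage.
rewrite (_ : tl \o rV_cons = id); last exact/funext.
by rewrite preimage_id product_measure1E// lte_mul_pinfty// ge0_fin_numE.
Qed.

HB.instance Definition _ := @Measure_isSigmaFinite.Build _ _ _ rV_step
  rV_step_sigma_finite.

End borel_lebesgue_rV_step.

(* Lebesgue measure on the Borel sets of R^n: L^0 is the Dirac measure of the
   only point of R^0, and L^(n+1) is L^1 \x L^n read in 'rV_n.+1. *)
Fixpoint borel_lebesgue_rV {R : realType} (n : nat) :
    {sigma_finite_measure set (borel_rV R n) -> \bar R} :=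
  if n is n'.+1 then rV_step (borel_lebesgue_rV n')
  else \d_ ((0 : 'rV[R]_0) : borel_rV R 0).

(* Caratheodory completion of the Borel measure; [rV_lebesgue R n] is 'rV[R]_n
   with the sigma-algebra of all Lebesgue measurable sets. *)
Notation rV_lebesgue R n :=
  (caratheodory_type (mu_ext (@borel_lebesgue_rV R n))).

Definition lebesgue_rV {R : realType} (n : nat) :
    {measure set (rV_lebesgue R n) -> \bar R} :=
  @completed_measure_extension _ _ _ (borel_lebesgue_rV n).

Section bochner.
Context d (T : measurableType d) (R : realType) (V : completeNormedModType R).
Variables (mu : {measure set T -> \bar R}) (D : set T).
Implicit Types (s u : T -> V).

Definition simple_fun s :=
  finite_set (range s) /\ forall v, measurable (s @^-1` [set v]).

Definition strongly_measurable u := exists s_ : (T -> V)^nat,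
  (forall k, simple_fun (s_ k)) /\
  {ae mu, forall x, D x -> s_ ^~ x @ \oo --> u x}.

Definition simple_integrable s := simple_fun s /\
  forall v, v != 0 -> (mu (D `&` s @^-1` [set v]) < +oo)%E.

(* The value v = 0 contributes 0 whatever the measure of its fibre. *)
Definition simple_integral s : V :=
  \sum_(v \in range s) fine (mu (D `&` s @^-1` [set v])) *: v.

Definition is_bochner_integral u (I : V) := strongly_measurable u /\
  exists s_ : (T -> V)^nat, [/\ forall k, simple_integrable (s_ k),
    (\int[mu]_(x in D) `|u x - s_ k x|%:E)%E @[k --> \oo] --> 0%E &
    simple_integral (s_ k) @[k --> \oo] --> I].

(* Junk value 0 when u is not Bochner integrable on D. *)
Definition bochner_integral u : V := xget 0 [set I | is_bochner_integral u I].

Definition bochner_L1 u := strongly_measurable u /\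
  (\int[mu]_(x in D) `|u x|%:E < +oo)%E.

End bochner.

Section vector_measures.
Context d (T : measurableType d) (R : realType) (Z : completeNormedModType R).
Implicit Types (nu : set T -> Z) (mu : {measure set T -> \bar R}).

Definition vector_measure nu := forall F : (set T)^nat,
  (forall k, measurable (F k)) -> trivIset setT F ->
  (\sum_(i < k) nu (F i)) @[k --> \oo] --> nu (\bigcup_k F k).

Definition vector_total_variation nu : \bar R :=
  ereal_sup [set x | exists k (F : 'I_k -> set T),
    [/\ forall i, measurable (F i), trivIset setT F,
        \bigcup_i F i = setT & x = (\sum_(i < k) `|nu (F i)|)%:E]].

Definition bounded_variation_measure nu :=
  (vector_total_variation nu < +oo)%E.

Definition vector_abs_continuous nu mu :=
  forall A, measurable A -> mu A = 0%E -> nu A = 0.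

End vector_measures.

Definition radon_nikodym_property (R : realType)
    (Z : completeNormedModType R) : Prop :=
  forall d (S : measurableType d) (mu : {measure set S -> \bar R}),
    sigma_finite setT mu -> measure_is_complete mu ->
  forall nu : set S -> Z, vector_measure nu -> bounded_variation_measure nu ->
    vector_abs_continuous nu mu ->
  exists f : S -> Z, bochner_L1 mu setT f /\
    forall A, measurable A -> nu A = bochner_integral mu A f.

(* Functions on Omega are total functions on 'rV_n of which only the values on
   Omega matter: membership and norm are invariant under a.e. equality on
   Omega (by [bfs_ae], [bfs_norm_eq0] and the triangle inequality). *)
Section banach_function_spaces.
Context {R : realType} {n : nat} (Om : set 'rV[R]_n).
Local Notation mu := (@lebesgue_rV R n).
Local Notation rfun := (rV_lebesgue R n -> R).
Local Notation OmL := (Om : set (rV_lebesgue R n)).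

Definition ae_on (P : 'rV[R]_n -> Prop) := {ae mu, forall x, Om x -> P x}.

Definition extended_norm (X : set rfun) (N : rfun -> R) (f : rfun) : \bar R :=
  if `[< X f >] then (N f)%:E else +oo%E.

Record banach_function_space := BanachFunctionSpace {
  bfs_set : set rfun ;
  bfs_norm : rfun -> R ;
  bfs_measurable : forall f : rfun, bfs_set f -> measurable_fun OmL f ;
  bfs_ae : forall f g : rfun, bfs_set f -> measurable_fun OmL g ->
    ae_on (fun x => f x = g x) -> bfs_set g ;
  bfs_linear : forall (a : R) (f g : rfun), bfs_set f -> bfs_set g ->
    bfs_set (fun x => a * f x + g x) ;
  bfs_norm_eq0 : forall f : rfun, bfs_set f ->
    bfs_norm f = 0 <-> ae_on (fun x => f x = 0) ;
  bfs_normZ : forall (a : R) (f : rfun), bfs_set f ->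
    bfs_norm (fun x => a * f x) = `|a| * bfs_norm f ;
  bfs_normD : forall f g : rfun, bfs_set f -> bfs_set g ->
    bfs_norm (fun x => f x + g x) <= bfs_norm f + bfs_norm g ;
  bfs_complete : forall f_ : nat -> rfun, (forall k, bfs_set (f_ k)) ->
    (forall e, 0 < e -> exists K, forall i j, (K <= i)%N -> (K <= j)%N ->
      bfs_norm (fun x => f_ i x - f_ j x) < e) ->
    exists2 f : rfun, bfs_set f &
      bfs_norm (fun x => f_ k x - f x) @[k --> \oo] --> 0 ;
  bfs_ideal : forall f g : rfun, measurable_fun OmL f -> bfs_set g ->
    ae_on (fun x => `|f x| <= g x) -> bfs_set f /\ bfs_norm f <= bfs_norm g ;
  bfs_fatou : forall (f_ : nat -> rfun) (f : rfun),
    (forall k, measurable_fun OmL (f_ k)) -> measurable_fun OmL f ->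
    ae_on (fun x => [/\ forall k, 0 <= f_ k x,
      nondecreasing_seq (f_ ^~ x) & f_ ^~ x @ \oo --> f x]) ->
    nondecreasing_seq (fun k => extended_norm bfs_set bfs_norm (f_ k)) /\
    extended_norm bfs_set bfs_norm (f_ k) @[k --> \oo] -->
      extended_norm bfs_set bfs_norm f ;
  bfs_indic : forall A : set (rV_lebesgue R n), measurable A -> A `<=` Om ->
    (mu A < +oo)%E -> bfs_set (\1_A) ;
  bfs_L1 : forall A : set (rV_lebesgue R n), measurable A -> A `<=` Om ->
    (mu A < +oo)%E -> exists2 C : R, 0 < C & forall f : rfun, bfs_set f ->
      (\int[mu]_(x in A) `|f x|%:E <=
       C%:E * extended_norm bfs_set bfs_norm (fun x => f x * \1_A x)%R)%E
}.

End banach_function_spaces.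

Section sobolev.
Context {R : realType} {n : nat} (Om : set 'rV[R]_n).
Local Notation mu := (@lebesgue_rV R n).

Definition partial (V : normedModType R) (j : 'I_n) (f : 'rV[R]_n -> V) :
    'rV[R]_n -> V := 'D_(delta_mx ord0 j) f.

Definition iter_partial (s : seq 'I_n) (f : 'rV[R]_n -> R) :=
  foldr (@partial R^o) f s.

Definition smooth (f : 'rV[R]_n -> R) := forall s : seq 'I_n,
  continuous (iter_partial s f) /\
  forall j x, derivable (iter_partial s f) x (delta_mx ord0 j).

(* C_0^oo(Om), each function being extended by 0 to the whole of R^n. *)
Definition test_function (phi : 'rV[R]_n -> R) := smooth phi /\
  let supp := closure [set x | phi x != 0] in compact supp /\ supp `<=` Om.

Section vector_valued.
Variable V : completeNormedModType R.
Implicit Types u w : rV_lebesgue R n -> V.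

Definition L1loc u := strongly_measurable mu Om u /\
  forall K : set 'rV[R]_n, compact K -> K `<=` Om ->
    (\int[mu]_(x in K) `|u x|%:E < +oo)%E.

Definition weak_partial (j : 'I_n) u w := [/\ L1loc u, L1loc w &
  forall phi, test_function phi ->
    bochner_integral mu Om (fun x => partial j phi x *: u x) =
    - bochner_integral mu Om (fun x => phi x *: w x)].

Variable X : banach_function_space Om.

Definition bfs_valued u := strongly_measurable mu Om u /\
  bfs_set X (fun x => `|u x|).

Definition W1 u := bfs_valued u /\
  forall j : 'I_n, exists2 w, weak_partial j u w & bfs_valued w.

End vector_valued.
End sobolev.

(* Main.v *)
Require Import Defs.
From HB Require Import structures.
From mathcomp Require Import all_boot all_order all_algebra.
From mathcomp Require Import all_classical all_reals all_analysis.
From mathcomp Require Import measurable_realfun.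
From mathcomp Require Import ring lra.
Set Implicit Arguments.
Unset Strict Implicit.
Unset Printing Implicit Defensive.
Import Order.TTheory GRing.Theory Num.Theory.
Import numFieldNormedType.Exports.
Import HBSimple HBNNSimple.
Local Open Scope classical_set_scope.
Local Open Scope ring_scope.

(* Let k = |D_j u| on Om, and let M be a Lipschitz constant of f. Testing the weak derivative of u
   against translates of test functions gives the integral form of the fundamental theorem of
   calculus: |u(x + h e_j) - u(x)| is at most the integral of k over the segment from x to
   x + h e_j, for almost every x. The Lipschitz bound transfers this to v = f o u, and writing
   D_j phi as a limit of difference quotients and moving the quotient onto v yields
     |\int D_j phi v| <= M \int |phi| k   for every test function phi.
   Hence phi |-> - \int D_j phi v extends to a bounded operator from L^1(k dx) to Z. On a set of
   finite k dx-measure its values at indicators form a Z-valued measure of bounded variation,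
   absolutely continuous with respect to Lebesgue measure; the Radon-Nikodym property gives it a
   density. Patching the densities gives w with \int D_j phi v = - \int phi w and |w| <= M k a.e.,
   and the ideal property of X puts |w| in X. *)

(** * Lebesgue measure on R^n *)

(** The usual route picks representatives that are absolutely continuous on almost every line and
    differentiates [f o u] along them. Here nothing is differentiated pointwise: [f] may be
    differentiable nowhere, so only size estimates survive the composition, and the derivative of
    [v] appears at the very end, as a density. The choice of the weight k is what makes membership
    in X possible: boundedness on L^1(k dx) is the integrated form of the pointwise bound that the
    ideal property asks for. Translations must stay inside Om and [u] is only locally integrable, so
    each estimate is made on a compact K containing the support of the test function with a margin.
    The errors depend on K but vanish with h; the constant M does not depend on K, so the bounds fit
    together. The null set in the increment bound depends on h, which is harmless because h is fixed
    whenever the bound is integrated. No functionals on Z are used: vectors are compared with the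
    values of simple functions. The condition on f(0) enters through |f o u| <= M |u| + |f(0)|,
    whose last term lies in X when Om has finite measure. *)

Lemma ge0_integral_measure_preserving d (T : measurableType d) (R : realType)
    (mu : {measure set T -> \bar R}) (g : T -> T) (f : T -> \bar R) :
  measurable_fun setT g -> (forall A, measurable A -> mu (g @^-1` A) = mu A) ->
  measurable_fun setT f -> (forall x, 0 <= f x)%E ->
  (\int[mu]_x f (g x) = \int[mu]_x f x)%E.
Proof.
move=> mg gmu mf f0.
transitivity (\int[pushforward mu g]_x f x)%E.
  by rewrite ge0_integral_pushforward.
by apply: eq_measure_integral => A mA _; exact: gmu.
Qed.

Section lebesgue_rV_basics.
Context {R : realType}.

Lemma lebesgue_rV_sigma_finite n : sigma_finite setT (@lebesgue_rV R n).
Proof.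
exact/completed_measure_extension_sigma_finite/sigma_finiteT.
Qed.

Lemma lebesgue_rV_complete n : measure_is_complete (@lebesgue_rV R n).
Proof. exact: measure_is_complete_caratheodory. Qed.

Lemma borel_lebesgue_measurable n (A : set (borel_rV R n)) :
  measurable A -> measurable (A : set (rV_lebesgue R n)).
Proof. exact: caratheodory_measurable_mu_ext. Qed.

Lemma lebesgue_rVE n (A : set (borel_rV R n)) :
  measurable A -> lebesgue_rV n A = borel_lebesgue_rV n A.
Proof. exact: measurable_mu_extE. Qed.

(** The pushforward of Lebesgue measure by the translation has the right values on half-open
    intervals, and these determine the measure. *)
Lemma lebesgue_measure_shift (a : R) (A : set (measurableTypeR R)) :
  measurable A ->
  lebesgue_measure ((fun x : measurableTypeR R => x + a) @^-1` A) = lebesgue_measure A.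
Proof.
move=> mA; apply/esym.
have ms : measurable_fun setT (fun x : measurableTypeR R => (x + a : measurableTypeR R)).
  exact: measurable_funD.
apply: (@lebesgue_measure_unique _ (measure_function_pushforward__canonical__measure_function_Measure lebesgue_measure ms)) => //= _ [[x y]] _ <-.
rewrite /pushforward.
rewrite [X in _ = lebesgue_measure X](_ : _ = [set` `]x - a, y - a]]).
  by rewrite !lebesgue_measure_itv/= !lte_fin ltrD2r -!EFinB opprB addrA subrK.
by apply/seteqP; split=> z /=; rewrite !in_itv/= ltrBlDr lerBrDr.
Qed.

Lemma ge0_integral_shift1 (a : R) (f : measurableTypeR R -> \bar R) :
  measurable_fun setT f -> (forall r, 0 <= f r)%E ->
  (\int[lebesgue_measure]_x f (x + a)%R = \int[lebesgue_measure]_x f x)%E.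
Proof.
move=> mf f0.
apply: ge0_integral_measure_preserving => //; first exact: measurable_funD.
by move=> A mA; exact: lebesgue_measure_shift.
Qed.

Lemma borel_measurable_shift n (a : 'rV[R]_n) :
  measurable_fun setT (fun x : borel_rV R n => ((x : 'rV[R]_n) + a : borel_rV R n)).
Proof.
apply: measurable_fun_rVP => i.
rewrite (_ : _ \o _ = fun x => rV_coor i x + a ord0 i); last first.
  by apply/funext => x; rewrite /rV_coor /= mxE.
apply: measurable_funD => //; exact: measurable_rV_coor.
Qed.

(** Induction on the dimension: a section of the translated set over a first coordinate is a
    translated section, so the induction hypothesis absorbs [a2], and invariance of the
    one-dimensional integral absorbs [a1]. *)
Lemma borel_lebesgue_rV_shift n (a : 'rV[R]_n) (A : set (borel_rV R n)) :
  measurable A ->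
  borel_lebesgue_rV n ((fun x : 'rV[R]_n => x + a) @^-1` A) = borel_lebesgue_rV n A.
Proof.
elim: n a A => [a A mA|n IH a A mA] /=.
  by rewrite (_ : +%R^~ a @^-1` A = A)//; apply/seteqP; split=> x /=; rewrite (_ : x + a = x)//; apply/rowP; case.
rewrite /rV_step /pushforward /product_measure1 /=.
set Z := @rV_cons R n @^-1` A.
have mZ : measurable Z by rewrite -[Z]setTI; apply: measurable_rV_cons.
set a1 := lsubmx (a : 'rV_(1 + n)) ord0 ord0; set a2 := rsubmx (a : 'rV_(1 + n)).
transitivity (\int[lebesgue_measure]_x (borel_lebesgue_rV n (xsection Z (x + a1)%R)))%E.
  apply: eq_integral => x _ /=.
  have mx : measurable (xsection Z (x + a1)).
    have H := @measurable_xsection _ _ _ _ Z (x + a1) mZ; exact: H.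
  rewrite -[RHS](IH a2)//; congr (borel_lebesgue_rV n _).
  suff E y : rV_cons (x, y) + a = rV_cons (x + a1, y + a2).
    by apply/seteqP; split=> y; rewrite /xsection/= !inE/Z/= E.
  apply/rowP => i; rewrite mxE /rV_cons/=; case: (@split_ordP 1 n i) => j ->.
    by rewrite !(@row_mxEl _ 1 1 n) !mxE ord1 /a1 mxE.
  by rewrite !(@row_mxEr _ 1 1 n) !mxE.
apply: (ge0_integral_shift1 a1 (f := fun x => borel_lebesgue_rV n (xsection Z x))) => //.
exact: measurable_fun_xsection.
Qed.

Local Notation shift a := (fun x : 'rV[R]_ _ => x + a).

(** The outer measure is an infimum over countable Borel covers; the union of a cover is itself
    Borel and costs no more, by subadditivity, so single Borel supersets suffice. Invariance can
    then be read off from Borel sets. *)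
Lemma lebesgue_rV_outer n (A : set 'rV[R]_n) :
  lebesgue_rV n A = ereal_inf [set borel_lebesgue_rV n B | B in
    [set B | measurable (B : set (borel_rV R n)) /\ A `<=` B]].
Proof.
apply/eqP; rewrite eq_le; apply/andP; split.
  apply: le_ereal_inf_tmp => _ [B [mB AB] <-].
  rewrite -(measurable_mu_extE (borel_lebesgue_rV n))//; exact: le_mu_ext.
apply: le_ereal_inf_tmp => _ [F [mF AF] <-].
have mUF : measurable (\bigcup_k F k) by apply: bigcupT_measurable.
apply: (@le_trans _ _ (borel_lebesgue_rV n (\bigcup_k F k))).
  by apply: ereal_inf_lbound; exists (\bigcup_k F k).
exact: measure_sigma_subadditive.
Qed.

(** [A] is arbitrary, not only measurable: the Caratheodory criterion tests a set against all
    subsets, and its invariance in [measurable_rV_shift] needs the outer measure of each of them. *)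
Lemma lebesgue_rV_shift n (a : 'rV[R]_n) (A : set 'rV[R]_n) :
  lebesgue_rV n (shift a @^-1` A) = lebesgue_rV n A.
Proof.
have le b (B : set 'rV[R]_n) : (lebesgue_rV n (shift b @^-1` B) <= lebesgue_rV n B)%E.
  rewrite [leRHS]lebesgue_rV_outer; apply: le_ereal_inf_tmp => _ [C [mC BC] <-].
  rewrite lebesgue_rV_outer; apply: ereal_inf_lbound; exists (shift b @^-1` C).
    split; last by move=> x /= /BC.
    by rewrite -[_ @^-1` _]setTI; exact: borel_measurable_shift.
  exact: borel_lebesgue_rV_shift.
apply/eqP; rewrite eq_le le/= -[leLHS]/(lebesgue_rV n A).
rewrite [X in (lebesgue_rV n X <= _)%E](_ : A = shift (- a) @^-1` (shift a @^-1` A)) ?le//.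
by apply/seteqP; split=> x /=; rewrite subrK.
Qed.

Lemma measurable_rV_shift n (a : 'rV[R]_n) :
  measurable_fun setT (fun x : rV_lebesgue R n => ((x : 'rV[R]_n) + a : rV_lebesgue R n)).
Proof.
move=> _ A mA; rewrite setTI; rewrite /measurable/= => X.
have := mA (shift (- a) @^-1` X).
have E B C : lebesgue_rV n (shift (- a) @^-1` B `&` C) = lebesgue_rV n (B `&` shift a @^-1` C).
  rewrite -(lebesgue_rV_shift a); congr (lebesgue_rV n _).
  by apply/seteqP; split=> x /=; rewrite addrK.
have := E X A; have := E X (~` A); have := E X setT.
by rewrite preimage_setT !setIT preimage_setC /lebesgue_rV/= /completed_measure_extension => <- <- <-.
Qed.

Lemma ge0_integral_rV_shift n (a : 'rV[R]_n) (f : rV_lebesgue R n -> \bar R) :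
  measurable_fun setT f -> (forall x, 0 <= f x)%E ->
  (\int[lebesgue_rV n]_x f ((x : 'rV[R]_n) + a)%R = \int[lebesgue_rV n]_x f x)%E.
Proof.
move=> mf f0.
exact: (ge0_integral_measure_preserving (measurable_rV_shift a) (fun A _ => lebesgue_rV_shift a A) mf f0).
Qed.

(* Intersect Borel covers realising the outer measure up to [1/(k+1)]. *)
Let borel_hull_finite n (A : set (rV_lebesgue R n)) : measurable A ->
  (lebesgue_rV n A < +oo)%E -> exists2 B : set (borel_rV R n), measurable B &
  A `<=` B /\ lebesgue_rV n (B `\` A) = 0%E.
Proof.
move=> mA Afin.
have Afn : lebesgue_rV n A \is a fin_num by rewrite ge0_fin_numE.
have /choice[F FP] : forall k, exists B : set (borel_rV R n), [/\ measurable B, A `<=` B &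
    (lebesgue_rV n B < lebesgue_rV n A + (k.+1%:R^-1)%:E)%E].
  move=> k.
  have k0 : (0 < k.+1%:R^-1 :> R)%R by rewrite invr_gt0.
  have := Afn; rewrite {1}lebesgue_rV_outer => /lb_ereal_inf_adherent => /(_ _ k0)[_ [B [mB AB] <-]].
  by rewrite -lebesgue_rV_outer -lebesgue_rVE// => ?; exists B.
have mF : measurable (\bigcap_k F k).
  by apply: bigcapT_measurable => k; case: (FP k).
have mF' := borel_lebesgue_measurable mF.
exists (\bigcap_k F k) => //; split; first by move=> x Ax k _; case: (FP k) => _ + _; apply.
have AF : A `<=` \bigcap_k F k by move=> x Ax k _; case: (FP k) => _ + _; apply.
have Fle k : (lebesgue_rV n (\bigcap_k F k) <= lebesgue_rV n A + (k.+1%:R^-1)%:E)%E.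
  have [mFk _ /ltW FkA] := FP k; apply: le_trans FkA.
  by apply: le_measure; rewrite ?inE//; [exact: borel_lebesgue_measurable|exact: bigcap_inf].
rewrite measureD//; last first.
  by apply: le_lt_trans (Fle 0%N) _; rewrite lte_add_pinfty// ltry.
suff E : lebesgue_rV n (\bigcap_k F k) = lebesgue_rV n A by rewrite (setIidr AF) [X in (X - _)%E]E subee.
apply/eqP; rewrite eq_le; apply/andP; split; last by apply: le_measure; rewrite ?inE.
apply/lee_addgt0Pr => _/posnumP[e]; near \oo => k.
apply: le_trans (Fle k) _; rewrite leeD2l// lee_fin ltW//.
by near: k; exact: near_infty_natSinv_lt.
Unshelve. all: by end_near. Qed.

(** Sigma-finiteness reduces to pieces of finite measure: the union of the hulls of the pieces
    exceeds [A] by a countable union of null sets. This is the passage from Lebesgue to Borel sets,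
    both for Borel representatives and for the density of test functions. *)
Lemma borel_hull n (A : set (rV_lebesgue R n)) : measurable A ->
  exists2 B : set (borel_rV R n), measurable B &
  A `<=` B /\ lebesgue_rV n (B `\` A) = 0%E.
Proof.
move=> mA; have [E TE Efin] := lebesgue_rV_sigma_finite n.
have mE k : measurable (E k) by case: (Efin k).
have /choice[B BP] : forall k, exists B : set (borel_rV R n), [/\ measurable B,
    A `&` E k `<=` B & lebesgue_rV n (B `\` (A `&` E k)) = 0%E].
  move=> k; have [||B mB [AB BA]] := @borel_hull_finite n (A `&` E k); last by exists B.
    exact: measurableI.
  apply: le_lt_trans (Efin k).2; apply: le_measure; rewrite ?inE//; exact: measurableI.
have mB : measurable (\bigcup_k B k) by apply: bigcupT_measurable => k; case: (BP k).
exists (\bigcup_k B k) => //; split.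
  move=> x Ax; have [k _ Ekx] : (\bigcup_k E k) x by rewrite -TE.
  by exists k => //; case: (BP k) => _ + _; apply.
have : (lebesgue_rV n).-negligible (\bigcup_k (B k `\` (A `&` E k))).
  apply: negligible_bigcup => k; case: (BP k) => mBk _ ?; exists (B k `\` (A `&` E k)); split => //.
  by apply: measurableD; [exact: borel_lebesgue_measurable|exact: measurableI].
move=> [N [mN N0 BN]]; apply: (@subset_measure0 _ _ _ (lebesgue_rV n) _ N) => //.
  by apply: measurableD => //; exact: borel_lebesgue_measurable.
by apply: subset_trans BN => x [[k _ Bkx] nAx]; exists k => //; split => // -[].
Qed.

End lebesgue_rV_basics.

(** * Boxes and compact sets in R^n *)

Section boxes.
Context {R : realType} {n : nat}.
Implicit Types (a b x y : 'rV[R]_n) (U K : set 'rV[R]_n).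

Definition open_box a b : set 'rV[R]_n :=
  [set x | forall i, a ord0 i < x ord0 i < b ord0 i].

Definition closed_box a b : set 'rV[R]_n :=
  [set x | forall i, a ord0 i <= x ord0 i <= b ord0 i].

Lemma rV_norm_ltP x (e : R) : 0 < e ->
  (`|x| < e) <-> (forall i, `|x ord0 i| < e).
Proof.
move=> e0; rewrite [`|x|]mx_normrE; split.
  by move=> /bigmax_ltP[_ xe] i; exact: (xe (ord0, i)).
by move=> xe; apply/bigmax_ltP; split => // -[i j] _ /=; rewrite ord1.
Qed.

Lemma rV_coord_le x i : `|x ord0 i| <= `|x|.
Proof.
rewrite [leRHS]mx_normrE; exact: (le_bigmax _ (fun j : 'I_1 * 'I_n => `|x j.1 j.2|) (ord0, i)).
Qed.

Lemma closed_closed_box a b : closed (closed_box a b).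
Proof.
rewrite (_ : closed_box a b =
    \bigcap_(i in [set: 'I_n]) ((fun x : 'rV[R]_n => x ord0 i) @^-1` `[a ord0 i, b ord0 i])).
  apply: closed_bigI => i _; apply: preimage_closed; last exact: interval_closed.
  by move=> x _; exact: coord_continuous.
by apply/seteqP; split=> x /= h i; [move=> _; rewrite /= in_itv/=; exact: h|have := h i Logic.I; rewrite /= in_itv].
Qed.

Lemma compact_closed_box a b : compact (closed_box a b).
Proof.
apply: bounded_closed_compact; last exact: closed_closed_box.
exists (`|a| + `|b|); split; first exact: num_real.
move=> M abM x xab; apply: ltW.
have M0 : 0 < M by apply: le_lt_trans abM; exact: addr_ge0.
apply/rV_norm_ltP => // i; apply: le_lt_trans abM.
have /andP[ax xb] := xab i.
have := rV_coord_le a i; have := rV_coord_le b i.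
rewrite !ler_norml => /andP[bb1 bb2] /andP[aa1 aa2].
by have a0 := normr_ge0 a; have b0 := normr_ge0 b; apply/andP; split; lra.
Qed.

Lemma measurable_open_box a b : measurable (open_box a b : set (borel_rV R n)).
Proof.
rewrite (_ : open_box a b = \bigcap_(i in [set: 'I_n])
    ((@rV_coor R n i) @^-1` `]a ord0 i, b ord0 i[)).
  apply: fin_bigcap_measurable; first exact: finite_finset.
  move=> i _; rewrite -[_ @^-1` _]setTI; apply: measurable_rV_coor => //.
by apply/seteqP; split=> x /= h i; [move=> _|]; have := h i; rewrite /= /rV_coor in_itv/=; [|exact].
Qed.

Lemma open_box_sub_closed a b : open_box a b `<=` closed_box a b.
Proof. by move=> x xab i; have /andP[/ltW -> /ltW ->] := xab i. Qed.

(** Rational centres and radii [r m] are enumerated through [unpickle]. Only boxes whose closure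
    lies in [U] are kept, the others being replaced by the empty set; hence a bump living on such a
    box is a test function on [U], and a locally integrable weight has finite mass on it. *)
Lemma open_box_cover U : open U -> exists F : (set 'rV[R]_n)^nat,
  (forall k, F k = set0 \/
    exists a b, F k = open_box a b /\ closed_box a b `<=` U) /\
  \bigcup_k F k = U.
Proof.
move=> oU.
pose r m : R := m.+1%:R^-1.
pose lo (p : 'rV[rat]_n * nat) : 'rV[R]_n := \row_i (ratr (p.1 ord0 i) - r p.2).
pose hi (p : 'rV[rat]_n * nat) : 'rV[R]_n := \row_i (ratr (p.1 ord0 i) + r p.2).
pose F k := if @unpickle ('rV[rat]_n * nat)%type k is Some p then
  if `[< closed_box (lo p) (hi p) `<=` U >] then open_box (lo p) (hi p) else set0 else set0.
exists F; split.
  move=> k; rewrite /F; case: unpickle => [p|]; last by left.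
  by case: asboolP => [pU|]; [right; exists (lo p), (hi p)|left].
apply/seteqP; split.
  move=> x [k _]; rewrite /F; case: unpickle => // p; case: asboolP => // pU.
  by move=> /open_box_sub_closed; exact: pU.
move=> x Ux.
have /nbhs_ballP[e /= e0 xeU] : nbhs x U by exact: open_nbhs_nbhs.
have [m me] : exists m, r m < e / 2.
  near \oo => m; exists m; near: m.
  exact: (near_infty_natSinv_lt (PosNum (divr_gt0 e0 (ltr0Sn _ 1)))).
have r0 : 0 < r m by rewrite invr_gt0.
have /choice[q qP] : forall i, exists q : rat, `|x ord0 i - ratr q| < r m.
  move=> i; have [q] := @rat_in_itvoo R (x ord0 i - r m) (x ord0 i + r m) ltac:(lra).
  by rewrite in_itv/= => /andP[q1 q2]; exists q; rewrite ltr_norml; apply/andP; split; lra.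
exists (pickle (\row_i q i, m)) => //; rewrite /F pickleK.
have -> : `[< closed_box (lo (\row_i q i, m)) (hi (\row_i q i, m)) `<=` U >].
  apply/asboolP => y yB; apply: xeU; rewrite -ball_normE /ball_/=.
  apply/rV_norm_ltP => // i; have := yB i; have := qP i; rewrite !mxE/= ltr_norml.
  by move=> /andP[? ?] /andP[? ?]; rewrite ltr_norml; apply/andP; split; lra.
by move=> i; have := qP i; rewrite !mxE/= ltr_norml => /andP[? ?]; apply/andP; split; lra.
Unshelve. all: by end_near. Qed.

Lemma open_borel U : open U -> measurable (U : set (borel_rV R n)).
Proof.
move=> /open_box_cover[F [FP <-]]; apply: bigcupT_measurable => k.
by case: (FP k) => [->//|[a [b [-> _]]]]; exact: measurable_open_box.
Qed.

Lemma closed_borel U : closed U -> measurable (U : set (borel_rV R n)).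
Proof.
by move=> /closed_openC/open_borel/measurableC; rewrite setCK.
Qed.

End boxes.

Section compact_finite.
Context {R : realType}.

Lemma borel_lebesgue_open_box n (a b : 'rV[R]_n) :
  (borel_lebesgue_rV n (open_box a b) < +oo)%E.
Proof.
elim: n a b => [|n IH] a b /=; first by rewrite diracE ltry.
pose a2 := rsubmx (a : 'rV_(1 + n)); pose b2 := rsubmx (b : 'rV_(1 + n)).
rewrite /rV_step /pushforward.
rewrite [X in (_ \x _)%E X](_ : _ = `]a ord0 ord0, b ord0 ord0[%classic `*` open_box a2 b2).
  rewrite product_measure1E//; last exact: measurable_open_box.
  rewrite lte_mul_pinfty//; try exact: IH.
  rewrite ge0_fin_numE//; set I := `]_, _[.
  rewrite (_ : _ [set` I] = lebesgue_measure [set` I])// lebesgue_measure_itv /I/=.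
  by case: ifP => _; rewrite ?ltry// -EFinB ltry.
apply/seteqP; split=> -[x y] /=; rewrite /rV_cons/=.
  move=> h; split.
    have := h ord0; rewrite in_itv/= (_ : ord0 = @lshift 1 n ord0 :> 'I_n.+1); last exact/val_inj.
    by rewrite (@row_mxEl _ 1 1 n) mxE.
  by move=> i; have := h (@rshift 1 n i); rewrite (@row_mxEr _ 1 1 n) !mxE.
rewrite in_itv/= => -[xab yab] i; case: (@split_ordP 1 n i) => j ->.
  rewrite (@row_mxEl _ 1 1 n) mxE.
  by rewrite (_ : lshift n j = ord0)//; apply/val_inj; rewrite /= ord1.
by have := yab j; rewrite (@row_mxEr _ 1 1 n) !mxE.
Qed.

Lemma lebesgue_compact n (K : set 'rV[R]_n) : compact K ->
  measurable (K : set (rV_lebesgue R n)) /\ (lebesgue_rV n K < +oo)%E.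
Proof.
move=> cK.
have mK : measurable (K : set (borel_rV R n)).
  by apply: closed_borel; apply: compact_closed => //; exact: norm_hausdorff.
split; first exact: borel_lebesgue_measurable.
have [M [_ KM]] := compact_bounded cK.
have M1 : M < `|M| + 1 by rewrite ltr_pwDr// ler_norm.
(* [|M| + 1] bounds the norm on [K]; one more unit makes the inequalities of the open box strict. *)
apply: (@le_lt_trans _ _ (lebesgue_rV n (open_box (const_mx (- (`|M| + 2))) (const_mx (`|M| + 2)) : set 'rV[R]_n))).
  apply: le_measure; rewrite ?inE; [exact: borel_lebesgue_measurable| |].
    by apply: borel_lebesgue_measurable; exact: measurable_open_box.
  move=> x Kx i; have := KM _ M1 x Kx => /(le_trans (rV_coord_le x i)).
  by rewrite ler_norml !mxE => /andP[? ?]; apply/andP; split; lra.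
by rewrite lebesgue_rVE ?borel_lebesgue_open_box//; exact: measurable_open_box.
Qed.

End compact_finite.

(** * Bochner integral *)

Section simple_functions.
Context d (T : measurableType d) (R : realType).
Implicit Types V W U : completeNormedModType R.

(** Both functions are constant on the finitely many joint fibres, so the preimage of any subset,
    with no measurability required of it, is a finite union of measurable sets. *)
Lemma simple_fun_pair V W (U : Type) (E : V -> W -> U) (s : T -> V) (t : T -> W) :
  simple_fun s -> simple_fun t ->
  finite_set (range (fun x => E (s x) (t x))) /\
  forall A, measurable ((fun x => E (s x) (t x)) @^-1` A).
Proof.
move=> [fs ms] [ft mt]; split.
  apply: (@sub_finite_set _ _ ((fun p => E p.1 p.2) @` (range s `*` range t))).
    by move=> _ [x _ <-]; exists (s x, t x).
  exact/finite_image/finite_setX.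
move=> A.
rewrite (_ : _ @^-1` A = \bigcup_(p in [set p | (range s `*` range t) p /\ A (E p.1 p.2)])
    (s @^-1` [set p.1] `&` t @^-1` [set p.2])).
  apply: fin_bigcup_measurable; last by move=> p _; exact: measurableI.
  by apply: (@sub_finite_set _ _ (range s `*` range t)); [move=> p []|exact: finite_setX].
apply/seteqP; split => [x /= Ax|x [p [_ Ap] [/= -> ->]]//].
by exists (s x, t x) => //; split => //; split; exists x.
Qed.

Lemma simple_fun_comp2 V W U (E : V -> W -> U) (s : T -> V) (t : T -> W) :
  simple_fun s -> simple_fun t -> simple_fun (fun x => E (s x) (t x)).
Proof. by move=> ss st; have [? m] := simple_fun_pair E ss st; split => // v; exact: m. Qed.

Lemma simple_fun_preimage V (s : T -> V) (A : set V) : simple_fun s -> measurable (s @^-1` A).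
Proof. by move=> ss; have [_] := simple_fun_pair (fun v _ => v) ss ss; exact. Qed.

Lemma simple_fun_indic V (A : set T) (v : V) : measurable A ->
  simple_fun (fun x => \1_A x *: v).
Proof.
move=> mA; split.
  apply: (@sub_finite_set _ _ [set 0; v]).
    by move=> _ [x _ <-]; rewrite indicE; case: (x \in A); [right|left]; rewrite /= ?scale1r ?scale0r.
  by rewrite finite_setU; split; exact: finite_set1.
move=> w; rewrite (_ : _ @^-1` _ = (A `&` [set _ | v = w]) `|` (~` A `&` [set _ | 0 = w])).
  apply: measurableU; apply: measurableI => //.
  - by have [vw|vw] := pselect (v = w); [rewrite (_ : [set _ | _] = setT)//|rewrite (_ : [set _ | _] = set0)//];
      apply/seteqP; split.
  - exact: measurableC.
  - by have [vw|vw] := pselect (0 = w); [rewrite (_ : [set _ | _] = setT)//|rewrite (_ : [set _ | _] = set0)//];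
      apply/seteqP; split.
apply/seteqP; split => x /=; rewrite indicE; case: (boolP (x \in A)).
- by rewrite scale1r => /set_mem; left.
- by rewrite scale0r => xA; right; split => // /mem_set; exact/negP.
- by move=> /set_mem xA [[]|[]]//; rewrite scale1r.
- by move=> /negP xA [[/mem_set]|[]]//; rewrite scale0r.
Qed.

Lemma simple_fun_scale_indic V (D : set T) (s : T -> V) : measurable D -> simple_fun s ->
  simple_fun (fun x => \1_D x *: s x).
Proof.
move=> mD ss.
have := simple_fun_comp2 (fun (a : R^o) v => a *: v) (simple_fun_indic (1 : R^o) mD) ss.
by congr simple_fun; apply/funext => x; rewrite /= [_ *: 1]mulr1.
Qed.

Lemma simple_fun_range V (s : T -> V) : simple_fun s ->
  exists2 r : seq V, uniq r & forall x, s x \in r.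
Proof.
move=> [/finite_seqP[r rE] _]; exists (undup r); first exact: undup_uniq.
move=> x; rewrite mem_undup. have : range s (s x) by exists x.
by rewrite rE.
Qed.

Section integral.
Variable mu : {measure set T -> \bar R}.

Let m (A : set T) : R := fine (mu A).

Lemma fine_measure_split V (s : T -> V) (r : seq V) (A : set T) : simple_fun s ->
  uniq r -> (forall x, s x \in r) -> measurable A -> (mu A < +oo)%E ->
  m A = \sum_(v <- r) m (A `&` s @^-1` [set v]).
Proof.
move=> ss ur sr mA Aoo.
have mAs v : measurable (A `&` s @^-1` [set v]).
  by apply: measurableI => //; exact: simple_fun_preimage.
rewrite {1}(_ : A = \bigcup_(v in [set` r]) (A `&` s @^-1` [set v])); last first.
  by rewrite -setI_bigcupr; apply/esym/setIidPl => x Ax; exists (s x) => //=; exact: sr.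
rewrite /m measure_fin_bigcup//=; last first.
  by move=> v w _ _ [x [[_ /= <-] [_ /= <-]]].
rewrite -fsbig_seq// sum_fine// => v _.
 rewrite ge0_fin_numE//; apply: le_lt_trans Aoo.
by apply: le_measure; rewrite ?inE.
Qed.

Lemma simple_integral_inE V (D : set T) (s : T -> V) (r : seq V) :
  uniq r -> (forall x, s x \in r) ->
  simple_integral mu D s = \sum_(v <- r) m (D `&` s @^-1` [set v]) *: v.
Proof.
move=> ur sr; rewrite /simple_integral [RHS]fsbig_seq//.
apply: fsbig_widen; first by move=> _ [x _ <-]; exact: sr.
move=> v [_ vs] /=; rewrite (_ : D `&` s @^-1` [set v] = set0) /m ?measure0 ?scale0r//.
by apply/seteqP; split => // x [_ xv]; apply: vs; exists x.
Qed.

Lemma simple_integralE V (s : T -> V) (r : seq V) : uniq r -> (forall x, s x \in r) ->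
  simple_integral mu setT s = \sum_(v <- r) m (s @^-1` [set v]) *: v.
Proof.
move=> ur sr; rewrite (simple_integral_inE _ ur sr).
by apply: eq_bigr => v _; rewrite setTI.
Qed.

Lemma simple_integrableP V (s : T -> V) :
  simple_integrable mu setT s <-> simple_fun s /\ (mu (s @^-1` [set~ 0%R]) < +oo)%E.
Proof.
split=> [[ss soo]|[ss soo]]; split => //.
  have [fs _] := ss.
  rewrite (_ : _ @^-1` _ = \bigcup_(v in range s `\ 0%R) (s @^-1` [set v])).
    rewrite measure_fin_bigcup//.
    - rewrite fsbig_finite/=; last exact: finite_setD.
      rewrite big_seq; apply: lte_sum_pinfty => v.
      by rewrite in_fset_set ?inE/=; [move=> [_ /eqP/soo]; rewrite setTI|exact: finite_setD].
    - exact: finite_setD.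
    - by move=> v w _ _ [x [/= -> ->]].
    - by move=> v _; exact: simple_fun_preimage.
  by apply/seteqP; split=> [x /= sx|x [v [_ v0] /= ->]//]; exists (s x) => //; split => //; exists x.
move=> v v0; rewrite setTI; apply: le_lt_trans soo; apply: le_measure; rewrite ?inE.
- exact: simple_fun_preimage.
- exact: simple_fun_preimage.
- by move=> x /= ->; exact/eqP.
Qed.

Lemma simple_integrable_comp2 V W U (E : V -> W -> U) (s : T -> V) (t : T -> W) :
  E 0 0 = 0 -> simple_integrable mu setT s -> simple_integrable mu setT t ->
  simple_integrable mu setT (fun x => E (s x) (t x)).
Proof.
move=> E0 /simple_integrableP[ss soo] /simple_integrableP[st too]; apply/simple_integrableP.
have sE := simple_fun_comp2 E ss st; split => //.
apply: (@le_lt_trans _ _ (mu (s @^-1` [set~ 0%R] `|` t @^-1` [set~ 0%R]))).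
  apply: le_measure; rewrite ?inE; first exact: simple_fun_preimage.
    by apply: measurableU; exact: simple_fun_preimage.
  move=> x /= Ex; have [sx|] := pselect (s x = 0); last by left.
  by right => tx; apply: Ex; rewrite sx tx.
apply: (le_lt_trans (measureU2 _ _ _)); try exact: simple_fun_preimage.
exact: lte_add_pinfty.
Qed.

(** The common refinement of the fibres of [s] and [t] serves every combination of them at once;
    linearity follows by comparing a linear [E] with the two projections. The condition [E 0 0 = 0]
    neutralises the joint zero fibre, which may have infinite measure. *)
Lemma simple_integral_joint V W U (E : V -> W -> U) (s : T -> V) (t : T -> W) r r' :
  E 0 0 = 0 -> simple_integrable mu setT s -> simple_integrable mu setT t ->
  uniq r -> (forall x, s x \in r) -> uniq r' -> (forall x, t x \in r') ->
  simple_integral mu setT (fun x => E (s x) (t x)) =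
  \sum_(v <- r) \sum_(w <- r') m (s @^-1` [set v] `&` t @^-1` [set w]) *: E v w.
Proof.
move=> E0 is_ it_ ur sr ur' tr'.
have /simple_integrableP[sE Eoo] := simple_integrable_comp2 E0 is_ it_.
have [ss _] := is_; have [st _] := it_.
pose r'' := undup [seq E v w | v <- r, w <- r'].
rewrite (@simple_integralE _ _ r''); last 2 first.
  exact: undup_uniq.
  by move=> x; rewrite mem_undup; apply: allpairs_f.
pose G u := (fun x => E (s x) (t x)) @^-1` [set u].
have mG u : measurable (G u) by exact: simple_fun_preimage.
(* [fine] is additive only on sets of finite measure. The fibre of [u = 0] may be infinite and is
   treated apart, since it multiplies the zero vector. *)
have split3 u : m (G u) *: u =
    \sum_(v <- r) \sum_(w <- r') m (G u `&` s @^-1` [set v] `&` t @^-1` [set w]) *: u.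
  have [->|/eqP u0] := eqVneq u 0.
    by rewrite scaler0 big1// => v _; rewrite big1// => w _; rewrite scaler0.
  have Goo : (mu (G u) < +oo)%E.
    by apply: le_lt_trans Eoo; apply: le_measure; rewrite ?inE//; [exact: simple_fun_preimage|move=> x /= ->].
  rewrite (fine_measure_split ss ur sr)// scaler_suml; apply: eq_bigr => v _.
  have mGs : measurable (G u `&` s @^-1` [set v]).
    by apply: measurableI => //; exact: simple_fun_preimage.
  rewrite (fine_measure_split st ur' tr')// ?scaler_suml//.
  by apply: le_lt_trans Goo; apply: le_measure; rewrite ?inE.
rewrite (eq_bigr _ (fun u _ => split3 u)) exchange_big/= big_seq [RHS]big_seq; apply: eq_bigr => v vr.
rewrite exchange_big/= big_seq [RHS]big_seq; apply: eq_bigr => w wr'.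
rewrite (bigD1_seq (E v w))/= ?undup_uniq//; last by rewrite mem_undup; exact: allpairs_f.
rewrite big1 ?addr0; last first.
  move=> u uE; rewrite (_ : _ `&` _ = set0) /m ?measure0 ?scale0r//.
  apply/seteqP; split => // x [[/= Gx sx] tx]; move/eqP: uE; apply.
  by rewrite -Gx sx tx.
congr (m _ *: _); apply/seteqP; split => x; first by move=> [[_ ?] ?].
by move=> [/= sx tx]; split => //; split => //; rewrite /G/= sx tx.
Qed.

Lemma simple_integral_linear V (a : R) (s t : T -> V) :
  simple_integrable mu setT s -> simple_integrable mu setT t ->
  simple_integral mu setT (fun x => a *: s x + t x) =
  a *: simple_integral mu setT s + simple_integral mu setT t.
Proof.
move=> is_ it_; have [ss _] := is_; have [st _] := it_.
have [r ur sr] := simple_fun_range ss; have [r' ur' tr'] := simple_fun_range st.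
rewrite (simple_integral_joint (E := fun v w => a *: v + w) _ is_ it_ ur sr ur' tr') ?scaler0 ?addr0//.
rewrite (simple_integral_joint (E := fun v w => v) _ is_ it_ ur sr ur' tr')//.
rewrite (simple_integral_joint (E := fun v w => w) _ is_ it_ ur sr ur' tr')//.
rewrite scaler_sumr -big_split/=; apply: eq_bigr => v _.
rewrite scaler_sumr -big_split/=; apply: eq_bigr => w _.
by rewrite scalerDr !scalerA mulrC.
Qed.

Lemma integral_simple_norm V (s : T -> V) (r : seq V) : simple_integrable mu setT s ->
  uniq r -> (forall x, s x \in r) ->
  (\int[mu]_x `|s x|%:E = \sum_(v <- r) (m (s @^-1` [set v]) * `|v|)%:E)%E.
Proof.
move=> [ss soo] ur sr.
transitivity (\int[mu]_x \sum_(v <- r) (`|v| * \1_(s @^-1` [set v]) x)%:E)%E.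
  apply: eq_integral => x _; rewrite (bigD1_seq (s x))//= big1 ?adde0.
    by rewrite indicE mem_set// mulr1.
  by move=> v /eqP vs; rewrite indicE memNset ?mulr0//= => /esym.
rewrite ge0_integral_sum//; last first.
  move=> v; apply/measurable_EFinP; apply: measurable_funM => //.
  by apply: measurable_indic; exact: simple_fun_preimage.
apply: eq_bigr => v _; under eq_integral do rewrite EFinM.
rewrite ge0_integralZl//; last first.
  by apply/measurable_EFinP; apply: measurable_indic; exact: simple_fun_preimage.
rewrite integral_indic ?setIT//; last exact: simple_fun_preimage.
have [->|v0] := eqVneq v 0; first by rewrite normr0 mul0e mulr0.
have sv : mu (s @^-1` [set v]) \is a fin_num.
  by rewrite ge0_fin_numE//; have := soo v v0; rewrite setTI.
by rewrite EFinM [X in (X * _)%E = _]/= muleC /m fineK.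
Qed.

Lemma integral_simple_norm_lty V (s : T -> V) : simple_integrable mu setT s ->
  (\int[mu]_x `|s x|%:E < +oo)%E.
Proof.
move=> is_; have [r ur sr] := simple_fun_range is_.1.
by rewrite (integral_simple_norm is_ ur sr) sumEFin ltry.
Qed.

Lemma le_simple_integral_norm V (s : T -> V) : simple_integrable mu setT s ->
  (`|simple_integral mu setT s|%:E <= \int[mu]_x `|s x|%:E)%E.
Proof.
move=> is_; have [r ur sr] := simple_fun_range is_.1.
rewrite (integral_simple_norm is_ ur sr).
rewrite sumEFin lee_fin (simple_integralE ur sr); apply: le_trans (ler_norm_sum _ _ _) _.
by apply: ler_sum => v _; rewrite normrZ ger0_norm// /m fine_ge0.
Qed.

Lemma simple_integral_indic V (A : set T) (v : V) : measurable A -> (mu A < +oo)%E ->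
  simple_integrable mu setT (fun x => \1_A x *: v) /\
  simple_integral mu setT (fun x => \1_A x *: v) = m A *: v.
Proof.
move=> mA Aoo; have sA := simple_fun_indic v mA; split.
  apply/simple_integrableP; split => //; apply: le_lt_trans Aoo.
  apply: le_measure; rewrite ?inE//; first exact: simple_fun_preimage.
  move=> x /=; rewrite indicE; have [/set_mem//|_] := boolP (x \in A).
  by rewrite scale0r.
have [->|v0] := eqVneq v 0.
  rewrite scaler0 (@simple_integralE _ _ [:: 0])//; first by rewrite big_seq1 scaler0.
  by move=> x; rewrite scaler0 inE.
rewrite (@simple_integralE _ _ [:: 0; v])//=; last 2 first.
- by rewrite inE eq_sym v0.
- by move=> x; rewrite indicE !inE; case: (x \in A); rewrite ?scale1r ?scale0r eqxx ?orbT.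
rewrite big_cons big_seq1 scaler0 add0r; congr (m _ *: _).
apply/seteqP; split => x /=; rewrite indicE; last by move=> /mem_set ->; rewrite scale1r.
have [/set_mem//|_] := boolP (x \in A).
by rewrite scale0r => /esym/eqP; rewrite (negbTE v0).
Qed.

Lemma simple_integral_restrict V (D : set T) (s : T -> V) : measurable D -> simple_fun s ->
  simple_integral mu D s = simple_integral mu setT (fun x => \1_D x *: s x).
Proof.
move=> mD ss; have [r ur sr] := simple_fun_range ss.
have ur' := undup_uniq (0 :: r); set r' := undup _ in ur'.
rewrite (@simple_integral_inE _ _ _ r')//; last by move=> x; rewrite mem_undup inE sr orbT.
rewrite (@simple_integralE _ _ r')//; last first.
  move=> x; rewrite mem_undup inE indicE; case: (x \in D); first by rewrite scale1r sr orbT.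
  by rewrite scale0r eqxx.
apply: eq_bigr => v _; have [->|/eqP v0] := eqVneq v 0; first by rewrite !scaler0.
congr (m _ *: _); apply/seteqP; split => x /=.
  by move=> [Dx sx]; rewrite indicE mem_set// scale1r.
rewrite indicE; have [/set_mem xD|_] := boolP (x \in D); first by rewrite scale1r.
by rewrite scale0r => /esym.
Qed.

Lemma simple_integrable_restrict V (D : set T) (s : T -> V) : measurable D ->
  simple_integrable mu D s -> simple_integrable mu setT (fun x => \1_D x *: s x).
Proof.
move=> mD [ss soo]; have sD := simple_fun_scale_indic mD ss; split => // v v0.
apply: le_lt_trans (soo v v0); apply: le_measure; rewrite ?inE ?setTI.
- exact: simple_fun_preimage.
- by apply: measurableI => //; exact: simple_fun_preimage.
move=> x /=; rewrite indicE; have [/set_mem xD|_] := boolP (x \in D).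
  by rewrite scale1r.
by rewrite scale0r => /esym/eqP; rewrite (negbTE v0).
Qed.

End integral.
End simple_functions.

Section strong_measurability.
Context d (T : measurableType d) (R : realType).
Variables (mu : {measure set T -> \bar R}).
Implicit Types (V W U : completeNormedModType R) (D : set T).

Lemma strongly_measurable_comp2 V W U D (E : V -> W -> U) (u : T -> V) (w : T -> W) :
  (forall (a : nat -> V) (b : nat -> W) v v', a @ \oo --> v -> b @ \oo --> v' ->
    (fun k => E (a k) (b k)) @ \oo --> E v v') ->
  strongly_measurable mu D u -> strongly_measurable mu D w ->
  strongly_measurable mu D (fun x => E (u x) (w x)).
Proof.
move=> cE [s [ss su]] [t [st tw]]; exists (fun k x => E (s k x) (t k x)); split.
  by move=> k; exact: simple_fun_comp2.
by apply: filterS2 su tw => x sx tx Dx; apply: cE; [exact: sx|exact: tx].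
Qed.

Lemma strongly_measurable_comp V U D (E : V -> U) (u : T -> V) :
  continuous E -> strongly_measurable mu D u -> strongly_measurable mu D (E \o u).
Proof.
move=> cE su; apply: (strongly_measurable_comp2 (E := fun v _ => E v) _ su su).
by move=> a b v v' av _; apply: (cvg_comp _ _ av); exact: cE.
Qed.

Lemma strongly_measurableD V D (u w : T -> V) :
  strongly_measurable mu D u -> strongly_measurable mu D w ->
  strongly_measurable mu D (fun x => u x + w x).
Proof. by apply: (strongly_measurable_comp2 (E := fun a b => a + b)) => *; exact: cvgD. Qed.

Lemma strongly_measurableB V D (u w : T -> V) :
  strongly_measurable mu D u -> strongly_measurable mu D w ->
  strongly_measurable mu D (fun x => u x - w x).
Proof. by apply: (strongly_measurable_comp2 (E := fun a b => a - b)) => *; exact: cvgB. Qed.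

Lemma strongly_measurableZ V D (phi : T -> R^o) (u : T -> V) :
  strongly_measurable mu D phi -> strongly_measurable mu D u ->
  strongly_measurable mu D (fun x => phi x *: u x).
Proof. by apply: (strongly_measurable_comp2 (E := fun (a : R^o) b => a *: b)) => *; exact: cvgZ. Qed.

Lemma strongly_measurable_cst V D (v : V) : strongly_measurable mu D (fun=> v).
Proof.
exists (fun _ _ => v); split; last by apply: aeW => x _; exact: cvg_cst.
move=> k; rewrite (_ : (fun=> v) = (fun x => \1_[set: T] x *: v)); first exact: simple_fun_indic.
by apply/funext => x; rewrite indicE in_setT scale1r.
Qed.

Lemma strongly_measurable_ae V D (u w : T -> V) :
  {ae mu, forall x, D x -> u x = w x} ->
  strongly_measurable mu D u -> strongly_measurable mu D w.
Proof.
move=> uw [s [ss su]]; exists s; split => //.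
by apply: filterS2 uw su => x uwx sx Dx; rewrite -uwx//; exact: sx.
Qed.

Lemma strongly_measurableS V D D' (u : T -> V) : D `<=` D' ->
  strongly_measurable mu D' u -> strongly_measurable mu D u.
Proof.
move=> DD' [s [ss su]]; exists s; split => //.
by apply: filterS su => x sx Dx; apply: sx; exact: DD'.
Qed.

Lemma measurable_strongly_measurable D (phi : T -> R) : measurable_fun setT phi ->
  strongly_measurable mu D (phi : T -> R^o).
Proof.
move=> mphi.
have /measurable_EFinP mphi' := mphi.
have [g gphi] := approximation_sfun measurableT mphi'.
exists (fun k => g k : T -> R^o); split.
  by move=> k; split; [exact: fimfunP|move=> v; exact: measurable_sfunP].
apply: aeW => x _; have /fine_cvgP[_] := gphi x Logic.I; exact.
Qed.

Lemma strongly_measurable_indic V D D' (u : T -> V) : measurable D ->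
  strongly_measurable mu D u -> strongly_measurable mu D' (fun x => \1_D x *: u x).
Proof.
move=> mD [s [ss su]]; exists (fun k x => \1_D x *: s k x); split.
  move=> k; have s1 := @simple_fun_indic _ _ _ R^o _ 1 mD.
  rewrite (_ : (fun x => _) = (fun x => (\1_D x *: (1 : R^o)) *: s k x)).
    exact: (simple_fun_comp2 (fun (a : R^o) b => a *: b) s1 (ss k)).
  by apply/funext => x; rewrite /GRing.scale/= mulr1.
apply: filterS su => x sx _; rewrite indicE.
have [/set_mem xD|xD] := boolP (x \in D).
  by under eq_fun do rewrite scale1r; rewrite scale1r; exact: sx.
by under eq_fun do rewrite scale0r; rewrite scale0r; exact: cvg_cst.
Qed.

Hypothesis mu_complete : measure_is_complete mu.

Lemma ae_eq_measurable (f g : T -> R) : {ae mu, forall x, f x = g x} ->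
  measurable_fun setT f -> measurable_fun setT g.
Proof.
move=> fg /measurable_EFinP mf; apply/measurable_EFinP.
apply: (ae_measurable_fun mu_complete _ mf).
by apply: filterS fg => x fgx _ /=; rewrite fgx.
Qed.

(** Off the null set [N] the norm is a pointwise limit of norms of simple functions; completeness of
    [mu] allows any values on [N]. *)
Lemma strongly_measurable_norm V (u : T -> V) : strongly_measurable mu setT u ->
  measurable_fun setT (fun x => `|u x|).
Proof.
move=> [s [ss [N [mN N0 suN]]]].
apply: (@ae_eq_measurable (fun x => \1_(~` N) x * `|u x|)).
  exists N; split => // x /= xN; apply: contrapT => Nx; apply: xN.
  by rewrite indicE mem_set// mul1r.
apply: (@measurable_fun_cvg _ _ _ _ (fun k x => \1_(~` N) x * `|s k x|)).
  move=> k; apply: measurable_funM.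
    by apply: measurable_indic; exact: measurableC.
  move=> _ B mB; rewrite setTI -[_ @^-1` _]/(s k @^-1` [set v | B `|v|]).
  exact: simple_fun_preimage.
move=> x _; have [Nx|Nx] := pselect (N x).
  rewrite indicE memNset; last by move=> /(_ Nx).
  by rewrite mul0r; under eq_fun do rewrite mul0r; exact: cvg_cst.
apply: cvgM; first exact: cvg_cst.
apply: cvg_norm; apply: contrapT => sx; apply: Nx; apply: suN => /= /(_ Logic.I).
by [].
Qed.

End strong_measurability.

Section extended_limits.
Context {R : realType}.

Lemma cvge0_lt (f : nat -> \bar R) : f @ \oo --> 0%E ->
  forall e : R, 0 < e -> \forall k \near \oo, (f k < e%:E)%E.
Proof.
move=> /fine_cvgP[ffin f0] e e0.
move/cvgr0_norm_lt : f0 => /(_ _ e0); apply: filterS2 ffin => k fk.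
by rewrite /= ltr_norml => /andP[_]; rewrite -lte_fin fineK.
Qed.

Lemma lt_cvge0 (f : nat -> \bar R) : (forall k, 0 <= f k)%E ->
  (forall e : R, 0 < e -> \forall k \near \oo, (f k < e%:E)%E) -> f @ \oo --> 0%E.
Proof.
move=> f0 fe; apply/fine_cvgP; split.
  apply: filterS (fe 1 ltr01) => k fk1.
  by rewrite ge0_fin_numE// (lt_trans fk1)// ltry.
apply/cvgrPdist_lt => e e0; apply: filterS (fe e e0) => k fke.
rewrite sub0r normrN /= ger0_norm ?fine_ge0// -lte_fin fineK//.
by rewrite ge0_fin_numE// (lt_trans fke)// ltry.
Qed.

Lemma cauchy_seq_cvg (V : completeNormedModType R) (a : nat -> V) :
  (forall e : R, 0 < e -> exists K, forall i j, (K <= i)%N -> (K <= j)%N -> `|a i - a j| < e) ->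
  cvg (a @ \oo).
Proof.
move=> aC; apply/cauchy_cvgP; apply: cauchy_exP => e e0.
have [K aK] := aC e e0; exists (a K); exists K => // k /= Kk.
by rewrite -ball_normE /ball_/=; apply: aK.
Qed.

End extended_limits.

Section bochner_theory.
Context d (T : measurableType d) (R : realType) (mu : {measure set T -> \bar R}).
Hypothesis mu_complete : measure_is_complete mu.
Implicit Types V W : completeNormedModType R.

Local Notation SM := (strongly_measurable mu setT).
Local Notation L1 := (bochner_L1 mu setT).

Lemma strongly_measurable_enorm V (u : T -> V) : SM u -> measurable_fun setT (fun x => `|u x|%:E).
Proof. by move=> su; apply/measurable_EFinP; exact: (strongly_measurable_norm mu_complete). Qed.

Lemma le_integral_normD V (u w : T -> V) : SM u -> SM w ->
  (\int[mu]_x `|u x + w x|%:E <= \int[mu]_x `|u x|%:E + \int[mu]_x `|w x|%:E)%E.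
Proof.
move=> su sw; rewrite -ge0_integralD//; try exact: strongly_measurable_enorm.
apply: ge0_le_integral => //.
- by apply: strongly_measurable_enorm; exact: strongly_measurableD.
- by apply: emeasurable_funD; exact: strongly_measurable_enorm.
- by move=> x _; rewrite -EFinD lee_fin ler_normD.
Qed.

Lemma le_integral_normB V (u w y : T -> V) : SM u -> SM w -> SM y ->
  (\int[mu]_x `|u x - y x|%:E <= \int[mu]_x `|u x - w x|%:E + \int[mu]_x `|w x - y x|%:E)%E.
Proof.
move=> su sw sy.
rewrite [leLHS](_ : _ = \int[mu]_x `|(u x - w x) + (w x - y x)|%:E)%E; last first.
  by apply: eq_integral => x _; rewrite addrA subrK.
by apply: le_integral_normD; exact: strongly_measurableB.
Qed.

Lemma integral_normZ V (a : R) (u : T -> V) : SM u ->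
  (\int[mu]_x `|a *: u x|%:E = `|a|%:E * \int[mu]_x `|u x|%:E)%E.
Proof.
move=> su; rewrite -ge0_integralZl//; last exact: strongly_measurable_enorm.
by apply: eq_integral => x _; rewrite normrZ EFinM.
Qed.

Lemma bochner_L1_linear V (a : R) (u w : T -> V) : L1 u -> L1 w -> L1 (fun x => a *: u x + w x).
Proof.
move=> [su uoo] [sw woo].
have sau : SM (fun x => a *: u x) by apply: strongly_measurableZ => //; exact: strongly_measurable_cst.
split; first exact: strongly_measurableD.
apply: le_lt_trans (le_integral_normD sau sw) _; apply: lte_add_pinfty => //.
by rewrite integral_normZ// lte_mul_pinfty.
Qed.

Lemma bochner_L1_le V W (u : T -> V) (w : T -> W) : SM u -> L1 w ->
  {ae mu, forall x, `|u x| <= `|w x|} -> L1 u.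
Proof.
move=> su [sw woo] uw; split => //; apply: le_lt_trans woo.
apply: ae_ge0_le_integral => //; try exact: strongly_measurable_enorm.
by apply: filterS uw => x uwx _; rewrite lee_fin.
Qed.

Lemma simple_strongly_measurable V (s : T -> V) : simple_fun s -> SM s.
Proof.
by move=> ss; exists (fun=> s); split => //; apply: aeW => x _; exact: cvg_cst.
Qed.

Lemma simple_L1P V (s : T -> V) : simple_integrable mu setT s <-> simple_fun s /\ L1 s.
Proof.
split=> [is_|[ss [su soo]]].
  split; first by have [] := is_.
  by split; [exact: (simple_strongly_measurable is_.1)|exact: integral_simple_norm_lty].
split => // v v0; rewrite setTI.
have ms : measurable (s @^-1` [set v]) by exact: simple_fun_preimage.
have : (`|v|%:E * mu (s @^-1` [set v]) < +oo)%E.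
  apply: le_lt_trans soo.
  rewrite -(setIT (s @^-1` _)) -integral_indic// -ge0_integralZl//; last first.
    by apply/measurable_EFinP; exact: measurable_indic.
  apply: ge0_le_integral => //.
  - by apply/measurable_EFinP; apply: measurable_funM => //; exact: measurable_indic.
  - exact: strongly_measurable_enorm.
  - move=> x _; rewrite -EFinM lee_fin indicE.
    have [/set_mem /= ->|_] := boolP (x \in _); first by rewrite mulr1.
    by rewrite mulr0.
rewrite !ltey; apply: contra => /eqP ->.
by rewrite gt0_muley// lte_fin normr_gt0.
Qed.

(** A simple sequence converging almost everywhere need not converge in L^1, so [s k] is set to 0
    wherever its norm exceeds twice that of [u]. Where [u] is nonzero this eventually changes
    nothing, where [u] vanishes it gives 0, and three times the norm of [u] dominates the
    differences. *)
Lemma bochner_approx V (u : T -> V) : L1 u -> exists s : nat -> T -> V,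
  (forall k, simple_integrable mu setT (s k)) /\
  (\int[mu]_x `|u x - s k x|%:E)%E @[k --> \oo] --> 0%E.
Proof.
move=> [su uoo]; have [s [ss scv]] := su.
pose A k := [set x | `|s k x| <= 2 * `|u x|].
have mA k : measurable (A k).
  rewrite -[A k]setTI; apply: measurable_fun_le => //.
    by apply: (strongly_measurable_norm mu_complete); exact: simple_strongly_measurable.
  by apply: measurable_funM => //; exact: (strongly_measurable_norm mu_complete).
pose t k x := \1_(A k) x *: s k x.
have st k : simple_fun (t k).
  have s1 := simple_fun_indic (1 : R^o) (mA k).
  rewrite (_ : t k = (fun x => (\1_(A k) x *: (1 : R^o)) *: s k x)).
    exact: (simple_fun_comp2 (fun (a : R^o) b => a *: b) s1 (ss k)).
  by apply/funext => x; rewrite /t /GRing.scale/= mulr1.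
have tu k x : `|t k x| <= 2 * `|u x|.
  rewrite /t indicE; have [/set_mem//|_] := boolP (x \in A k); first by rewrite scale1r.
  by rewrite scale0r normr0 mulr_ge0.
have tcv : {ae mu, forall x, t ^~ x @ \oo --> u x}.
  apply: filterS scv => x /(_ Logic.I) sx.
  have [ux0|ux0] := eqVneq (u x) 0.
    rewrite (_ : t ^~ x = fun=> u x); first exact: cvg_cst.
    apply/funext => k; have := tu k x; rewrite ux0 normr0 mulr0 normr_le0.
    by move=> /eqP.
  have u0 : 0 < `|u x| by rewrite normr_gt0.
  have /cvgrPdist_lt/(_ _ u0) near_sx := sx.
  apply: cvg_trans sx; apply: near_eq_cvg.
  apply: filterS near_sx => k uk; rewrite /t indicE mem_set ?scale1r//= /A/=.
  have := ler_distD (u x) (s k x) 0; rewrite !subr0 distrC; lra.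
have tL1 k : L1 (t k).
  apply: (@bochner_L1_le _ _ _ (fun x => 2 *: u x)).
  - exact: simple_strongly_measurable.
  - have := @bochner_L1_linear _ 1 u u (conj su uoo) (conj su uoo).
    by congr (bochner_L1 _ _ _); apply/funext => x; rewrite scale1r scaler_nat mulr2n.
  - by apply: aeW => x; rewrite [leRHS]normrZ ger0_norm//; exact: tu.
exists t; split; first by move=> k; apply/simple_L1P.
have mut k : measurable_fun setT (fun x => `|u x - t k x|%:E).
  apply: strongly_measurable_enorm; apply: strongly_measurableB => //.
  exact: simple_strongly_measurable.
have := @dominated_convergence _ _ _ mu setT measurableT (fun k x => `|u x - t k x|%:E)
  (cst 0%E) (fun x => (3 * `|u x|)%:E) mut (measurable_cst _).
case.
- apply: filterS tcv => x tx _; apply/fine_cvgP; split; first by apply: nearW.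
  rewrite -(@normr0 _ V) -(subrr (u x)); apply: cvg_norm; apply: cvgB => //; exact: cvg_cst.
- apply/integrableP; split.
    by apply/measurable_EFinP; apply: measurable_funM => //; exact: (strongly_measurable_norm mu_complete).
  under eq_integral => x _ do rewrite gee0_abs ?lee_fin ?mulr_ge0// EFinM.
  rewrite ge0_integralZl//; last exact: strongly_measurable_enorm.
  exact: lte_mul_pinfty.
- apply: aeW => x k _; rewrite gee0_abs// lee_fin.
  by have := ler_normB (u x) (t k x); have := tu k x; lra.
by move=> _ _; rewrite integral0.
Qed.

Local Notation IB := (is_bochner_integral mu setT).
Local Notation SI := (simple_integral mu setT).

(** The basic estimate of the theory: existence of the integral (as a Cauchy criterion for simple
    functions), uniqueness (the case [w = u]) and the norm bound are all read off from it. *)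
Lemma le_bochner_dist V (u w : T -> V) I J : IB u I -> IB w J ->
  (`|I - J|%:E <= \int[mu]_x `|u x - w x|%:E)%E.
Proof.
move=> [su [s [is_ us sI]]] [sw [t [it_ wt tJ]]].
apply/lee_addgt0Pr => e e0.
(* Four errors: two between [I], [J] and the integrals of simple functions, two in the L^1 distance
   to these simple functions. *)
have e4 : 0 < e / 4 by rewrite divr_gt0.
near \oo => k.
have HI : `|I - SI (s k)| < e / 4 by near: k; move/cvgrPdist_lt : sI; exact.
have HJ : `|J - SI (t k)| < e / 4 by near: k; move/cvgrPdist_lt : tJ; exact.
have Hu : (\int[mu]_x `|u x - s k x|%:E < (e / 4)%:E)%E by near: k; exact: cvge0_lt.
have Hw : (\int[mu]_x `|w x - t k x|%:E < (e / 4)%:E)%E by near: k; exact: cvge0_lt.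
have ss := simple_strongly_measurable (is_ k).1.
have st := simple_strongly_measurable (it_ k).1.
have IJ : `|I - J| <= e / 4 + `|SI (s k) - SI (t k)| + e / 4.
  have -> : I - J = (I - SI (s k)) + (SI (s k) - SI (t k)) - (J - SI (t k)).
    by rewrite addrA subrK opprB addrA subrK.
  apply: le_trans (ler_normB _ _) _; apply: lerD; last exact: ltW.
  by apply: le_trans (ler_normD _ _) _; rewrite lerD2r ltW.
have st_le : (`|SI (s k) - SI (t k)|%:E <= \int[mu]_x `|s k x - t k x|%:E)%E.
  have := simple_integral_linear (-1) (it_ k) (is_ k).
  rewrite scaleN1r addrC => <-.
  apply: le_trans (le_simple_integral_norm _) _.
    apply: (simple_integrable_comp2 (E := fun a b => (-1) *: a + b) _ (it_ k) (is_ k)).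
    by rewrite scaler0 addr0.
  by rewrite le_eqVlt; apply/orP; left; apply/eqP/eq_integral => x _; rewrite scaleN1r addrC.
have ste : (\int[mu]_x `|s k x - t k x|%:E <=
   (e / 4)%:E + (\int[mu]_x `|u x - w x|%:E + (e / 4)%:E))%E.
  apply: le_trans (le_integral_normB ss su st) _; apply: leeD.
    by rewrite (eq_integral (fun x => `|u x - s k x|%:E)) ?ltW// => x _; rewrite distrC.
  by apply: le_trans (le_integral_normB su sw st) _; apply: leeD => //; exact: ltW.
apply: (@le_trans _ _ ((e / 4)%:E + ((e / 4)%:E + (\int[mu]_x `|u x - w x|%:E + (e / 4)%:E)) + (e / 4)%:E)%E).
  apply: (@le_trans _ _ (e / 4 + `|SI (s k) - SI (t k)| + e / 4)%:E); first by rewrite lee_fin.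
  by rewrite !EFinD leeD// leeD2l// (le_trans st_le).
rewrite le_eqVlt; apply/orP; left; apply/eqP.
by case: (\int[mu]_x `|u x - w x|%:E)%E => [q||]//; rewrite -!EFinD; congr (_%:E); field.
Unshelve. all: by end_near. Qed.

Lemma bochner_integral_exists V (u : T -> V) : L1 u -> exists I, IB u I.
Proof.
move=> Lu; have [su _] := Lu; have [s [is_ us]] := bochner_approx Lu.
suff /cvg_ex[I sI] : cvg (SI (s k) @[k --> \oo]) by exists I; split => //; exists s.
apply: cauchy_seq_cvg => e e0.
have e2 : 0 < e / 2 by rewrite divr_gt0.
have [K _ HK] := cvge0_lt us e2; exists K => i j Ki Kj; rewrite -lte_fin.
have IBs k : IB (s k) (SI (s k)).
  split; first exact: (simple_strongly_measurable (is_ k).1).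
  exists (fun=> s k); split => //; last exact: cvg_cst.
  under eq_fun do under eq_integral do rewrite subrr normr0.
  by under eq_fun do rewrite integral0; exact: cvg_cst.
apply: le_lt_trans (le_bochner_dist (IBs i) (IBs j)) _.
have ss k := simple_strongly_measurable (is_ k).1.
apply: le_lt_trans (le_integral_normB (ss i) su (ss j)) _.
rewrite (_ : e = e / 2 + e / 2); last by field.
rewrite EFinD; apply: lteD; last exact: HK.
by rewrite (eq_integral (fun x => `|u x - s i x|%:E)) ?HK// => x _; rewrite distrC.
Qed.

Lemma bochner_integral_uniq V (u : T -> V) I J : IB u I -> IB u J -> I = J.
Proof.
move=> uI uJ; apply/eqP; rewrite -subr_eq0 -normr_le0 -lee_fin.
apply: le_trans (le_bochner_dist uI uJ) _.
under eq_integral do rewrite subrr normr0.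
by rewrite integral0.
Qed.

Lemma bochner_integralP V (u : T -> V) : L1 u -> IB u (bochner_integral mu setT u).
Proof. by move=> /bochner_integral_exists[I uI]; by apply: (@xgetPex _ 0 [set I | IB u I]); exists I. Qed.

Lemma bochner_integralE V (u : T -> V) I : IB u I -> bochner_integral mu setT u = I.
Proof.
move=> uI; apply: (bochner_integral_uniq _ uI).
exact: (@xgetPex _ 0 [set I | IB u I] (ex_intro _ I uI)).
Qed.

Lemma bochner_integral_linear V (a : R) (u w : T -> V) : L1 u -> L1 w ->
  bochner_integral mu setT (fun x => a *: u x + w x) =
  a *: bochner_integral mu setT u + bochner_integral mu setT w.
Proof.
move=> Lu Lw; apply: bochner_integralE.
have [su [s [is_ us sI]]] := bochner_integralP Lu.
have [sw [t [it_ wt tJ]]] := bochner_integralP Lw.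
split; first by have [] := bochner_L1_linear a Lu Lw.
exists (fun k x => a *: s k x + t k x); split.
- by move=> k; apply: (simple_integrable_comp2 (E := fun b c => a *: b + c)) => //; rewrite scaler0 addr0.
- apply: lt_cvge0 => [k|e e0]; first exact: integral_ge0.
  have c0 : 0 < e / 2 / (`|a| + 1) by rewrite !divr_gt0// ltr_wpDl.
  have e2 : 0 < e / 2 by rewrite divr_gt0.
  apply: filterS2 (cvge0_lt us c0) (cvge0_lt wt e2) => k usk wtk.
  have ss := simple_strongly_measurable (is_ k).1.
  have st := simple_strongly_measurable (it_ k).1.
  have sus : SM (fun x => u x - s k x) by exact: strongly_measurableB.
  have swt : SM (fun x => w x - t k x) by exact: strongly_measurableB.
  have E x : a *: u x + w x - (a *: s k x + t k x) = a *: (u x - s k x) + (w x - t k x).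
    by rewrite scalerBr opprD addrACA.
  under eq_integral do rewrite E.
  apply: le_lt_trans (le_integral_normD _ swt) _.
    by apply: strongly_measurableZ => //; exact: strongly_measurable_cst.
  rewrite integral_normZ// (_ : e = e / 2 + e / 2); last by field.
  rewrite EFinD lee_ltD//; first by rewrite fin_num_abs gee0_abs ?mule_ge0 ?integral_ge0//
    lte_mul_pinfty// (lt_trans usk)// ltry.
  apply: (@le_trans _ _ (`|a|%:E * (e / 2 / (`|a| + 1))%:E)%E).
    by rewrite lee_wpmul2l// ltW.
  rewrite -EFinM lee_fin mulrA ler_pdivrMr ?ltr_wpDl// mulrC.
  by rewrite ler_wpM2l ?ltW// ltrDl.
- under eq_fun do rewrite simple_integral_linear//.
  exact: cvgD (cvgZ (cvg_cst _) sI) tJ.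
Qed.

Lemma le_bochner_integral_dist V (u w : T -> V) : L1 u -> L1 w ->
  (`|bochner_integral mu setT u - bochner_integral mu setT w|%:E <=
   \int[mu]_x `|u x - w x|%:E)%E.
Proof. by move=> Lu Lw; apply: le_bochner_dist; exact: bochner_integralP. Qed.

Lemma simple_is_bochner V (s : T -> V) : simple_integrable mu setT s -> IB s (SI s).
Proof.
move=> is_; split; first exact: (simple_strongly_measurable is_.1).
exists (fun=> s); split => //; last exact: cvg_cst.
under eq_fun do under eq_integral do rewrite subrr normr0.
by under eq_fun do rewrite integral0; exact: cvg_cst.
Qed.

Lemma bochner_integral_indic V (A : set T) (v : V) : measurable A -> (mu A < +oo)%E ->
  bochner_integral mu setT (fun x => \1_A x *: v) = fine (mu A) *: v.
Proof.
move=> mA Aoo; have [iA <-] := simple_integral_indic v mA Aoo.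
exact/bochner_integralE/simple_is_bochner.
Qed.

Lemma bochner_L1_0 V : L1 (fun=> 0 : V).
Proof.
split; first exact: strongly_measurable_cst.
by under eq_integral do rewrite normr0; rewrite integral0.
Qed.

Lemma bochner_integral0 V : bochner_integral mu setT (fun=> 0 : V) = 0.
Proof.
rewrite -[RHS](addNr (bochner_integral mu setT (fun=> 0 : V))) -scaleN1r.
rewrite -bochner_integral_linear; try exact: bochner_L1_0.
by congr (bochner_integral _ _ _); apply/funext => x; rewrite scaler0 addr0.
Qed.

Lemma le_bochner_integral_norm V (u : T -> V) : L1 u ->
  (`|bochner_integral mu setT u|%:E <= \int[mu]_x `|u x|%:E)%E.
Proof.
move=> Lu; have := le_bochner_integral_dist Lu (bochner_L1_0 V).
rewrite bochner_integral0 subr0; congr (_ <= _)%E.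
by apply: eq_integral => x _; rewrite subr0.
Qed.

Lemma ae_bochner_integral V (u w : T -> V) : {ae mu, forall x, u x = w x} ->
  L1 u -> L1 w /\ bochner_integral mu setT u = bochner_integral mu setT w.
Proof.
move=> uw Lu; have [su _] := Lu.
have Lw : L1 w.
  apply: (@bochner_L1_le _ _ _ u) => //; last by apply: filterS uw => x ->.
  by apply: strongly_measurable_ae su; apply: filterS uw => x uwx _.
split; first exact: Lw.
apply/eqP; rewrite -subr_eq0 -normr_le0 -lee_fin.
apply: le_trans (le_bochner_integral_dist Lu Lw) _.
rewrite (@ge0_ae_eq_integral _ _ _ mu setT _ (cst 0%E)) ?integral0//.
  by apply: strongly_measurable_enorm; apply: strongly_measurableB => //; case: Lw.
by apply: filterS uw => x -> _; rewrite subrr normr0.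
Qed.

(** No integrability is assumed: the two predicates given to [xget] have the same solutions, so the
    default value 0 is also taken on both sides together. *)
Lemma bochner_integral_restrict V (D : set T) (u : T -> V) : measurable D ->
  bochner_integral mu D u = bochner_integral mu setT (fun x => \1_D x *: u x).
Proof.
move=> mD; rewrite /bochner_integral; congr (xget 0 _).
have E (w : T -> V) : (\int[mu]_(x in D) `|u x - w x|%:E =
    \int[mu]_x `|\1_D x *: u x - \1_D x *: w x|%:E)%E.
  rewrite integral_mkcond; apply: eq_integral => x _; rewrite patchE indicE.
  by case: (x \in D); rewrite ?scale1r// !scale0r subrr normr0.
apply/seteqP; split=> I /=.
  move=> [su [s [is_ us sI]]]; split; first exact: strongly_measurable_indic.
  exists (fun k x => \1_D x *: s k x); split.
  - by move=> k; exact: simple_integrable_restrict.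
  - by under eq_fun do rewrite -E.
  - by under eq_fun => k do rewrite -(simple_integral_restrict _ mD (is_ k).1).
move=> uI; have [su [s [is_ us sI]]] := uI.
have sDs k : simple_integrable mu setT (fun x => \1_D x *: s k x).
  by apply: simple_integrable_restrict => //; split; [exact: (is_ k).1|
    move=> v v0; apply: le_lt_trans ((is_ k).2 v v0); apply: le_measure; rewrite ?inE;
    [apply: measurableI => //; exact: (simple_fun_preimage _ (is_ k).1)|
     apply: measurableI => //; exact: (simple_fun_preimage _ (is_ k).1)|exact: setSI]].
split.
  apply: strongly_measurable_ae (strongly_measurableS (@subsetT _ D) su).
  by apply: aeW => x Dx; rewrite indicE mem_set// scale1r.
have DD x (v : V) : \1_D x *: (\1_D x *: v) = \1_D x *: v.
  by rewrite indicE; case: (x \in D); rewrite ?scale1r ?scale0r.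
have le k : (\int[mu]_x `|\1_D x *: u x - \1_D x *: s k x|%:E <= \int[mu]_x `|\1_D x *: u x - s k x|%:E)%E.
  have ss := simple_strongly_measurable (is_ k).1.
  have ssD := simple_strongly_measurable (sDs k).1.
  apply: ge0_le_integral => //; try by apply: strongly_measurable_enorm; exact: strongly_measurableB.
  move=> x _; rewrite lee_fin indicE; case: (x \in D); rewrite ?scale1r// !scale0r subrr normr0//.
have cv : (\int[mu]_x `|\1_D x *: u x - \1_D x *: s k x|%:E)%E @[k --> \oo] --> 0%E.
  apply: lt_cvge0 => [k|e e0]; first exact: integral_ge0.
  by apply: filterS (cvge0_lt us e0) => k; apply: le_lt_trans.
exists (fun k x => \1_D x *: s k x); split.
- move=> k; split; first exact: (sDs k).1.
  move=> v v0; apply: le_lt_trans ((sDs k).2 v v0); apply: le_measure; rewrite ?inE.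
  + by apply: measurableI => //; exact: (simple_fun_preimage _ (sDs k).1).
  + by apply: measurableI => //; exact: (simple_fun_preimage _ (sDs k).1).
  + exact: setSI.
- by under eq_fun do rewrite E; under eq_fun do under eq_integral do rewrite DD.
have /cvgrPdist_lt sI' := sI.
under eq_fun => k do rewrite (simple_integral_restrict _ mD (sDs k).1).
under eq_fun => k do (under eq_fun => x do rewrite DD).
(* Cutting to [D] changes the integrals of [s k]. Their limit is still [I], because the cut
   functions still converge in L^1 to [u] cut to [D]. *)
apply/cvgrPdist_lt => e e0.
apply: filterS (cvge0_lt cv e0) => k Hk; rewrite -lte_fin; apply: le_lt_trans Hk.
exact: (le_bochner_dist uI (simple_is_bochner (sDs k))).
Qed.

Lemma bochner_integral_preserving V (g : T -> T) (u : T -> V) :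
  measurable_fun setT g -> (forall A, measurable A -> mu (g @^-1` A) = mu A) ->
  L1 u -> L1 (u \o g) /\
  bochner_integral mu setT (u \o g) = bochner_integral mu setT u.
Proof.
move=> mg gmu Lu.
have mgA A : measurable A -> measurable (g @^-1` A).
  by move=> mA; rewrite -[_ @^-1` _]setTI; exact: mg.
have sg (s : T -> V) : simple_fun s -> simple_fun (s \o g).
  move=> ss; split; first by apply: sub_finite_set ss.1 => _ [x _ <-]; exists (g x).
  by move=> v; rewrite comp_preimage; apply: mgA; exact: simple_fun_preimage.
have smg (w : T -> V) : SM w -> SM (w \o g).
  move=> [s [ss [N [mN N0 sN]]]]; exists (fun k => s k \o g); split; first by move=> k; exact: sg.
  exists (g @^-1` N); split; [exact: mgA|by rewrite gmu|].
  by move=> x /= gx; apply: sN => /= h; apply: gx => _; exact: h.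
have int_g (w : T -> V) : SM w -> (\int[mu]_x `|w (g x)|%:E = \int[mu]_x `|w x|%:E)%E.
  move=> sw; apply: (ge0_integral_measure_preserving mg gmu (f := fun x => `|w x|%:E)) => //.
  exact: strongly_measurable_enorm.
have Lug : L1 (u \o g) by case: Lu => su uoo; split; [exact: smg|rewrite int_g].
split; first exact: Lug.
apply: bochner_integralE.
have [su [s [is_ us sI]]] := bochner_integralP Lu.
split; first by case: Lug.
exists (fun k => s k \o g); split.
- move=> k; split; first exact: (sg _ (is_ k).1).
  move=> v v0; have := (is_ k).2 v v0; rewrite !setTI comp_preimage gmu//.
  exact: (simple_fun_preimage _ (is_ k).1).
- rewrite (_ : (fun k => _) = (fun k => \int[mu]_x `|u x - s k x|%:E)%E)//.
  apply/funext => k; rewrite -(int_g (fun x => u x - s k x))//.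
  apply: strongly_measurableB => //; exact: (simple_strongly_measurable (is_ k).1).
- rewrite (_ : (fun k => SI (s k \o g)) = (fun k => SI (s k)))//; apply/funext => k.
  have [r ur sr] := simple_fun_range (is_ k).1.
  rewrite (simple_integralE _ ur sr) (@simple_integralE _ _ _ mu _ (s k \o g) r)//; last by move=> x; exact: sr.
  apply: eq_bigr => v _; rewrite comp_preimage gmu//; exact: (simple_fun_preimage _ (is_ k).1).
Qed.

End bochner_theory.

(** * Weighted L^1 norms *)

Lemma measurable_lt_fun d (T : measurableType d) (R : realType) (f g : T -> R) :
  measurable_fun setT f -> measurable_fun setT g -> measurable [set x | f x < g x].
Proof.
move=> mf mg; rewrite (_ : [set x | _] = ~` (setT `&` [set x | g x <= f x])).
  by apply: measurableC; exact: measurable_fun_le.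
by rewrite setTI; apply/seteqP; split => x /=; rewrite ltNge => /negP.
Qed.

Lemma integral_scale_indic d (T : measurableType d) (R : realType) (mu : {measure set T -> \bar R})
    (A : set T) (c : R) : measurable A -> 0 <= c ->
  (\int[mu]_x (c * \1_A x)%:E = c%:E * mu A)%E.
Proof.
move=> mA c0; under eq_integral do rewrite EFinM.
rewrite ge0_integralZl//; first by rewrite integral_indic// setIT.
by apply/measurable_EFinP; exact: measurable_indic.
Qed.

Section domination.
Context d (T : measurableType d) (R : realType) (mu : {measure set T -> \bar R}).
Hypothesis mu_complete : measure_is_complete mu.
Variable V : completeNormedModType R.

Lemma bochner_L1_indic (A : set T) (w : T -> V) : measurable A ->
  bochner_L1 mu setT w -> bochner_L1 mu setT (fun x => \1_A x *: w x).
Proof.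
move=> mA Lw; apply: (bochner_L1_le mu_complete _ Lw).
  by apply: strongly_measurable_indic => //; case: Lw => sw _; exact: strongly_measurableS sw.
apply: aeW => x; rewrite indicE; case: (x \in A); first by rewrite scale1r.
by rewrite scale0r normr0.
Qed.

(* Testing on the sets where [w] is close to a vector [c] with [|c| > kap]. *)
Lemma bochner_integral_dominated (w : T -> V) (kap : T -> R) :
  bochner_L1 mu setT w -> measurable_fun setT kap ->
  (forall A, measurable A ->
    (`|bochner_integral mu setT (fun x => \1_A x *: w x)|%:E <=
     \int[mu]_(x in A) `|kap x|%:E)%E) ->
  {ae mu, forall x, `|w x| <= `|kap x| }.
Proof.
move=> Lw mkap wkap; have [sw woo] := Lw; have [s [ss scv]] := sw.
pose q m : R := m.+1%:R^-1.
have q0 m : 0 < q m by rewrite invr_gt0.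
(* The margin [2 * q m] is twice the approximation error. On the part of [B k m] where [s k] equals
   [c], of measure [M], the integral of [w] is within [q m * M] of [M *: c], while the hypothesis
   bounds it by [(|c| - 2 * q m) * M]. Together these give [q m * M <= 0]. *)
pose B k m := [set x | `|w x - s k x| < q m /\ `|kap x| < `|s k x| - 2 * q m].
have msk k : measurable_fun setT (fun x => `|s k x|).
  by apply: (strongly_measurable_norm mu_complete); exact: simple_strongly_measurable.
have mnkap : measurable_fun setT (fun x => `|kap x|) by exact: measurableT_comp.
have mB k m : measurable (B k m).
  rewrite (_ : B k m = [set x | `|w x - s k x| < q m] `&` [set x | `|kap x| < `|s k x| - 2 * q m])//.
  apply: measurableI; apply: measurable_lt_fun => //.
  - apply: (strongly_measurable_norm mu_complete); apply: strongly_measurableB => //.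
    exact: simple_strongly_measurable.
  - exact: measurable_funB.
have B0c k m c : mu (B k m `&` s k @^-1` [set c]) = 0%E.
  set A := _ `&` _.
  have mA : measurable A by apply: measurableI => //; exact: (simple_fun_preimage _ (ss k)).
  have Aw x : A x -> `|w x - c| < q m /\ `|kap x| < `|c| - 2 * q m.
    by move=> [[Bx1 Bx2] /= <-].
  (* On [A] the norm of [w] exceeds [q m], so integrability of [w] bounds the measure of [A]. *)
  have Aoo : (mu A < +oo)%E.
    have : ((q m)%:E * mu A < +oo)%E.
      apply: le_lt_trans woo.
      rewrite -(integral_scale_indic mu mA (ltW (q0 m))); apply: ge0_le_integral => //.
      - by move=> x _; rewrite lee_fin mulr_ge0// ltW.
      - by apply/measurable_EFinP; apply: measurable_funM => //; exact: measurable_indic.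
      - exact: (strongly_measurable_enorm mu_complete).
      move=> x _; rewrite lee_fin indicE.
      have [/set_mem/Aw[wx kx]|_] := boolP (x \in A); last by rewrite mulr0.
      rewrite mulr1; have := ler_distD (w x) c 0; rewrite !subr0 distrC.
      by have := normr_ge0 (kap x); lra.
    rewrite !ltey; apply: contra => /eqP ->.
    by rewrite gt0_muley// lte_fin.
  have Afin : mu A \is a fin_num by rewrite ge0_fin_numE.
  set M := fine (mu A).
  have ME : mu A = M%:E by rewrite /M fineK.
  have LA := bochner_L1_indic mA Lw.
  have [iA _] := simple_integral_indic c mA Aoo.
  have [_ LAc] := (@simple_L1P _ _ _ _ mu_complete _ _).1 iA.
  have d1 : `|bochner_integral mu setT (fun x => \1_A x *: w x) - M *: c| <= q m * M.
    rewrite -lee_fin -(bochner_integral_indic mu_complete c mA Aoo).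
    apply: le_trans (le_bochner_integral_dist mu_complete LA LAc) _.
    rewrite EFinM -ME -(integral_scale_indic mu mA (ltW (q0 m))); apply: ge0_le_integral => //.
    - apply: (strongly_measurable_enorm mu_complete); apply: strongly_measurableB.
        by case: LA.
      by case: LAc.
    - by apply/measurable_EFinP; apply: measurable_funM => //; exact: measurable_indic.
    move=> x _; rewrite lee_fin indicE.
    have [/set_mem/Aw[wx _]|_] := boolP (x \in A); first by rewrite !scale1r mulr1 ltW.
    by rewrite !scale0r subrr normr0 mulr0.
  have M0 : 0 <= M by rewrite fine_ge0.
  have d2 : `|bochner_integral mu setT (fun x => \1_A x *: w x)| <= (`|c| - 2 * q m) * M.
    (* On an empty [A] the coefficient [|c| - 2 * q m] may be negative; any point of [A] forces it
       to be nonnegative. *)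
    have [A0|/set0P[y Ay]] := eqVneq A set0.
      suff -> : (fun x => \1_A x *: w x) = (fun=> 0).
        by rewrite bochner_integral0// normr0 /M A0 measure0 mulr0.
      by apply/funext => x; rewrite A0 indic0 scale0r.
    have c0 : 0 <= `|c| - 2 * q m.
      by have [_ /ltW] := Aw _ Ay; apply: le_trans.
    rewrite -lee_fin; apply: le_trans (wkap A mA) _.
    rewrite EFinM -ME -integral_scale_indic//.
    rewrite integral_mkcond; apply: ge0_le_integral => //.
    - by move=> x _; rewrite patchE; case: ifP => _; rewrite lee_fin.
    - by apply/(measurable_restrictT _ mA); apply: measurable_funTS; exact/measurable_EFinP.
    - by apply/measurable_EFinP; apply: measurable_funM => //; exact: measurable_indic.
    move=> x _; rewrite patchE indicE.
    have [/set_mem/Aw[_ wx]|_] := boolP (x \in A); first by rewrite mulr1 lee_fin ltW.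
    by rewrite mulr0.
  have : M * `|c| <= (`|c| - 2 * q m) * M + q m * M.
    rewrite -{1}(ger0_norm M0) -normrZ.
    have := ler_distD (bochner_integral mu setT (fun x => \1_A x *: w x)) (M *: c) 0.
    rewrite !subr0 distrC; lra.
  rewrite ME => H; congr (_%:E); apply/eqP; rewrite eq_le M0 andbT.
  by rewrite -(pmulr_rle0 _ (q0 m)); lra.
have B0 k m : mu.-negligible (B k m).
  exists (B k m); split => //.
  have [r ur sr] := simple_fun_range (ss k).
  rewrite (_ : B k m = \bigcup_(c in [set` r]) (B k m `&` s k @^-1` [set c])).
    rewrite measure_fin_bigcup//; last 2 first.
    - by move=> c e _ _ [x [[_ /= <-] [_ /= <-]]].
    - by move=> c _; apply: measurableI => //; exact: (simple_fun_preimage _ (ss k)).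
    by apply: fsbig1 => c _; exact: B0c.
    exact: finite_seq.
  by rewrite -setI_bigcupr; apply/esym/setIidPl => x _; exists (s k x) => //=; exact: sr.
have : mu.-negligible (\bigcup_k \bigcup_m B k m).
  by apply: negligible_bigcup => k; apply: negligible_bigcup => m; exact: B0.
move=> /(negligibleU scv); apply: negligibleS => x /= xw.
have [sx|sx] := pselect ((fun k => s k x) @ \oo --> w x); last by left => /(_ Logic.I).
right; have {}xw : `|kap x| < `|w x| by rewrite ltNge; apply/negP.
(* A quarter of the gap pays for the error of [s k x] and for the margin of [B k m], with room to
   spare. *)
have e0 : 0 < (`|w x| - `|kap x|) / 4 by rewrite divr_gt0// subr_gt0.
have [m me] : exists m, q m < (`|w x| - `|kap x|) / 4.
  near \oo => m; exists m; near: m; exact: (near_infty_natSinv_lt (PosNum e0)).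
have [k kq] : exists k, `|w x - s k x| < q m.
  move/cvgrPdist_lt : sx => /(_ _ (q0 m)) [k _ Hk]; exists k; exact: (Hk k (leqnn k)).
exists k => //; exists m => //; split => //.
have := ler_distD (s k x) (w x) 0; rewrite !subr0; lra.
Unshelve. all: by end_near. Qed.

End domination.

Section weighted_L1.
Context d (T : measurableType d) (R : realType) (mu : {measure set T -> \bar R}).
Variable k : T -> R.
Hypotheses (mk : measurable_fun setT k) (k0 : forall x, 0 <= k x).
Implicit Types F G : T -> R.

Definition weighted_norm F := (\int[mu]_x (`|F x| * k x)%:E)%E.

Lemma measurable_weighted F : measurable_fun setT F ->
  measurable_fun setT (fun x => (`|F x| * k x)%:E).
Proof.
by move=> mF; apply/measurable_EFinP; apply: measurable_funM => //; exact: measurableT_comp.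
Qed.

Lemma weighted_normD F G : measurable_fun setT F -> measurable_fun setT G ->
  (weighted_norm (fun x => F x + G x)%R <= weighted_norm F + weighted_norm G)%E.
Proof.
move=> mF mG; rewrite /weighted_norm -ge0_integralD//; try exact: measurable_weighted;
  try by move=> x _; rewrite lee_fin mulr_ge0.
apply: ge0_le_integral => //.
- by move=> x _; rewrite lee_fin mulr_ge0.
- by apply: measurable_weighted; exact: measurable_funD.
- by apply: emeasurable_funD; exact: measurable_weighted.
- by move=> x _; rewrite -EFinD lee_fin -mulrDl ler_wpM2r// ler_normD.
Qed.

Lemma weighted_normZ a F : measurable_fun setT F ->
  (weighted_norm (fun x => a * F x)%R = `|a|%:E * weighted_norm F)%E.
Proof.
move=> mF; rewrite /weighted_norm -ge0_integralZl//; last 2 first.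
- exact: measurable_weighted.
- by move=> x _; rewrite lee_fin mulr_ge0.
by apply: eq_integral => x _; rewrite -EFinM normrM mulrA.
Qed.

Lemma le_weighted_norm F G : measurable_fun setT F -> measurable_fun setT G ->
  (forall x, k x != 0 -> `|F x| <= `|G x|) -> (weighted_norm F <= weighted_norm G)%E.
Proof.
move=> mF mG FG; apply: ge0_le_integral => //; try exact: measurable_weighted.
  by move=> x _; rewrite lee_fin mulr_ge0.
move=> x _; rewrite lee_fin; have [->|kx] := eqVneq (k x) 0; first by rewrite !mulr0.
by rewrite ler_wpM2r// FG.
Qed.

Lemma weighted_normDZ_lty a F G : measurable_fun setT F -> measurable_fun setT G ->
  (weighted_norm F < +oo)%E -> (weighted_norm G < +oo)%E ->
  (weighted_norm (fun x => a * F x + G x)%R < +oo)%E.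
Proof.
move=> mF mG Foo Goo; have maF : measurable_fun setT (fun x => a * F x) by exact: measurable_funM.
apply: le_lt_trans (weighted_normD maF mG) _; apply: lte_add_pinfty => //.
by rewrite weighted_normZ// lte_mul_pinfty.
Qed.

Lemma weighted_dominated (F_ : nat -> T -> R) F :
  (forall m, measurable_fun setT (F_ m)) -> measurable_fun setT F ->
  (weighted_norm F < +oo)%E ->
  (forall m x, k x != 0 -> `|F x - F_ m x| <= `|F x|) ->
  (forall x, k x != 0 -> F_ ^~ x @ \oo --> F x) ->
  weighted_norm (fun x => F x - F_ m x) @[m --> \oo] --> 0%E.
Proof.
move=> mF_ mF Foo FF Fcv.
have mFF m : measurable_fun setT (fun x => F x - F_ m x) by exact: measurable_funB.
have := @dominated_convergence _ _ _ mu setT measurableT (fun m x => (`|F x - F_ m x| * k x)%:E)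
  (cst 0%E) (fun x => (`|F x| * k x)%:E) (fun m => measurable_weighted (mFF m)) (measurable_cst _).
case.
- apply: aeW => x _; have [kx0|kx0] := eqVneq (k x) 0.
    by rewrite kx0; under eq_fun do rewrite mulr0; exact: cvg_cst.
  apply/fine_cvgP; split; first by apply: nearW.
  rewrite -[X in _ --> X](mul0r (k x)) -(@normr0 _ R^o) -(subrr (F x)).
  by apply: cvgMl; apply: cvg_norm; apply: cvgB; [exact: cvg_cst|exact: Fcv].
- apply/integrableP; split; first exact: measurable_weighted.
  by under eq_integral => x _ do rewrite gee0_abs ?lee_fin ?mulr_ge0//.
- apply: aeW => x m _; rewrite gee0_abs ?lee_fin ?mulr_ge0//.
  have [->|kx] := eqVneq (k x) 0; first by rewrite !mulr0.
  by rewrite ler_wpM2r// FF.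
by move=> _ _; rewrite integral0.
Qed.

Section induction_principle.
Variable P : (T -> R) -> Prop.
Hypothesis P_linear : forall a F G, measurable_fun setT F -> measurable_fun setT G ->
  (weighted_norm F < +oo)%E -> (weighted_norm G < +oo)%E ->
  P F -> P G -> P (fun x => a * F x + G x).
Hypothesis P_closed : forall F, measurable_fun setT F -> (weighted_norm F < +oo)%E ->
  (forall e, 0 < e -> exists G, [/\ measurable_fun setT G, (weighted_norm G < +oo)%E, P G &
    (weighted_norm (fun x => F x - G x)%R < e%:E)%E]) -> P F.
Variable B : nat -> set T.
Hypothesis mB : forall i, measurable (B i).
Hypothesis Bk : forall x, k x != 0 -> exists i, B i x.
Hypothesis Boo : forall i, (weighted_norm \1_(B i) < +oo)%E.
Hypothesis P_indic : forall A i, measurable A -> P \1_(A `&` B i).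

Let P0 : P (fun=> 0).
Proof.
have -> : (fun=> 0) = \1_(set0 `&` B 0) :> (T -> R) by rewrite set0I indic0.
exact: P_indic.
Qed.

Let norm_indic_lty A i : measurable A -> (weighted_norm \1_(A `&` B i) < +oo)%E.
Proof.
move=> mA; apply: le_lt_trans (Boo i); apply: le_weighted_norm => //.
- by apply: measurable_indic; exact: measurableI.
- move=> x _; rewrite !indicE in_setI; case: (x \in A) => //=.
  by rewrite normr0.
Qed.

(** The sets [B i] may overlap, so [A] is cut along the disjoint pieces [D i]. Finite sums of the
    indicators of the cuts are again indicators, and they converge to that of [A] in the weighted
    norm, since the points outside every [B i] have weight 0. *)
Let P_indic_all A : measurable A -> (weighted_norm \1_A < +oo)%E -> P \1_A.
Proof.
move=> mA Aoo.
pose D i := B i `\` \big[setU/set0]_(j < i) B j.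
have mU m : measurable (\big[setU/set0]_(i < m) B i).
  by apply: bigsetU_measurable => j _; exact: mB.
have mD i : measurable (D i) by exact: measurableD.
pose C i := A `&` D i.
have mC i : measurable (C i) by exact: measurableI.
pose G m x : R := \sum_(i < m) \1_(C i) x.
have mG m : measurable_fun setT (G m).
  by apply: measurable_sum => i; exact: measurable_indic.
have GE m x : G m x = \1_(A `&` \big[setU/set0]_(i < m) B i) x.
  elim: m => [|m IH]; first by rewrite /G !big_ord0 setI0 indic0.
  rewrite /G big_ord_recr/= -/(G m x) IH big_ord_recr/= !indicE.
  have memD : (x \in D m) = (x \in B m) && (x \notin \big[setU/set0]_(i < m) B i).
    by rewrite /D setDE in_setI in_setC.
  rewrite [x \in C m]in_setI memD [x \in A `&` \big[setU/set0]_(i < m) B i]in_setI.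
  rewrite [x \in A `&` (_ `|` _)]in_setI in_setU.
  by case: (x \in A); case: (x \in \big[setU/set0]_(i < m) B i); case: (x \in B m);
    rewrite /= ?addr0 ?add0r.
(* This form shows [C m] as a measurable set intersected with [B m], which is what [P_indic]
   accepts. *)
have CE m : C m = (A `&` ~` \big[setU/set0]_(i < m) B i) `&` B m.
  by rewrite /C /D setDE -setIA [B m `&` _]setIC.
have mCE m : measurable (A `&` ~` \big[setU/set0]_(i < m) B i).
  by apply: measurableI => //; exact: measurableC.
have GP m : (weighted_norm (G m) < +oo)%E /\ P (G m).
  elim: m => [|m [IH1 IH2]].
    rewrite (_ : G 0%N = fun=> 0); last by apply/funext => x; rewrite /G big_ord0.
    split => //; rewrite /weighted_norm.
    by under eq_integral do rewrite normr0 mul0r; rewrite integral0.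
  rewrite (_ : G m.+1 = (fun x => 1 * G m x + \1_(C m) x)); last first.
    by apply/funext => x; rewrite /G big_ord_recr/= mul1r.
  have Coo : (weighted_norm \1_(C m) < +oo)%E by rewrite CE; exact: norm_indic_lty.
  split; first by apply: weighted_normDZ_lty => //; exact: measurable_indic.
  apply: (P_linear _ (mG m) (measurable_indic (mC m)) IH1 Coo IH2).
  by rewrite CE; exact: P_indic.
apply: (P_closed (measurable_indic mA) Aoo) => e e0.
have cv : weighted_norm (fun x => \1_A x - G m x) @[m --> \oo] --> 0%E.
  apply: (weighted_dominated mG (measurable_indic mA) Aoo).
  - move=> m x _; rewrite GE !indicE in_setI; case: (x \in A) => /=; last by rewrite subr0.
    by case: (x \in _); rewrite ?subrr ?normr0 ?subr0.
  - move=> x kx; have [i Bix] := Bk kx.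
    apply: cvg_near_cst; exists i.+1 => // m /= im.
    rewrite GE !indicE in_setI (_ : x \in \big[setU/set0]_(i < m) B i); first by rewrite andbT.
    by apply/mem_set; rewrite -bigcup_mkord; exists i.
have [N _ HN] := cvge0_lt cv e0; have [GNoo PGN] := GP N.
by exists (G N); split => //; apply: HN => /=.
Qed.

Let P_ge0 F : measurable_fun setT F -> (weighted_norm F < +oo)%E -> (forall x, 0 <= F x) -> P F.
Proof.
move=> mF Foo F0.
have mF' : measurable_fun setT (EFin \o F) by exact/measurable_EFinP.
pose s := nnsfun_approx measurableT mF'.
have scv x : s ^~ x @ \oo --> F x.
  have /fine_cvgP[_] := cvg_nnsfun_approx measurableT mF' (fun x _ => F0 x : (0 <= (F x)%:E)%E) (Logic.I : setT x).
  exact.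
have sF m x : s m x <= F x.
  have nd : nondecreasing_seq (s ^~ x).
    by move=> i j ij; have /lefP := nd_nnsfun_approx measurableT mF' ij; exact.
  have := nondecreasing_cvgn_le nd (cvgP _ (scv x)) m.
  by rewrite (cvg_lim _ (scv x)).
have ms m : measurable_fun setT (s m) by [].
have s0 m x : 0 <= s m x by [].
have soo m : (weighted_norm (s m) < +oo)%E.
  by apply: le_lt_trans Foo; apply: le_weighted_norm => // x _; rewrite !ger0_norm.
have Ps m : P (s m).
  have [r rE] := (finite_seqP _).1 (@fimfunP _ _ (s m)).
  have ur := undup_uniq r.
  have sr x : s m x \in undup r.
    by rewrite mem_undup; have : range (s m) (s m x) by [exists x]; rewrite rE.
  pose S (l : seq R) x := \sum_(v <- l) v * \1_(s m @^-1` [set v]) x.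
  have sE : s m = S (undup r) :> (T -> R).
    apply/funext => x; rewrite /S (bigD1_seq (s m x))//= big1 ?addr0.
      by rewrite indicE mem_set// mulr1.
    by move=> v /eqP vs; rewrite indicE memNset ?mulr0//= => /esym.
  have ml (l : seq R) : measurable_fun setT (S l).
    by apply: measurable_sum => v; apply: measurable_funM => //; exact: measurable_indic.
  have voo v : v != 0 -> (weighted_norm \1_(s m @^-1` [set v]) < +oo)%E.
    move=> v0; have : (`|v|%:E * weighted_norm \1_(s m @^-1` [set v]) < +oo)%E.
      rewrite -weighted_normZ; last exact: measurable_indic.
      apply: le_lt_trans (soo m); apply: le_weighted_norm => //.
        by apply: measurable_funM => //; exact: measurable_indic.
      move=> x _; rewrite indicE; have [/set_mem /= ->|_] := boolP (x \in _).
        by rewrite mulr1.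
      by rewrite mulr0 normr0.
    rewrite !ltey; apply: contra => /eqP ->.
    by rewrite gt0_muley// lte_fin normr_gt0.
  suff : (weighted_norm (S (undup r)) < +oo)%E /\ P (S (undup r)) by rewrite -sE => -[].
  elim: (undup r) => [|v l [IH1 IH2]].
    rewrite (_ : S [::] = fun=> 0); last by apply/funext => x; rewrite /S big_nil.
    split => //; rewrite /weighted_norm.
    by under eq_integral do rewrite normr0 mul0r; rewrite integral0.
  have [v0|v0] := eqVneq v 0.
    rewrite (_ : S (v :: l) = S l)//.
    by apply/funext => x; rewrite /S big_cons v0 mul0r add0r.
  rewrite (_ : S (v :: l) = fun x => v * \1_(s m @^-1` [set v]) x + S l x); last first.
    by apply/funext => x; rewrite /S big_cons.
  have mv : measurable_fun setT (\1_(s m @^-1` [set v]) : T -> R) by exact: measurable_indic.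
  split; first exact: weighted_normDZ_lty (voo _ v0) IH1.
  by apply: P_linear (voo _ v0) IH1 _ IH2 => //; apply: P_indic_all (voo _ v0).
apply: P_closed => // e e0.
have cv : weighted_norm (fun x => F x - s m x) @[m --> \oo] --> 0%E.
  apply: weighted_dominated => // m x _.
  rewrite !ger0_norm//; first by rewrite lerBlDr lerDl.
  by rewrite subr_ge0.
have [N _ HN] := cvge0_lt cv e0.
by exists (s N); split => //; apply: HN => /=.
Qed.

(** Positive and negative parts reduce the claim to nonnegative functions, these to increasing
    simple functions, and these to indicators of finite weight. The principle is used twice: for the
    density of test functions, and for identifying a bounded functional with an integral. *)
Lemma weighted_induction F : measurable_fun setT F -> (weighted_norm F < +oo)%E -> P F.
Proof.
move=> mF Foo.
have mp : measurable_fun setT (fun x => Num.max (F x) 0%R) by exact: measurable_maxr.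
have mn : measurable_fun setT (fun x => Num.max (- F x)%R 0%R).
  by apply: measurable_maxr => //; exact: measurableT_comp.
have poo : (weighted_norm (fun x => Num.max (F x) 0%R) < +oo)%E.
  apply: le_lt_trans Foo; apply: le_weighted_norm => // x _.
  by have [Fx|Fx] := leP (F x) 0; rewrite ?normr0.
have noo : (weighted_norm (fun x => Num.max (- F x)%R 0%R) < +oo)%E.
  apply: le_lt_trans Foo; apply: le_weighted_norm => // x _.
  by have [Fx|Fx] := leP (- F x) 0; rewrite ?normr0// normrN.
rewrite (_ : F = (fun x => -1 * Num.max (- F x) 0 + Num.max (F x) 0)).
  apply: P_linear => //; apply: P_ge0 => // x; by rewrite le_max lexx orbT.
apply/funext => x; have [Fx|Fx] := leP (F x) 0; have [Fx'|Fx'] := leP (- F x) 0; lra.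
Qed.

End induction_principle.
End weighted_L1.

(** * Smooth functions and test functions *)

Section is_derive_facts.
Context {R : realType}.

Lemma is_deriveP (W V : normedModType R) (f : W -> V) (x v : W) (d : V) :
  is_derive x v f d <->
  (fun h : R => h^-1 *: (f (h *: v + x) - f x)) @ 0^' --> d.
Proof.
split=> [[fd <-]|fd]; first exact: fd.
by split; [exact: cvgP fd|exact: cvg_lim].
Qed.

Lemma is_derive_line (W V : normedModType R) (f : W -> V) (x v : W) (d : V) :
  is_derive x v f d <-> is_derive (0 : R) 1 (fun t : R => f (t *: v + x)) d.
Proof.
rewrite !is_deriveP; split; apply: cvg_trans; apply: near_eq_cvg; apply: nearW => h;
  by rewrite /= scale0r add0r addr0 [h *: 1]mulr1.
Qed.

Lemma is_derive_along (W V : normedModType R) (f : W -> V) (x v : W) (t : R) (d : V) :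
  is_derive (t *: v + x) v f d <-> is_derive t 1 (fun s : R => f (s *: v + x)) d.
Proof.
rewrite !is_deriveP; split; apply: cvg_trans; apply: near_eq_cvg; apply: nearW => h;
  by rewrite /= [h *: 1]mulr1 scalerDl addrA.
Qed.

End is_derive_facts.

Section flat_exponential.
Context {R : realType}.
Implicit Types (p : {poly R}) (x y : R).

(* The derivatives of exp(-1/x), extended by 0, are all of this form. *)
Definition flat_exp p x : R := if 0 < x then p.[x^-1] * expR (- x^-1) else 0.

(** This is the [k]-th power of [y / k <= expR (y / k)], hence the constant [k ^ k]. *)
Lemma pow_le_expR k y : 0 <= y -> y ^+ k <= k%:R ^+ k * expR y.
Proof.
case: k => [|k] y0; first by rewrite !expr0 mul1r -expR0 ler_expR.
have -> : expR y = expR (y / k.+1%:R) ^+ k.+1.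
  by rewrite -expRM_natl mulrC divfK// pnatr_eq0.
rewrite -exprMn; apply: lerXn2r; rewrite ?nnegrE ?mulr_ge0 ?expR_ge0//.
rewrite -ler_pdivrMl ?ltr0n// mulrC; apply: le_trans (expR_ge1Dx _).
by rewrite ler_wpDl.
Qed.

Lemma horner_expRN_bounded p : exists2 C, 0 < C & forall y, 0 <= y -> `|p.[y] * expR (- y)| <= C.
Proof.
exists (1 + \sum_(i < size p) `|p`_i| * i%:R ^+ i).
  by rewrite ltr_pwDl// sumr_ge0// => i _; rewrite mulr_ge0// exprn_ge0.
move=> y y0; rewrite normrM (ger0_norm (expR_ge0 _)) expRN ler_pdivrMr ?expR_gt0//.
rewrite horner_coef mulrDl mul1r; apply: le_trans (ler_norm_sum _ _ _) _.
rewrite mulr_suml; apply: (@le_trans _ _ (\sum_(i < size p) `|p`_i| * i%:R ^+ i * expR y)).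
  apply: ler_sum => i _; rewrite normrM -mulrA ler_wpM2l// ger0_norm ?exprn_ge0//.
  exact: pow_le_expR.
by rewrite lerDr expR_ge0.
Qed.

(** The boundedness of [y ^ 2 * p(y) * expR (- y)] at [y = 1 / x]. A quadratic bound is what makes
    the difference quotients at 0 tend to 0. *)
Lemma flat_exp_quadratic p : exists2 C, 0 < C & forall x, `|flat_exp p x| <= C * x ^+ 2.
Proof.
have [C C0 pC] := horner_expRN_bounded ('X^2 * p); exists C => // x.
rewrite /flat_exp; case: ifP => [x0|_]; last by rewrite normr0 mulr_ge0 ?sqr_ge0// ltW.
have y0 : 0 <= x^-1 by rewrite invr_ge0 ltW.
have := pC _ y0; rewrite hornerM hornerXn -mulrA normrM ger0_norm ?exprn_ge0//.
by rewrite exprVn ler_pdivrMl ?exprn_gt0// [_ ^+ 2 * C]mulrC.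
Qed.

(** For [x > 0], the chain rule applied to [p(1/x) * expR (-1/x)] produces the factor [1 / x ^ 2]
    and the polynomial [p - p'], evaluated at [1 / x]. The family is thus closed under
    differentiation, and smoothness follows by induction on the order. *)
Lemma is_derive_flat_exp p x :
  is_derive x 1 (flat_exp p) (flat_exp ('X^2 * (p - p^`())) x).
Proof.
have [x0|x0|->] := ltgtP x 0.
- rewrite [flat_exp _ x]/flat_exp ltNge (ltW x0)/=.
  have d0 := is_derive_cst (0 : R) x (1 : R).
  apply: near_eq_is_derive d0.
  near=> y; rewrite /flat_exp ltNge (_ : y <= 0)//.
  by apply: ltW; near: y; exact: lt_nbhsl.
- have dV : is_derive x 1 (fun y : R => y^-1) (- x ^- 2).
    have := @is_deriveV R id x 1 1 _ (is_derive_id _ _).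
    by rewrite [- _ *: 1]mulr1; apply; rewrite gt_eqF.
  have dp := is_derive1_comp (is_derive_poly p x^-1) dV.
  have dE : is_derive x 1 (fun y : R => expR (- y^-1)) (expR (- x^-1) * x ^- 2).
    have dN : is_derive x 1 (fun y : R => - y^-1) (x ^- 2).
      by have := is_deriveN dV; rewrite opprK.
    exact: (is_derive1_comp (is_derive_expR _) dN).
  have := is_deriveM dp dE; set d := (X in is_derive _ _ _ X) => dM.
  have -> : flat_exp ('X^2 * (p - p^`())) x = d.
    rewrite /flat_exp x0 /d !hornerE /GRing.scale/= exprVn; ring.
  apply: near_eq_is_derive dM.
  near=> y; rewrite /flat_exp (_ : 0 < y)//.
  by near: y; exact: lt_nbhsr.
- apply/is_deriveP; rewrite [X in _ --> X]/flat_exp ltxx.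
  have [C C0 pC] := flat_exp_quadratic p.
  apply/cvgr0Pnorm_lt => e e0; near=> h.
  rewrite addr0 [h *: 1]mulr1 {2}/flat_exp ltxx subr0 normrZ normfV.
  have h0 : 0 < `|h| by rewrite normr_gt0; near: h; exact: nbhs_dnbhs_neq.
  rewrite ltr_pdivrMl//; apply: le_lt_trans (pC h) _.
  rewrite -real_normK ?num_real// expr2 mulrCA ltr_pM2l// -ltr_pdivlMl//.
  near: h; apply: dnbhs0_lt; by rewrite mulr_gt0// invr_gt0.
Unshelve. all: by end_near. Qed.

Lemma continuous_flat_exp p : continuous (flat_exp p).
Proof.
move=> x; have [d _] := is_derive_flat_exp p x.
by apply: differentiable_continuous; exact/derivable1_diffP.
Qed.

Lemma flat_exp1_ge0 x : 0 <= flat_exp 1 x.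
Proof. by rewrite /flat_exp; case: ifP => // _; rewrite hornerC mul1r expR_ge0. Qed.

Lemma flat_exp1_le1 x : flat_exp 1 x <= 1.
Proof.
rewrite /flat_exp; case: ifP => // x0; rewrite hornerC mul1r -expR0 ler_expR.
by rewrite oppr_le0 invr_ge0 ltW.
Qed.

Lemma flat_exp1_eq0 x : (flat_exp 1 x == 0) = (x <= 0).
Proof.
rewrite /flat_exp leNgt; case: ifP => _; last by rewrite eqxx.
by rewrite hornerC mul1r gt_eqF// expR_gt0.
Qed.

Lemma cvg_flat_exp1 x : 0 < x -> flat_exp 1 (m.+1%:R * x) @[m --> \oo] --> (1 : R).
Proof.
move=> x0.
rewrite (_ : (fun m => _) = (fun m => expR (- (x^-1 * m.+1%:R^-1)))); last first.
  apply/funext => m; rewrite /flat_exp mulr_gt0// hornerC mul1r invfM mulrC//.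
rewrite -[X in _ --> X]expR0; apply: (@cvg_comp _ _ _ _ expR _ (nbhs (0 : R))); last exact: continuous_expR.
rewrite -oppr0 -(mulr0 x^-1); apply: cvgN; apply: cvgMr; exact: cvg_harmonic.
Qed.

End flat_exponential.

Section continuity.
Context {R : realType} {T : topologicalType}.
Implicit Types f g : T -> R.

Lemma continuous_mulf f g : continuous f -> continuous g -> continuous (fun x => f x * g x).
Proof. by move=> cf cg x; exact: (continuousM (cf x) (cg x)). Qed.

Lemma continuous_linf (a : R) f g : continuous f -> continuous g -> continuous (fun x => a * f x + g x).
Proof.
move=> cf cg x; have caf := continuous_mulf (@cst_continuous _ _ a) cf.
exact: (continuousD (caf x) (cg x)).
Qed.

End continuity.

Lemma continuous_addr {R : realType} (V : normedModType R) (a : V) : continuous (fun x : V => x + a).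
Proof. by move=> x; apply: cvgD; [exact: cvg_id|exact: cvg_cst]. Qed.

Lemma continuous_rV_shift {R : realType} {n : nat} (a : 'rV[R]_n) :
  continuous (fun x : 'rV[R]_n => x + a).
Proof.
exact: (@continuous_addr _ 'rV[R]_n a).
Qed.

Section smooth_functions.
Context {R : realType} {n : nat}.
Implicit Types (f g phi : 'rV[R]_n -> R) (x : 'rV[R]_n) (j : 'I_n).
Local Notation e j := (delta_mx ord0 j : 'rV[R]_n).
Local Notation d j f := (@partial R n R^o j f).

(** Smoothness graded by order. Unlike the quantification over sequences of directions in [smooth],
    it supports the inductions for products, linear combinations and translates. *)
Fixpoint Ck (k : nat) (f : 'rV[R]_n -> R) : Prop := continuous f /\
  if k is k'.+1 then forall j, (forall x, derivable (f : 'rV[R]_n -> R^o) x (e j)) /\ Ck k' (d j f)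
  else True.

Lemma CkW k f : Ck k.+1 f -> Ck k f.
Proof.
elim: k f => [|k IH] f; first by move=> [].
by move=> [cf df]; split => // j; have [? ?] := df j; split => //; exact: IH.
Qed.

Lemma smooth_partial f j : smooth f -> smooth (d j f).
Proof.
by move=> sf s; have := sf (rcons s j); rewrite /iter_partial foldr_rcons.
Qed.

Lemma smooth_continuous f : smooth f -> continuous f.
Proof. by move=> /(_ [::])[]. Qed.

Lemma smooth_derivable f j x : smooth f -> derivable (f : 'rV[R]_n -> R^o) x (e j).
Proof. by move=> /(_ [::])[_]; exact. Qed.

Lemma smoothP f : smooth f <-> forall k, Ck k f.
Proof.
split=> [sf k|Cf s].
  elim: k f sf => [|k IH] f sf; first by split => //; exact: smooth_continuous.
  split=> [|j]; first exact: smooth_continuous.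
  by split=> [x|]; [exact: smooth_derivable|exact/IH/smooth_partial].
(* [foldr] differentiates first in the direction of the last entry, and [Ck] exposes that first
   derivative; hence the induction from the right. *)
have {Cf} := Cf (size s).+1; elim/last_ind: s f => [|s j IH] f.
  by move=> /= [cf df]; split => // j x; have [+ _] := df j; exact.
rewrite size_rcons => -[_ /(_ j)[_ /IH]].
by rewrite /iter_partial foldr_rcons.
Qed.

Lemma partialE f x j (a : R^o) : is_derive x (e j) (f : 'rV[R]_n -> R^o) a -> d j f x = a.
Proof. by move=> [_]. Qed.

Lemma Ck_lin k (a : R) f g : Ck k f -> Ck k g -> Ck k (fun x => a * f x + g x).
Proof.
elim: k f g => [|k IH] f g [cf df] [cg dg].
  by split => //; exact: continuous_linf.
split=> [|j]; first exact: continuous_linf.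
have [df1 df2] := df j; have [dg1 dg2] := dg j.
have D x : is_derive x (e j) (fun x => a * f x + g x : R^o) (a * d j f x + d j g x).
  exact: (is_deriveD (is_deriveZ a (derivableP (df1 x))) (derivableP (dg1 x))).
split=> [x|]; first by case: (D x).
rewrite (_ : d j _ = fun x => a * d j f x + d j g x); first exact: IH.
by apply/funext => x; exact: (partialE (D x)).
Qed.

Lemma Ck_mul k f g : Ck k f -> Ck k g -> Ck k (fun x => f x * g x).
Proof.
elim: k f g => [|k IH] f g Cf Cg; have [cf df] := Cf; have [cg dg] := Cg.
  by split => //; exact: continuous_mulf.
split=> [|j]; first exact: continuous_mulf.
have [df1 df2] := df j; have [dg1 dg2] := dg j.
have D x : is_derive x (e j) (fun x => f x * g x : R^o) (1 * (f x * d j g x) + g x * d j f x).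
  rewrite mul1r; apply: is_deriveM; exact: derivableP.
split=> [x|]; first by case: (D x).
rewrite (_ : d j _ = fun x => 1 * (f x * d j g x) + g x * d j f x); last first.
  by apply/funext => x; exact: (partialE (D x)).
by apply: Ck_lin; apply: IH => //; exact: CkW.
Qed.

Lemma Ck_cst k (a : R) : Ck k (fun=> a).
Proof.
elim: k a => [|k IH] a; first by split => //; exact: cst_continuous.
split=> [|j]; first exact: cst_continuous.
have D x : is_derive x (e j) (fun=> a : R^o) 0 by exact: is_derive_cst.
split=> [x|]; first by case: (D x).
rewrite (_ : d j _ = fun=> 0); first exact: IH.
by apply/funext => x; exact: (partialE (D x)).
Qed.

Lemma Ck_flat_exp k p (c b : R) i : Ck k (fun x => flat_exp p (c * x ord0 i + b)).
Proof.
have cont q : continuous (fun x : 'rV[R]_n => flat_exp q (c * x ord0 i + b)).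
  move=> x; apply: (@cvg_comp _ _ _ (fun x : 'rV[R]_n => c * x ord0 i + b) (flat_exp q)); last exact: continuous_flat_exp.
  apply: (@continuous_linf _ _ c (fun x : 'rV[R]_n => x ord0 i) (cst b)).
    by move=> y; exact: coord_continuous.
  exact: cst_continuous.
elim: k p => [|k IH] p; first by split.
split => // j.
have D x : is_derive x (e j) (fun x => flat_exp p (c * x ord0 i + b) : R^o)
    ((c * (i == j)%:R) * flat_exp ('X^2 * (p - p^`())) (c * x ord0 i + b) + 0).
  apply/is_derive_line; rewrite addr0 mulrC.
  rewrite (_ : (fun t : R => _) = flat_exp p \o (fun t => (c * (i == j)%:R) * t + (c * x ord0 i + b))); last first.
    by apply/funext => t; rewrite /= !mxE eqxx/= mulrDr addrA; congr (flat_exp _ (_ + _ + _)); ring.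
  apply: is_derive1_comp.
    by have := is_derive_flat_exp p (c * (i == j)%:R * 0 + (c * x ord0 i + b)); rewrite mulr0 add0r.
  have := is_deriveD (is_deriveZ (c * (i == j)%:R) (is_derive_id (0 : R) (1 : R))) (is_derive_cst (c * x ord0 i + b) (0 : R) (1 : R)).
  by rewrite addr0 [_ *: 1]mulr1.
split=> [x|]; first by case: (D x).
rewrite (_ : d j _ = fun x => (c * (i == j)%:R) * flat_exp ('X^2 * (p - p^`())) (c * x ord0 i + b) + 0).
  by apply: Ck_lin => //; exact: Ck_cst.
by apply/funext => x; exact: (partialE (D x)).
Qed.

Lemma Ck_shift k f (a : 'rV[R]_n) : Ck k f -> Ck k (fun x => f (x + a)).
Proof.
have cs g : continuous g -> continuous (fun x => g (x + a)).
  move=> cg x; apply: (@continuous_comp _ _ _ (fun x : 'rV[R]_n => x + a) g); last exact: cg.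
  exact: continuous_rV_shift.
elim: k f => [|k IH] f [cf df]; first by split => //; exact: cs.
split=> [|j]; first exact: cs.
have [df1 df2] := df j.
have D x : is_derive x (e j) (fun x => f (x + a) : R^o) (d j f (x + a)).
  have /is_derive_line := @derivableP _ _ _ (f : 'rV[R]_n -> R^o) (x + a) (e j) (df1 (x + a)).
  by move=> D; apply/is_derive_line; under eq_fun do rewrite -addrA.
split=> [x|]; first by case: (D x).
rewrite (_ : d j _ = fun x => d j f (x + a)); first exact: IH.
by apply/funext => x; exact: (partialE (D x)).
Qed.

Lemma partial_shift f j (a : 'rV[R]_n) x : smooth f ->
  d j (fun x => f (x + a)) x = d j f (x + a).
Proof.
move=> sf; apply: partialE; apply/is_derive_line.
have /is_derive_line := @derivableP _ _ _ (f : 'rV[R]_n -> R^o) (x + a) (e j) (@smooth_derivable f j (x + a) sf).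
by move=> D; under eq_fun do rewrite -addrA.
Qed.

Lemma is_derive_smooth f j x (t : R) : smooth f ->
  is_derive t 1 (fun s : R => f (s *: e j + x)) (d j f (t *: e j + x)).
Proof.
move=> sf; have /is_derive_along := @derivableP _ _ _ (f : 'rV[R]_n -> R^o) (t *: e j + x) (e j) (@smooth_derivable f j (t *: e j + x) sf).
exact.
Qed.

End smooth_functions.

Section test_functions.
Context {R : realType} {n : nat}.
Implicit Types (U K : set 'rV[R]_n) (phi psi : 'rV[R]_n -> R).
Local Notation d j f := (@partial R n R^o j f).

Lemma test_functionP U phi : test_function U phi <->
  smooth phi /\ exists K, [/\ compact K, K `<=` U & forall x, phi x != 0 -> K x].
Proof.
split=> [[sphi [cK KU]]|[sphi [K [cK KU phiK]]]]; split => //.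
  by exists (closure [set x | phi x != 0]); split => // x; exact: (@subset_closure _ [set x | phi x != 0]).
have clK : closed K by apply: compact_closed => //; exact: norm_hausdorff.
have supK : closure [set x | phi x != 0] `<=` K.
  by rewrite [X in _ `<=` X]((closure_id K).1 clK); exact: closure_subset.
split; last exact: subset_trans KU.
by apply: (subclosed_compact _ cK) => //; exact: closed_closure.
Qed.

Lemma test_function_sub U U' phi : U `<=` U' -> test_function U phi -> test_function U' phi.
Proof. by move=> UU' [? [? ?]]; split => //; split => //; exact: subset_trans UU'. Qed.

Lemma test_function_lin U (a : R) phi psi : test_function U phi -> test_function U psi ->
  test_function U (fun x => a * phi x + psi x).
Proof.
move=> /test_functionP[sphi [K [cK KU phiK]]] /test_functionP[spsi [K' [cK' KU' psiK]]].
apply/test_functionP; split.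
  by apply/smoothP => k; apply: Ck_lin; [move/smoothP : sphi|move/smoothP : spsi]; exact.
exists (K `|` K'); split; [exact: compactU|by rewrite subUset|].
move=> x; have [phi0|phi0 _] := eqVneq (phi x) 0; last by left; exact: phiK.
by rewrite phi0 mulr0 add0r => psi0; right; exact: psiK.
Qed.

Lemma test_function0 U : test_function U (fun=> 0).
Proof.
apply/test_functionP; split; first by apply/smoothP => k; exact: Ck_cst.
by exists set0; split => //; [exact: compact0|move=> x; rewrite eqxx].
Qed.

(** Smooth, with values in [0, 1], and nonzero only on the open box. The dilation by [m.+1] drives
    each factor to 1 at interior points, so the bumps converge to the indicator of the box. *)
Definition box_bump (a b : 'rV[R]_n) (m : nat) (x : 'rV[R]_n) : R :=
  \prod_(i < n) (flat_exp 1 (m.+1%:R * (x ord0 i - a ord0 i)) *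
                 flat_exp 1 (m.+1%:R * (b ord0 i - x ord0 i))).

Lemma box_bump_ge0 a b m x : 0 <= box_bump a b m x.
Proof. by apply: prodr_ge0 => i _; rewrite mulr_ge0 ?flat_exp1_ge0. Qed.

Lemma box_bump_le1 a b m x : box_bump a b m x <= 1.
Proof.
suff /andP[] : 0 <= box_bump a b m x <= 1 by [].
rewrite /box_bump; apply: (big_ind (fun y : R => 0 <= y <= 1)); first by rewrite ler01 lexx.
  by move=> y z /andP[y0 y1] /andP[z0 z1]; rewrite mulr_ge0//= mulr_ile1.
by move=> i _; rewrite mulr_ge0 ?flat_exp1_ge0//= mulr_ile1 ?flat_exp1_ge0 ?flat_exp1_le1.
Qed.

Lemma box_bump_neq0 a b m x : box_bump a b m x != 0 -> open_box a b x.
Proof.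
move=> /prodf_neq0 bx i; have := bx i isT.
rewrite mulf_eq0 negb_or !flat_exp1_eq0 -!ltNge !pmulr_rgt0 ?ltr0n//.
by rewrite !subr_gt0.
Qed.

Lemma cvg_box_bump a b x : box_bump a b m x @[m --> \oo] --> (\1_(open_box a b) x : R).
Proof.
have [xab|xab] := pselect (open_box a b x).
  have cprod (F : 'I_n -> nat -> R) (r : seq 'I_n) : (forall i, F i @ \oo --> (1 : R)) ->
      (fun m => \prod_(i <- r) F i m) @ \oo --> (1 : R).
    move=> F1; elim: r => [|i r IH]; first by under eq_fun do rewrite big_nil; exact: cvg_cst.
    rewrite (_ : (fun m => _) = (fun m => F i m * \prod_(l <- r) F l m)); last first.
      by apply/funext => m; rewrite big_cons.
    by have := cvgM (F1 i) IH; rewrite mulr1; exact.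
  rewrite indicE mem_set//=; apply: cprod => i.
  have /andP[ax xb] := xab i; rewrite -subr_gt0 in ax; rewrite -subr_gt0 in xb.
  by have := cvgM (cvg_flat_exp1 ax) (cvg_flat_exp1 xb); rewrite mulr1; exact.
rewrite indicE memNset//=; apply: cvg_near_cst; apply: nearW => m.
by apply/eqP; apply: contrapT => /negP/box_bump_neq0.
Qed.

Lemma smooth_box_bump a b m : smooth (box_bump a b m).
Proof.
apply/smoothP => k.
have Cprod (F : 'I_n -> 'rV[R]_n -> R) (r : seq 'I_n) : (forall i, Ck k (F i)) ->
    Ck k (fun x => \prod_(i <- r) F i x).
  move=> CF; elim: r => [|i r IH].
    by rewrite (_ : (fun x => _) = fun=> 1); [exact: Ck_cst|apply/funext => x; rewrite big_nil].
  rewrite (_ : (fun x => _) = fun x => F i x * \prod_(i <- r) F i x).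
    exact: Ck_mul.
  by apply/funext => x; rewrite big_cons.
apply: Cprod => i; apply: Ck_mul.
  under eq_fun do rewrite mulrBr; exact: Ck_flat_exp.
under eq_fun do rewrite mulrBr addrC -mulNr; exact: Ck_flat_exp.
Qed.

Lemma test_function_box_bump a b m U : closed_box a b `<=` U -> test_function U (box_bump a b m).
Proof.
move=> abU; apply/test_functionP; split; first exact: smooth_box_bump.
exists (closed_box a b); split => //; first exact: compact_closed_box.
by move=> x /box_bump_neq0; exact: open_box_sub_closed.
Qed.

Lemma compact_shift K (a : 'rV[R]_n) : compact K -> compact [set x | K (x + a)].
Proof.
move=> cK; rewrite (_ : [set x | _] = (fun x => x - a) @` K).
  apply: continuous_compact => //; apply: continuous_subspaceT.
  exact: continuous_rV_shift.
apply/seteqP; split => x /=; first by exists (x + a) => //; rewrite addrK.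
by move=> [y Ky <-]; rewrite subrK.
Qed.

Lemma test_function_shift U U' phi (a : 'rV[R]_n) : (forall x, U (x + a) -> U' x) ->
  test_function U phi -> test_function U' (fun x => phi (x + a)).
Proof.
move=> UU' /test_functionP[sphi [K [cK KU phiK]]]; apply/test_functionP; split.
  by apply/smoothP => k; apply: Ck_shift; move/smoothP : sphi; exact.
exists [set x | K (x + a)]; split; [exact: compact_shift| |by move=> x /phiK].
by move=> x /KU; exact: UU'.
Qed.

(** A Lebesgue number argument: local radii that serve both arguments near a point have a positive
    lower bound on a compact set. It yields uniform continuity of test functions, and a positive
    distance from a compact set to the complement of an open neighbourhood. *)
Lemma compact_uniform_radius K (P : 'rV[R]_n -> 'rV[R]_n -> Prop) : compact K ->
  (forall x, K x -> exists2 r, 0 < r & forall x' y, `|x - x'| < r -> `|x - y| < r -> P x' y) ->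
  exists2 del : R, 0 < del & forall x, K x -> forall y, `|x - y| < del -> P x y.
Proof.
move=> cK HP; pose Q (del : R) (x : 'rV[R]_n) := forall y, `|x - y| < del -> P x y.
have near_Q : \forall del \near 0^'+, K `<=` Q del.
  apply: (@compact_near_coveringP _ K).1 => // x /HP[r r0 xr].
  have r2 : 0 < r / 2 by rewrite divr_gt0.
  exists (ball x (r / 2), [set del | del < r / 2]).
    by split; [exact: nbhsx_ballx|exact: nbhs_right_lt].
  move=> [x' del] /= []; rewrite -ball_normE/= => xx' delr y x'y.
  by apply: xr; [|have := ler_distD x' x y]; lra.
have [del []] := @filter_ex _ (0^'+) _ _ (filterI near_Q (nbhs_right_gt (0 : R))).
by exists del.
Qed.

Lemma compact_supp_unif phi K : continuous phi -> compact K -> (forall x, phi x != 0 -> K x) ->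
  forall eps : R, 0 < eps -> exists2 del : R, 0 < del &
  forall x y, `|x - y| < del -> `|phi x - phi y| < eps.
Proof.
move=> cphi cK phiK eps eps0.
have [|del del0 H] := compact_uniform_radius (P := fun x y => `|phi x - phi y| < eps) cK.
  move=> x _; have e2 : 0 < eps / 2 by rewrite divr_gt0.
  have /nbhs_ballP[r /= r0 xr] : \forall y \near x, `|phi x - phi y| < eps / 2.
    by have /cvgrPdist_lt := cphi x; exact.
  exists r => // x' y xx' xy.
  have h1 : `|phi x - phi x'| < eps / 2 by apply: xr; rewrite -ball_normE.
  have h2 : `|phi x - phi y| < eps / 2 by apply: xr; rewrite -ball_normE.
  by rewrite distrC in h1; have := ler_distD (phi x) (phi x') (phi y); lra.
exists del => // x y xy.
have [phix|/phiK Kx] := eqVneq (phi x) 0; last exact: H.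
have [phiy|/phiK Ky] := eqVneq (phi y) 0; first by rewrite phix phiy subrr normr0.
by rewrite distrC; apply: H => //; rewrite distrC.
Qed.

End test_functions.

(** * Density of test functions in weighted L^1 *)

Section borel_boxes.
Context {R : realType} {n : nat}.
Local Notation L := (rV_lebesgue R n).
Local Notation mu := (@lebesgue_rV R n).

Definition open_boxes : set (set 'rV[R]_n) := [set A | A = set0 \/ exists a b, A = open_box a b].

Lemma open_boxI (a b a' b' : 'rV[R]_n) : open_box a b `&` open_box a' b' =
  open_box (\row_i Num.max (a ord0 i) (a' ord0 i)) (\row_i Num.min (b ord0 i) (b' ord0 i)).
Proof.
apply/seteqP; split => x /=.
  by move=> [h h'] i; rewrite !mxE gt_max lt_min; have /andP[-> ->] := h i; have /andP[-> ->] := h' i.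
move=> h; split => i; have := h i; rewrite !mxE gt_max lt_min => /andP[/andP[ax a'x] /andP[bx b'x]];
  by apply/andP.
Qed.

Lemma setI_closed_open_boxes : setI_closed open_boxes.
Proof.
move=> A B [->|[a [b ->]]]; first by rewrite set0I; left.
move=> [->|[a' [b' ->]]]; first by rewrite setI0; left.
by right; rewrite open_boxI; do 2 eexists.
Qed.

Lemma open_sub_boxes (U : set 'rV[R]_n) : open U -> <<s open_boxes >> U.
Proof.
move=> /open_box_cover[F [FP <-]].
have sA := @smallest_sigma_algebra _ setT open_boxes.
case: sA => _ _; apply => k; apply: sub_sigma_algebra.
by case: (FP k) => [->|[a [b [-> _]]]]; [left|right; exists a, b].
Qed.

(** Open boxes, together with the empty set, are stable under intersection. Generating the Borel
    sets by them prepares the Dynkin argument behind [weighted_density]. *)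
Lemma borel_rVE : @measurable rV_display (borel_rV R n) = <<s open_boxes >>.
Proof.
apply/seteqP; split; last first.
  apply: smallest_sub; first exact: sigma_algebra_measurable.
  by move=> A [->//|[a [b ->]]]; exact: measurable_open_box.
apply: smallest_sub; first exact: smallest_sigma_algebra.
move=> A; rewrite -bigcup_seq => -[i _ [B mB <-]]; rewrite setTI.
have [S0 SC SU] := @smallest_sigma_algebra _ setT open_boxes.
(* The sets with good preimage under one coordinate form a sigma-algebra; it then suffices that it
   contains the open intervals, whose preimages are open. *)
pose H := [set B : set R | <<s open_boxes >> ((fun x : 'rV[R]_n => x ord0 i) @^-1` B)].
suff : H B by [].
have mB' : (@ocitv R).-sigma.-measurable B by exact: mB.
rewrite RGenOpens.measurableE in mB'.
have : <<s @RGenOpens.G R >> B by exact: mB'.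
clear mB'.
move: B {mB}; apply: smallest_sub.
  split; first by rewrite /H/= preimage_set0.
    by move=> B HB; rewrite /H/= setTD preimage_setC -setTD; exact: SC.
  by move=> F HF; rewrite /H/= preimage_bigcup; exact: SU.
move=> _ [x [y ->]]; apply: open_sub_boxes; apply: open_comp; last exact: interval_open.
by move=> z _; exact: coord_continuous.
Qed.

Lemma continuous_lebesgue_measurable (phi : 'rV[R]_n -> R) : continuous phi ->
  measurable_fun [set: L] (phi : L -> R).
Proof.
move=> cphi; apply: (measurability _ (RGenOpens.measurableE R)).
move=> _ [_ [x [y ->]] <-]; rewrite setTI; apply: borel_lebesgue_measurable; apply: open_borel.
apply: open_comp; last exact: interval_open.
by move=> z _; exact: cphi.
Qed.

End borel_boxes.

Section density.
Context d (T : measurableType d) (R : realType) (mu : {measure set T -> \bar R}).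
Variables (k : T -> R) (tst : (T -> R) -> Prop).
Hypotheses (mk : measurable_fun setT k) (k0 : forall x, 0 <= k x).
Hypothesis tst_measurable : forall psi, tst psi -> measurable_fun setT psi.
Hypothesis tst_lin : forall a phi psi, tst phi -> tst psi -> tst (fun x => a * phi x + psi x).
Implicit Types F G phi psi : T -> R.
Local Notation N := (weighted_norm mu k).

Definition approximable F := forall e : R, 0 < e -> exists2 psi, tst psi &
  (N (fun x => F x - psi x)%R < e%:E)%E.

Let approx_linear a F G : measurable_fun setT F -> measurable_fun setT G ->
  approximable F -> approximable G -> approximable (fun x => a * F x + G x).
Proof.
move=> mF mG aF aG e e0.
have c0 : 0 < e / 2 / (`|a| + 1) by rewrite !divr_gt0// ltr_wpDl.
have e2 : 0 < e / 2 by rewrite divr_gt0.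
have [phi tphi Fphi] := aF _ c0; have [psi tpsi Gpsi] := aG _ e2.
exists (fun x => a * phi x + psi x); first exact: tst_lin.
rewrite (_ : (fun x => _) = (fun x => a * (F x - phi x) + (G x - psi x))); last first.
  by apply/funext => x; rewrite mulrBr opprD addrACA.
have m1 : measurable_fun setT (fun x => F x - phi x) by apply: measurable_funB => //; exact: tst_measurable.
have m2 : measurable_fun setT (fun x => G x - psi x) by apply: measurable_funB => //; exact: tst_measurable.
have m3 : measurable_fun setT (fun x => a * (F x - phi x)) by exact: measurable_funM.
apply: le_lt_trans (weighted_normD mu mk k0 m3 m2) _.
rewrite (weighted_normZ mu mk k0)// (_ : e = e / 2 + e / 2); last by field.
rewrite EFinD; apply: lee_ltD => //.
  rewrite ge0_fin_numE; last by rewrite mule_ge0// integral_ge0// => x _; rewrite lee_fin mulr_ge0.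
  by rewrite lte_mul_pinfty ?(lt_trans Fphi) ?ltry// integral_ge0// => x _; rewrite lee_fin mulr_ge0.
apply: (@le_trans _ _ (`|a|%:E * (e / 2 / (`|a| + 1))%:E)%E).
  by rewrite lee_wpmul2l// ltW.
rewrite -EFinM lee_fin mulrA ler_pdivrMr ?ltr_wpDl// mulrC.
by rewrite ler_wpM2l ?ltW// ltrDl.
Qed.

Let approx_closed F : measurable_fun setT F ->
  (forall e : R, 0 < e -> exists G, [/\ measurable_fun setT G, approximable G &
    (N (fun x => F x - G x)%R < e%:E)%E]) -> approximable F.
Proof.
move=> mF FG e e0; have e2 : 0 < e / 2 by rewrite divr_gt0.
have [G [mG aG FGe]] := FG _ e2; have [psi tpsi Gpsi] := aG _ e2.
exists psi => //.
rewrite (_ : (fun x => _) = (fun x => (F x - G x) + (G x - psi x))); last first.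
  by apply/funext => x; rewrite addrA subrK.
have m1 : measurable_fun setT (fun x => F x - G x) by exact: measurable_funB.
have m2 : measurable_fun setT (fun x => G x - psi x) by apply: measurable_funB => //; exact: tst_measurable.
apply: le_lt_trans (weighted_normD mu mk k0 m1 m2) _.
by rewrite (_ : e = e / 2 + e / 2) ?EFinD; [exact: lteD|field].
Qed.

Variables (B : nat -> set T) (Pi : set (set T)).
Hypothesis mB : forall i, measurable (B i).
Hypothesis Bk : forall x, k x != 0 -> exists i, B i x.
Hypothesis Boo : forall i, (N \1_(B i) < +oo)%E.
Hypothesis PiI : setI_closed Pi.
Hypothesis mPi : Pi `<=` measurable.
Hypothesis hull : forall A, measurable A ->
  exists2 C, <<s Pi >> C & A `<=` C /\ mu (C `\` A) = 0%E.
Hypothesis approx_B : forall i, approximable \1_(B i).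
Hypothesis approx_Pi : forall A i, Pi A -> approximable \1_(A `&` B i).

(** Dynkin's lemma: a complement costs a difference from the indicator of [B i], and a disjoint
    union a dominated limit, for which the finite weight of [B i] supplies the domination. *)
Let approx_sigma i : <<s Pi >> `<=` [set A | measurable A /\ approximable \1_(A `&` B i)].
Proof.
have mi A : measurable A -> measurable_fun setT (\1_(A `&` B i) : T -> R).
  by move=> mA; apply: measurable_indic; exact: measurableI.
have a0 : approximable (\1_(set0 `&` B i)).
  (* [tst] is only known to be closed under linear combinations; some member of it is borrowed here
     in order to produce 0. *)
  move=> e e0; have [psi tpsi _] := approx_B i ltr01.
  exists (fun x => -1 * psi x + psi x); first exact: tst_lin.
  rewrite /weighted_norm; under eq_integral do rewrite set0I indic0 mulN1r addNr subr0 normr0 mul0r.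
  by rewrite integral0 lte_fin.
apply: lambda_system_subset => //.
apply/dynkin_lambda_system; split.
- by split => //; rewrite setTI.
- move=> A [mA aA]; split; first exact: measurableC.
  rewrite (_ : \1_(~` A `&` B i) = (fun x => -1 * \1_(A `&` B i) x + \1_(B i) x)).
    by apply: approx_linear => //; exact: mi.
  apply/funext => x; rewrite !indicE !in_setI in_setC.
  by case: (x \in A); case: (x \in B i); rewrite /= ?mulr0 ?add0r ?addr0 ?mulr1 ?addNr.
- move=> F tF FP; have mF j : measurable (F j) by case: (FP j).
  have mU : measurable (\bigcup_j F j) by exact: bigcupT_measurable.
  split => //.
  apply: approx_closed; first exact: mi.
  pose G m x : R := \sum_(j < m) \1_(F j `&` B i) x.
  have mG m : measurable_fun setT (G m) by apply: measurable_sum => j; exact: mi.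
  have GE m x : G m x = \1_(\big[setU/set0]_(j < m) F j `&` B i) x.
    elim: m => [|m IH]; first by rewrite /G !big_ord0 set0I indic0.
    rewrite /G big_ord_recr/= -/(G m x) IH big_ord_recr/= setIUl !indicE in_setU.
    have [/set_mem[Fx _]|] := boolP (x \in F m `&` B i); last by rewrite addr0 orbF.
    rewrite orbT memNset ?add0r// => -[]; rewrite -bigcup_mkord => -[j /= jm Fjx] _.
    have := (trivIsetP.1 tF) j m Logic.I Logic.I; rewrite lt_eqF// => /(_ isT).
    by move=> /seteqP[+ _] => /(_ x); apply.
  have aG m : approximable (G m).
    elim: m => [|m IH].
      by rewrite (_ : G 0%N = \1_(set0 `&` B i))//; apply/funext => x; rewrite GE big_ord0.
    rewrite (_ : G m.+1 = (fun x => 1 * G m x + \1_(F m `&` B i) x)); last first.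
      by apply/funext => x; rewrite /G big_ord_recr/= mul1r.
    by apply: approx_linear => //; [exact: mi|case: (FP m)].
  move=> e e0.
  have cv : N (fun x => \1_(\bigcup_j F j `&` B i) x - G m x) @[m --> \oo] --> 0%E.
    apply: (weighted_dominated mk k0 mG (mi _ mU)).
    - apply: le_lt_trans (Boo i); apply: (le_weighted_norm mu mk k0) => //; first exact: mi.
      move=> x _; rewrite !indicE in_setI; case: (x \in B i); rewrite ?andbT ?andbF//.
      by case: (x \in _); rewrite ?normr1 ?normr0.
    - move=> m x _; rewrite GE !indicE.
      have [/set_mem[Ux Bx]|nUx] := boolP (x \in \bigcup_j F j `&` B i).
        by case: (x \in _); rewrite ?subrr ?normr0 ?subr0.
      rewrite memNset ?subr0//; rewrite -bigcup_mkord => -[[j _ Fjx] Bx].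
      by move/negP: nUx; apply; apply/mem_set; split => //; exists j.
    - move=> x _; have [[[j _ Fjx] Bx]|nUx] := pselect ((\bigcup_j F j `&` B i) x).
        apply: cvg_near_cst; exists j.+1 => // m /= jm.
        by rewrite GE !indicE !mem_set//; split => //; [exists j|rewrite -bigcup_mkord; exists j].
      apply: cvg_near_cst; apply: nearW => m.
      rewrite GE !indicE !memNset// => -[+ Bx]; rewrite -bigcup_mkord => -[j _ Fjx].
      by apply: nUx; split => //; exists j.
  have [M _ HM] := cvge0_lt cv e0.
  by exists (G M); split => //; exact: (HM M (leqnn M)).
- by move=> A PA; split; [exact: mPi|exact: approx_Pi].
Qed.

(** [weighted_induction] leaves the indicators of [A] cut to [B i]. Replacing [A] by its hull
    changes the indicator on a null set only, and the hull is in the range of [approx_sigma]. *)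
Lemma weighted_density F : measurable_fun setT F -> (N F < +oo)%E -> approximable F.
Proof.
move=> mF Foo; apply: (weighted_induction mk k0 (P := approximable) _ _ mB Bk Boo) => //.
- by move=> a F1 G1 mF1 mG1 _ _; exact: approx_linear.
- move=> F1 mF1 _ FG; apply: approx_closed => // e e0.
  by have [G [mG _ aG GFe]] := FG e e0; exists G.
- move=> A i mA; have [C sC [AC CA0]] := hull mA.
  have [mC aC] := approx_sigma i sC.
  have mAi : measurable_fun setT (\1_(A `&` B i) : T -> R) by apply: measurable_indic; exact: measurableI.
  have mCi : measurable_fun setT (\1_(C `&` B i) : T -> R) by apply: measurable_indic; exact: measurableI.
  apply: approx_closed => // e e0; exists \1_(C `&` B i); split => //.
  rewrite /weighted_norm (@ge0_ae_eq_integral _ _ _ mu setT _ (cst 0%E)) ?integral0 ?lte_fin//.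
  - by apply: measurable_weighted => //; exact: measurable_funB.
  - by move=> x _; rewrite lee_fin mulr_ge0.
  exists (C `\` A); split; [exact: measurableD|exact: CA0|].
  move=> x /= xP; apply: contrapT => xCA; apply: xP => _.
  suff -> : \1_(A `&` B i) x = \1_(C `&` B i) x :> R by rewrite subrr normr0 mul0r.
  rewrite !indicE !in_setI; congr ((_ && _)%:R).
  have [/set_mem Ax|nAx] := boolP (x \in A); first by apply/esym/mem_set/AC.
  apply/esym/negbTE/negP => /set_mem Cx; apply: xCA; split => //.
  by move=> Ax; move/negP: nAx; apply; exact: mem_set.
Qed.

End density.

Lemma weighted_norm_indic_le d (T : measurableType d) (R : realType)
    (mu : {measure set T -> \bar R}) (k : T -> R) (A K : set T) :
  measurable_fun setT k -> (forall x, 0 <= k x) -> measurable A -> measurable K -> A `<=` K ->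
  (weighted_norm mu k \1_A <= \int[mu]_(x in K) (k x)%:E)%E.
Proof.
move=> mk k0 mA mK AK; rewrite integral_mkcond; apply: ge0_le_integral => //.
- by move=> x _; rewrite lee_fin mulr_ge0.
- by apply: measurable_weighted => //; exact: measurable_indic.
- by apply/(measurable_restrictT _ mK); apply: measurable_funTS; exact/measurable_EFinP.
move=> x _; rewrite patchE indicE.
have [/set_mem xA|_] := boolP (x \in A); first by rewrite normr1 mul1r mem_set//; exact: AK.
by rewrite normr0 mul0r; case: ifP => _; rewrite lee_fin.
Qed.

Section test_domination.
Context d (T : measurableType d) (R : realType) (mu : {measure set T -> \bar R}).
Hypothesis mu_complete : measure_is_complete mu.
Variables (V : completeNormedModType R) (tst : (T -> R) -> Prop) (w : T -> V) (kap : T -> R).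
Hypothesis tst_measurable : forall psi, tst psi -> measurable_fun setT psi.
Hypotheses (Lw : bochner_L1 mu setT w) (mkap : measurable_fun setT kap) (kap0 : forall x, 0 <= kap x).
Hypothesis dense : forall A, measurable A -> approximable mu (fun x => `|w x| + kap x) tst \1_A.
Hypothesis tst_le : forall psi, tst psi ->
  (`|bochner_integral mu setT (fun x => psi x *: w x)|%:E <= weighted_norm mu kap psi)%E.

(** Reduction to [bochner_integral_dominated], with test functions in place of sets. The weight
    [|w| + kap] is chosen so that a single approximation of an indicator by [psi] controls both
    changes: in the integral against [w], and in the norm weighted by [kap]. *)
Lemma test_dominated : {ae mu, forall x, `|w x| <= kap x}.
Proof.
have [sw woo] := Lw.
have mw : measurable_fun setT (fun x => `|w x|) by exact: (strongly_measurable_norm mu_complete).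
have mk : measurable_fun setT (fun x => `|w x| + kap x) by exact: measurable_funD.
suff : {ae mu, forall x, `|w x| <= `|kap x| }.
  by apply: filterS => x; rewrite (ger0_norm (kap0 x)).
apply: (bochner_integral_dominated mu_complete) => // A mA.
apply/lee_addgt0Pr => e e0; have e2 : 0 < e / 2 by rewrite divr_gt0.
have [psi tpsi psie] := dense mA e2; have mpsi := tst_measurable tpsi.
have LA := bochner_L1_indic mu_complete mA Lw.
have mApsi : measurable_fun setT (fun x => \1_A x - psi x).
  by apply: measurable_funB => //; exact: measurable_indic.
have smult (phi : T -> R) : measurable_fun setT phi -> strongly_measurable mu setT (fun x => phi x *: w x).
  by move=> mphi; apply: strongly_measurableZ => //; exact: measurable_strongly_measurable.
have Ldiff : bochner_L1 mu setT (fun x => (\1_A x - psi x) *: w x).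
  split; first exact: smult.
  apply: (@le_lt_trans _ _ (weighted_norm mu (fun x => `|w x| + kap x) (fun x => \1_A x - psi x))); last first.
    by apply: lt_trans psie _; rewrite ltry.
  apply: ge0_le_integral => //.
  - by apply: (strongly_measurable_enorm mu_complete); exact: smult.
  - exact: measurable_weighted.
  - by move=> x _; rewrite lee_fin normrZ ler_wpM2l// lerDl.
have Lpsi : bochner_L1 mu setT (fun x => psi x *: w x).
  have := bochner_L1_linear mu_complete (-1) Ldiff LA.
  by congr (bochner_L1 _ _ _); apply/funext => x; rewrite scaleN1r -scaleNr -scalerDl opprB subrK.
have -> : (fun x => \1_A x *: w x) = (fun x => 1 *: ((\1_A x - psi x) *: w x) + psi x *: w x).
  by apply/funext => x; rewrite scale1r -scalerDl subrK.
rewrite bochner_integral_linear// scale1r.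
have N_le (kap' : T -> R) : measurable_fun setT kap' -> (forall x, 0 <= kap' x) ->
    (forall x, kap' x <= `|w x| + kap x) ->
    (weighted_norm mu kap' (fun x => \1_A x - psi x)%R <= (e / 2)%:E)%E.
  move=> mk' k0' kk'; apply: ltW; apply: le_lt_trans psie; apply: ge0_le_integral => //.
  - by move=> x _; rewrite lee_fin mulr_ge0.
  - exact: measurable_weighted.
  - exact: measurable_weighted.
  - by move=> x _; rewrite lee_fin ler_wpM2l.
apply: (@le_trans _ _ ((e / 2)%:E + (weighted_norm mu kap \1_A + (e / 2)%:E))%E).
  apply: (@le_trans _ _ (`|bochner_integral mu setT (fun x => (\1_A x - psi x) *: w x)|%:E +
      `|bochner_integral mu setT (fun x => psi x *: w x)|%:E)%E).
    by rewrite -EFinD lee_fin ler_normD.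
  apply: leeD.
    apply: le_trans (le_bochner_integral_norm mu_complete Ldiff) _.
    apply: le_trans (N_le (fun x => `|w x|) mw _ _) => //; last by move=> x; rewrite lerDl.
    by apply: ge0_le_integral => //; [apply: (strongly_measurable_enorm mu_complete); exact: smult|
      exact: measurable_weighted|move=> x _; rewrite lee_fin normrZ].
  apply: le_trans (tst_le tpsi) _.
  rewrite (_ : psi = (fun x => \1_A x + -1 * (\1_A x - psi x))); last first.
    by apply/funext => x; rewrite mulN1r opprB addrC subrK.
  apply: le_trans (weighted_normD mu mkap kap0 _ _) _.
  - exact: measurable_indic.
  - exact: measurable_funM.
  rewrite (weighted_normZ mu mkap kap0)// normrN1 mul1e leeD2l//.
  by apply: N_le => // x; rewrite lerDr.
have -> : weighted_norm mu kap \1_A = (\int[mu]_(x in A) `|kap x|%:E)%E.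
  rewrite integral_mkcond; apply: eq_integral => x _; rewrite patchE indicE.
  by case: (x \in A); rewrite ?normr1 ?mul1r ?normr0 ?mul0r// ger0_norm.
rewrite addeCA leeD2l// -EFinD lee_fin; lra.
Qed.

End test_domination.

Section lebesgue_density.
Context {R : realType} {n : nat}.
Local Notation L := (rV_lebesgue R n).
Local Notation mu := (@lebesgue_rV R n).
Variables (U : set 'rV[R]_n) (k : L -> R).
Hypotheses (oU : open U) (mk : measurable_fun [set: L] k) (k0 : forall x, 0 <= k x).
Hypothesis kU : forall x, k x != 0 -> U x.
Hypothesis kloc : forall K : set 'rV[R]_n, compact K -> K `<=` U ->
  (\int[mu]_(x in K) (k x)%:E < +oo)%E.

Lemma test_function_measurable psi : test_function U psi -> measurable_fun [set: L] (psi : L -> R).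
Proof. by move=> [/smooth_continuous/continuous_lebesgue_measurable]. Qed.

Lemma measurable_open_box_lebesgue (a b : 'rV[R]_n) : measurable (open_box a b : set L).
Proof. by apply: borel_lebesgue_measurable; exact: measurable_open_box. Qed.

Lemma weighted_norm_box_lty (a b : 'rV[R]_n) : closed_box a b `<=` U ->
  (weighted_norm mu k (\1_(open_box a b : set L)) < +oo)%E.
Proof.
move=> abU; have cK := @compact_closed_box R n a b; have [mK _] := lebesgue_compact cK.
apply: le_lt_trans (kloc cK abU).
exact: (weighted_norm_indic_le mu mk k0 (measurable_open_box_lebesgue a b) mK (@open_box_sub_closed _ _ a b)).
Qed.

Lemma approximable_box (a b : 'rV[R]_n) : closed_box a b `<=` U ->
  approximable mu k (test_function U) (\1_(open_box a b : set L)).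
Proof.
move=> abU e e0.
have cv : weighted_norm mu k (fun x : L => \1_(open_box a b : set L) x - box_bump a b m x) @[m --> \oo] --> 0%E.
  apply: (weighted_dominated mk k0 _ _ (weighted_norm_box_lty abU)).
  - by move=> m; apply: test_function_measurable; exact: test_function_box_bump.
  - by apply: measurable_indic; exact: measurable_open_box_lebesgue.
  - move=> m x _; rewrite indicE; have [/set_mem xab|xab] := boolP (x \in (open_box a b : set L)).
      rewrite normr1 ger0_norm ?subr_ge0 ?box_bump_le1//.
      by rewrite lerBlDr lerDl box_bump_ge0.
    have -> : box_bump a b m x = 0.
      by apply/eqP; apply: contrapT => /negP/box_bump_neq0/mem_set; exact/negP.
    by rewrite subrr.
  - by move=> x _; exact: cvg_box_bump.
have [M _ HM] := cvge0_lt cv e0; exists (box_bump a b M); first exact: test_function_box_bump.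
exact: (HM M (leqnn M)).
Qed.

Lemma approximable0 : approximable mu k (test_function U) (\1_(set0 : set L)).
Proof.
move=> e e0; exists (fun=> 0); first exact: test_function0.
rewrite /weighted_norm; under eq_integral do rewrite indic0 subr0 normr0 mul0r.
by rewrite integral0 lte_fin.
Qed.

(** The weight vanishes off [U] and is finite on compact subsets of [U], so the boxes covering [U]
    exhaust it with finite mass, and smooth bumps approximate their indicators by dominated
    convergence. *)
Lemma test_function_dense (F : L -> R) : measurable_fun [set: L] F ->
  (weighted_norm mu k F < +oo)%E -> approximable mu k (test_function U) F.
Proof.
have [B [BP BU]] := open_box_cover oU.
apply: (weighted_density mk k0 (@test_function_measurable) (@test_function_lin _ _ U)
  (B := B) (Pi := open_boxes)).
- by move=> i; case: (BP i) => [->//|[a [b [-> _]]]]; exact: measurable_open_box_lebesgue.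
- by move=> x /kU; rewrite -BU => -[i _ Bix]; exists i.
- move=> i; case: (BP i) => [->|[a [b [-> abU]]]]; last exact: weighted_norm_box_lty.
  rewrite /weighted_norm; under eq_integral do rewrite indic0 normr0 mul0r.
  by rewrite integral0.
- exact: setI_closed_open_boxes.
- by move=> A [->//|[a [b ->]]]; exact: measurable_open_box_lebesgue.
- move=> A mA; have [C mC AC] := borel_hull mA; exists C => //.
  by rewrite -borel_rVE.
- by move=> i; case: (BP i) => [->|[a [b [-> abU]]]]; [exact: approximable0|exact: approximable_box].
- move=> A i [->|[a [b ->]]]; first by rewrite set0I; exact: approximable0.
  case: (BP i) => [->|[a' [b' [-> abU]]]]; first by rewrite setI0; exact: approximable0.
  (* A box cut by a box of the cover is again a box, and its closure stays inside that of the
     covering box, hence inside [U]. *)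
  rewrite open_boxI; apply: approximable_box; apply: subset_trans abU => x h j.
  by have := h j; rewrite !mxE ge_max le_min => /andP[/andP[_ ->] /andP[_ ->]].
Qed.

End lebesgue_density.

(** * Averages along a line *)

Section tonelli_average.
Context d (T : measurableType d) (R : realType) (mu : {measure set T -> \bar R}).
Hypothesis mu_sf : sigma_finite setT mu.

(** A local copy of [mu] that can carry the sigma-finite structure required by Tonelli's theorem,
    [mu] itself being sigma-finite by hypothesis only. *)
Let mu' : set T -> \bar R := mu.
Let mu'0 : mu' set0 = 0%E. Proof. exact: measure0. Qed.
Let mu'_ge0 A : (0 <= mu' A)%E. Proof. exact: measure_ge0. Qed.
Let mu'_sigma : semi_sigma_additive mu'. Proof. exact: measure_semi_sigma_additive. Qed.
HB.instance Definition _ := isMeasure.Build _ _ _ mu' mu'0 mu'_ge0 mu'_sigma.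
HB.instance Definition _ := @Measure_isSigmaFinite.Build _ _ _ mu' mu_sf.

Variables (G : T * measurableTypeR R -> R) (I : set (measurableTypeR R)).
Hypotheses (mG : measurable_fun [set: T * measurableTypeR R] G) (G0 : forall z, 0 <= G z).
Hypothesis mI : measurable I.

Let f (phi : T -> R) (z : T * measurableTypeR R) : \bar R := (phi z.1 * G z * \1_I z.2)%:E.

Let mf (phi : T -> R) : measurable_fun setT phi -> measurable_fun setT (f phi).
Proof.
move=> mphi; apply/measurable_EFinP; apply: measurable_funM.
  by apply: measurable_funM => //; exact: measurableT_comp mphi measurable_fst.
by apply: measurableT_comp; [exact: measurable_indic|exact: measurable_snd].
Qed.

Let f0 phi : (forall x, 0 <= phi x) -> forall z, (0 <= f phi z)%E.
Proof. by move=> phi0 z; rewrite lee_fin !mulr_ge0// indicE. Qed.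

(** An integral over [I], not divided by the length of [I]. *)
Definition average x : \bar R := (\int[lebesgue_measure]_(s in I) (G (x, s))%:E)%E.

Let averageE phi x : (forall x, 0 <= phi x) ->
  fubini_F lebesgue_measure (f phi) x = ((phi x)%:E * average x)%E.
Proof.
move=> phi0; rewrite /fubini_F /average.
have mGx : measurable_fun [set: measurableTypeR R] (fun s : measurableTypeR R => (G (x, s))%:E).
  by apply/measurable_EFinP; apply: (measurableT_comp mG); exact: pair1_measurable.
rewrite -ge0_integralZl => //; first last.
- by rewrite lee_fin.
- by move=> s _; rewrite lee_fin.
- exact: measurable_funTS.
rewrite [RHS]integral_mkcond.
apply: eq_integral => s _; rewrite patchE; case: ifPn => sI.
  by rewrite /f/= indicE sI mulr1 EFinM.
by rewrite /f/= indicE (negbTE sI) mulr0.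
Qed.

Lemma measurable_average : measurable_fun setT average.
Proof.
rewrite (_ : average = fubini_F lebesgue_measure (f (cst 1))).
  by apply: measurable_fun_fubini_tonelli_F => //; [exact: mf|exact: f0].
by apply/funext => x; rewrite averageE// mul1e.
Qed.

Let sliceE phi s : (forall x, 0 <= phi x) ->
  fubini_G mu' (f phi) s = ((fun s => \int[mu]_x (phi x * G (x, s))%:E) \_ I)%E s.
Proof.
move=> phi0; rewrite /fubini_G patchE; case: ifPn => sI.
  by apply: eq_integral => x _; rewrite /f/= indicE sI mulr1.
rewrite /= (_ : point = 0%E)//; apply: integral0_eq => x _.
by rewrite /f/= indicE (negbTE sI) mulr0.
Qed.

Lemma measurable_slice (phi : T -> R) : measurable_fun setT phi -> (forall x, 0 <= phi x) ->
  measurable_fun I (fun s : measurableTypeR R => \int[mu]_x (phi x * G (x, s))%:E)%E.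
Proof.
move=> mphi phi0; apply/(measurable_restrictT _ mI).
rewrite (_ : _ \_ I = fubini_G mu' (f phi)); last by apply/funext => s; rewrite sliceE.
by apply: measurable_fun_fubini_tonelli_G => //; [exact: mf|exact: f0].
Qed.

Lemma integral_average (phi : T -> R) : measurable_fun setT phi -> (forall x, 0 <= phi x) ->
  (\int[mu]_x ((phi x)%:E * average x) =
   \int[lebesgue_measure]_(s in I) \int[mu]_x (phi x * G (x, s))%:E)%E.
Proof.
move=> mphi phi0.
transitivity (\int[mu']_x fubini_F lebesgue_measure (f phi) x)%E.
  by apply: eq_integral => x _; rewrite averageE.
rewrite [RHS]integral_mkcond.
rewrite -(fubini_tonelli1 (m1:=mu') (m2:=lebesgue_measure))//; [|exact: mf|exact: f0].
rewrite (fubini_tonelli2 (m1:=mu') (m2:=lebesgue_measure))//; [|exact: mf|exact: f0].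
by apply: eq_integral => s _; rewrite sliceE.
Qed.

End tonelli_average.

(** A substitute for integrating a derivative: [q] need not be differentiable, it is enough that
    each short increment obeys the bound up to an error proportional to its length. Cutting [[0, h]]
    into equal steps, the errors sum to at most [h * e * |C|], whence the choice of the precision
    [e / (h * (|C| + 1))]. *)
Lemma increment_le_integral (R : realType) (V : completeNormedModType R) (q : R -> V)
    (r : measurableTypeR R -> \bar R) (h C : R) :
  0 < h -> (forall s, 0 <= r s)%E -> measurable_fun `[0, h[%classic r ->
  (forall e : R, 0 < e -> exists2 del : R, 0 < del & forall t eta : R, 0 <= t -> 0 <= eta ->
    eta < del -> t + eta <= h ->
    (`|q (t + eta) - q t|%:E <=
      \int[lebesgue_measure]_(s in `[t, (t + eta)%R[) r s + (eta * e * C)%R%:E)%E) ->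
  (`|q h - q 0|%:E <= \int[lebesgue_measure]_(s in `[0%R, h[) r s)%E.
Proof.
move=> h0 r0 mr H; apply/lee_addgt0Pr => e e0.
have C1 : 0 < `|C| + 1 by rewrite ltr_pwDr.
have e1 : 0 < e / (h * (`|C| + 1)) by rewrite divr_gt0// mulr_gt0.
have [del del0 Hdel] := H _ e1.
have [m mdel] : exists m, h / m.+1%:R < del.
  have dh : 0 < del / h by rewrite divr_gt0.
  near \oo => m; exists m; rewrite ltr_pdivrMr// mulrC -ltr_pdivrMr//.
  rewrite -[X in _ < X]invrK -[ltLHS]invrK ltf_pV2 ?posrE ?invr_gt0 ?divr_gt0//.
  by rewrite invf_div; near: m; exact: (near_infty_natSinv_lt (PosNum dh)).
set eta := h / m.+1%:R in mdel.
have eta0 : 0 < eta by rewrite divr_gt0.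
have etam : eta * m.+1%:R = h by rewrite divfK.
suff step i : (i <= m.+1)%N -> (`|q (eta * i%:R) - q 0|%:E <=
    \int[lebesgue_measure]_(s in `[0%R, (eta * i%:R)%R[) r s +
    (eta * i%:R * (e / (h * (`|C| + 1))) * `|C|)%R%:E)%E.
  have := step m.+1 (leqnn _); rewrite etam => /le_trans; apply.
  rewrite leeD2l// lee_fin invfM mulrA mulrCA mulrA mulrA.
  rewrite mulVf ?gt_eqF// mul1r -mulrA ger_pMr//.
  by rewrite ler_pdivrMl// mulr1 lerDl.
elim: i => [_|i IH im].
  by rewrite mulr0 !mul0r adde0 subrr normr0 integral_ge0.
have {}IH := IH (ltnW im).
have iS : eta * i.+1%:R = eta * i%:R + eta by rewrite -addn1 natrD mulrDr mulr1.
have ih : eta * i%:R + eta <= h by rewrite -etam -iS ler_pM2l// ler_nat.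
have i0 : 0 <= eta * i%:R by rewrite mulr_ge0// ltW.
have {}Hdel := Hdel _ _ i0 (ltW eta0) mdel ih.
rewrite iS.
have -> : `[0, eta * i%:R + eta[%classic =
    `[0, eta * i%:R[%classic `|` `[eta * i%:R, eta * i%:R + eta[%classic.
  apply/seteqP; split => s /=; rewrite !in_itv/=.
    move=> /andP[s0 s1]; case: (ltP s (eta * i%:R)) => s2; [left|right].
      by rewrite s0.
    by rewrite s1.
  case=> /andP[s0 s1].
    by rewrite s0/= (lt_le_trans s1)// lerDl ltW.
  by rewrite s1 (le_trans i0).
rewrite ge0_integral_setU//; last 2 first.
- apply: measurable_funS mr => // s /=; rewrite !in_itv/=.
  case=> /andP[s0 s1].
    by rewrite s0/= (lt_le_trans s1)// (le_trans _ ih)// lerDl ltW.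
  by rewrite (le_trans i0 s0) (lt_le_trans s1).
- apply/disj_setPS => s [] /=; rewrite !in_itv/= => /andP[_ s1] /andP[s2 _].
  by move: (lt_le_trans s1 s2); rewrite ltxx.
apply: (@le_trans _ _ (`|q (eta * i%:R + eta) - q (eta * i%:R)|%:E + `|q (eta * i%:R) - q 0|%:E)%E).
  rewrite -EFinD lee_fin; apply: le_trans (ler_normD _ _).
  by rewrite addrA subrK.
apply: (le_trans (leeD Hdel IH)).
rewrite addeACA (addeC (\int[_]_(s in _) _ s)%E) leeD2l// -EFinD lee_fin addrC.
by rewrite !mulrDl lerD2l ler_wpM2l ?ler_norm// mulr_ge0// ltW.
Unshelve. all: by end_near. Qed.

Section borel_representative.
Context {R : realType} {n : nat}.
Local Notation L := (rV_lebesgue R n).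
Local Notation mu := (@lebesgue_rV R n).

(* Joint measurability of [gam (x + s *: e)] in [(x, s)] requires [gam] to be Borel, not only
   Lebesgue measurable. *)
Lemma borel_representative (F : L -> R) : measurable_fun [set: L] F -> (forall x, 0 <= F x) ->
  exists gam : borel_rV R n -> R, [/\ measurable_fun [set: borel_rV R n] gam,
    forall x, 0 <= gam x & {ae mu, forall x, gam x = F x}].
Proof.
move=> mF F0.
have mA (q : rat) : measurable ([set x | ratr q < F x] : set L).
  by apply: measurable_lt_fun => //; exact: measurable_cst.
have /choice[C hC] (q : rat) : exists C : set (borel_rV R n),
    [/\ measurable C, [set x | ratr q < F x] `<=` C &
      mu (C `\` [set x | ratr q < F x]) = 0%E].
  by have [B mB [AB B0]] := borel_hull (mA q); exists B.
pose N := \bigcup_i (C (odflt 0 (unpickle i)) `\` [set x | ratr (odflt 0 (unpickle i)) < F x]) : set L.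
have mN i : measurable (C (odflt 0 (unpickle i)) `\` [set x | ratr (odflt 0 (unpickle i)) < F x] : set L).
  by apply: measurableD => //; apply: borel_lebesgue_measurable; case: (hC (odflt 0 (unpickle i))).
have mNN : measurable N by exact: bigcup_measurable.
have N0 : mu N = 0%E.
  apply: measure_negligible => //; apply: negligible_bigcup => i.
  apply/negligibleP; first exact: mN.
  by case: (hC (odflt 0 (unpickle i))).
have [N' mN' [NN' N'0]] := borel_hull mNN.
have N'0' : mu N' = 0%E.
  have -> : N' = N `|` (N' `\` N) by rewrite setDUK.
  rewrite measureU0//; apply: measurableD => //.
  exact: borel_lebesgue_measurable.
(* Off the Borel null set [N'], each Borel hull [C q] coincides with the superlevel set that it
   covers. Setting [F] to 0 on [N'] therefore leaves Borel superlevel sets, described through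
   rational levels. *)
exists (fun x => F x * \1_(~` N') x); split.
- apply: (measurability _ (RGenOInfty.measurableE R)) => _ [_ [a ->] <-]; rewrite setTI.
  case: (ltP a 0) => a0.
    rewrite (_ : _ @^-1` _ = setT)//; apply/seteqP; split => // x _ /=.
    by rewrite in_itv/= andbT (lt_le_trans a0)// mulr_ge0// indicE.
  rewrite (_ : _ @^-1` _ = \bigcup_(q in [set q : rat | a <= ratr q]) (C q `&` ~` N')).
    rewrite bigcup_mkcond; apply: bigcupT_measurable_rat => q; case: ifPn => // _.
    by apply: measurableI; [case: (hC q)|exact: measurableC].
  apply/seteqP; split => x /=.
    rewrite in_itv/= andbT indicE; case: (boolP (x \in ~` N')) => [|_]; last first.
      by rewrite mulr0 ltNge a0.
    rewrite inE mulr1 => N'x aF.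
    have [q] := rat_in_itvoo aF; rewrite in_itv/= => /andP[aq qF].
    exists q; first exact: ltW.
    by split => //; case: (hC q) => _ + _; apply.
  case=> q/= aq [Cq N'x]; rewrite in_itv/= andbT indicE mem_set// mulr1.
  apply: (le_lt_trans aq).
  apply: contrapT => qF; apply: N'x; apply: NN'; exists (pickle q); first by [].
  by rewrite pickleK; split.
- by move=> x; rewrite mulr_ge0// indicE.
- have mN'L := borel_lebesgue_measurable mN'.
  exists (N' : set L).
  split; [exact: mN'L|exact: N'0'|] => x xN.
  apply: contrapT => N'x; apply: xN => /=.
  by rewrite indicE mem_set ?mulr1.
Qed.

Lemma measurable_add_line (gam : borel_rV R n -> R) (e : 'rV[R]_n) :
  measurable_fun [set: borel_rV R n] gam ->
  measurable_fun [set: L * measurableTypeR R]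
    (fun z : L * measurableTypeR R => gam ((z.1 : 'rV[R]_n) + z.2 *: e)).
Proof.
move=> mgam; apply: (measurableT_comp mgam).
apply: measurable_fun_rVP => i.
have -> : rV_coor i \o (fun z : L * measurableTypeR R => ((z.1 : 'rV[R]_n) + z.2 *: e : borel_rV R n)) =
   (fun z => (z.1 : 'rV[R]_n) ord0 i + z.2 * e ord0 i).
  by apply/funext => z; rewrite /= /rV_coor !mxE.
apply: measurable_funD.
  apply: (@measurableT_comp _ _ _ _ _ _ (fun x : L => (x : 'rV[R]_n) ord0 i)); last exact: measurable_fst.
  move=> _ Y mY; rewrite setTI; apply: borel_lebesgue_measurable.
  by rewrite -[X in measurable X]setTI; exact: measurable_rV_coor.
by apply: measurable_funM; [exact: measurable_snd|exact: measurable_cst].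
Qed.

End borel_representative.

Section difference_quotients.
Context {R : realType} {n : nat}.
Local Notation d j f := (@partial R n R^o j f).
Local Notation e j := (delta_mx ord0 j : 'rV[R]_n).

Lemma rV_norm_delta_le j : `|e j| <= 1.
Proof.
apply/ler_addgt0Pl => eps eps0; apply/ltW/rV_norm_ltP => [|i]; first by rewrite addr_gt0.
by rewrite mxE eqxx/=; case: eqP => _; rewrite ?normr1 ?normr0 ?ltrDr// addr_gt0.
Qed.

Lemma partial_support (K : set 'rV[R]_n) f j : smooth f -> closed K ->
  (forall x, f x != 0 -> K x) -> forall x, d j f x != 0 -> K x.
Proof.
move=> sf cK fK x; apply: contra_neqP => Kx.
apply: partialE; apply/is_deriveP.
have oK : open (~` K) by exact: closed_openC.
have nK : \forall h \near (0 : R), (~` K) (h *: e j + x).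
  have cvx : (fun h : R => h *: e j + x) @ (0 : R) --> x.
    rewrite -[X in _ --> X]add0r; apply: cvgD; last exact: cvg_cst.
    by rewrite -[X in _ --> X](scale0r (e j)); apply: cvgZr_tmp; exact: cvg_id.
  by apply: cvx; exact: open_nbhs_nbhs.
have f0 y : ~ K y -> f y = 0 by move=> Ky; apply: contra_notP Ky => /eqP; exact: fK.
apply: cvg_near_cst; apply: (@nbhs_dnbhs R^o) => //.
near=> h; rewrite f0 ?(f0 x)//; last by near: h.
by rewrite subrr scaler0.
Unshelve. all: by end_near. Qed.

(** The mean value theorem and the uniform continuity of [d j f]. The derivative may be taken
    anywhere on the segment; the later uses take the far end [theta = eta], where translation by
    [- eta *: e] brings the base point back to a fixed position. *)
Lemma uniform_difference_quotient f K j : smooth f -> compact K ->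
  (forall x, f x != 0 -> K x) -> forall eps : R, 0 < eps -> exists2 del : R, 0 < del &
  forall x (eta theta : R), 0 <= theta <= eta -> eta < del ->
  `|f (x + eta *: e j) - f x - eta * d j f (x + theta *: e j)| <= eta * eps.
Proof.
move=> sf cK fK eps eps0.
have sdf : smooth (d j f) := smooth_partial j sf.
have clK : closed K by apply: compact_closed => //; exact: norm_hausdorff.
have [del del0 Hdel] := compact_supp_unif (smooth_continuous sdf) cK
  (partial_support sf clK fK) eps0.
exists del => // x eta theta /andP[th0 thE] Edel.
have eta0 : 0 <= eta := le_trans th0 thE.
have [||c] := @MVT_segment R (fun s : R => f (s *: e j + x)) (fun s => d j f (s *: e j + x)) 0 eta eta0.
- by move=> s _; exact: is_derive_smooth.
- apply: derivable_within_continuous => s _.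
  by have [] := is_derive_smooth j x s sf.
rewrite in_itv/= scale0r add0r subr0 => /andP[c0 cE].
rewrite !(addrC x) => ->; rewrite (mulrC _ eta) -mulrBr normrM ger0_norm// ler_wpM2l//.
apply/ltW/Hdel; rewrite opprD addrACA subrr addr0 -scalerBl normrZ.
apply: (@le_lt_trans _ _ (`|c - theta|)); first by rewrite ler_piMr// rV_norm_delta_le.
by rewrite ltr_norml; apply/andP; split; lra.
Qed.

End difference_quotients.

(** * Increments of weakly differentiable functions *)

Definition bounded_measurable d (T : measurableType d) (R : realType) (psi : T -> R) :=
  measurable_fun [set: T] psi /\ exists C, forall x, `|psi x| <= C.

Section bounded_multipliers.
Context d (T : measurableType d) (R : realType) (mu : {measure set T -> \bar R}).
Hypothesis mu_complete : measure_is_complete mu.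
Variable V : completeNormedModType R.
Local Notation L1 := (bochner_L1 mu setT).
Local Notation BI := (bochner_integral mu setT).
Implicit Types (psi : T -> R) (w : T -> V).

Lemma bochner_L1_scale psi w : bounded_measurable psi -> L1 w -> L1 (fun x => psi x *: w x).
Proof.
move=> [mpsi [C psiC]] Lw; have [sw _] := Lw.
apply: (bochner_L1_le mu_complete (w := fun x => C *: w x + 0)).
- by apply: strongly_measurableZ => //; exact: measurable_strongly_measurable.
- by apply: (bochner_L1_linear mu_complete) => //; exact: bochner_L1_0.
- apply: aeW => x; rewrite addr0 !normrZ ler_wpM2r//.
  exact: le_trans (psiC x) (ler_norm _).
Qed.

Lemma bochner_integral_scale_linear (a : R) psi psi' w :
  bounded_measurable psi -> bounded_measurable psi' -> L1 w ->
  BI (fun x => (a * psi x + psi' x) *: w x) = a *: BI (fun x => psi x *: w x) + BI (fun x => psi' x *: w x).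
Proof.
move=> bpsi bpsi' Lw; rewrite -(bochner_integral_linear mu_complete); [|exact: bochner_L1_scale..].
by congr (bochner_integral _ _ _); apply/funext => x; rewrite scalerDl scalerA.
Qed.

Lemma le_bochner_integral_scale psi w (gam : T -> R) : bounded_measurable psi -> L1 w ->
  measurable_fun setT gam -> (forall x, 0 <= gam x) -> {ae mu, forall x, `|w x| <= gam x} ->
  (`|BI (fun x => psi x *: w x)|%:E <= \int[mu]_x (`|psi x| * gam x)%:E)%E.
Proof.
move=> bpsi Lw mgam gam0 wgam; have Lpw := bochner_L1_scale bpsi Lw.
have [mpsi _] := bpsi.
apply: le_trans (le_bochner_integral_norm mu_complete Lpw) _.
apply: ae_ge0_le_integral => //.
- by apply: (strongly_measurable_enorm mu_complete); case: Lpw.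
- by move=> x _; rewrite lee_fin mulr_ge0.
- exact: measurable_weighted.
- by apply: filterS wgam => x wgx _; rewrite lee_fin normrZ ler_wpM2l.
Qed.

Lemma le_bochner_integral_bounded psi w (C : R) : bounded_measurable psi -> L1 w ->
  (forall x, `|psi x| <= C) ->
  (`|BI (fun x => psi x *: w x)|%:E <= C%:E * \int[mu]_x `|w x|%:E)%E.
Proof.
move=> bpsi Lw psiC; have Lpw := bochner_L1_scale bpsi Lw; have [sw _] := Lw.
apply: le_trans (le_bochner_integral_norm mu_complete Lpw) _.
have mw := strongly_measurable_enorm mu_complete sw.
have C0 : 0 <= C by exact: le_trans (psiC point).
rewrite -ge0_integralZl//; apply: ge0_le_integral => //.
- by apply: (strongly_measurable_enorm mu_complete); case: Lpw.
- by apply: measurable_funeM.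
- by move=> x _; rewrite -EFinM lee_fin normrZ ler_wpM2r.
Qed.

End bounded_multipliers.

Lemma bounded_measurable_lin d (T : measurableType d) (R : realType) (a : R) (f g : T -> R) :
  bounded_measurable f -> bounded_measurable g -> bounded_measurable (fun x => a * f x + g x).
Proof.
move=> [mf [C fC]] [mg [C' gC']]; split.
  by apply: measurable_funD => //; exact: measurable_funM.
exists (`|a| * C + C') => x; apply: (le_trans (ler_normD _ _)); apply: lerD => //.
by rewrite normrM ler_wpM2l.
Qed.

Lemma le_weighted_norm_osc d (T : measurableType d) (R : realType) (mu : {measure set T -> \bar R})
    (k F G : T -> R) (eps : R) :
  measurable_fun [set: T] k -> (forall x, 0 <= k x) ->
  measurable_fun [set: T] F -> measurable_fun [set: T] G ->
  0 <= eps -> (forall x, `|F x - G x| <= eps) ->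
  (weighted_norm mu k G <= weighted_norm mu k F + eps%:E * \int[mu]_x (k x)%:E)%E.
Proof.
move=> mk k0 mF mG eps0 osc.
have mke : measurable_fun setT (fun x => (k x)%:E) by exact/measurable_EFinP.
have mkF := measurable_weighted mk mF.
rewrite -ge0_integralZl//; last by move=> x _; rewrite lee_fin.
rewrite -ge0_integralD//; last 3 first.
- by move=> x _; rewrite lee_fin mulr_ge0.
- by move=> x _; rewrite -EFinM lee_fin mulr_ge0.
- exact: measurable_funeM.
apply: ge0_le_integral => //.
- by move=> x _; rewrite lee_fin mulr_ge0.
- exact: measurable_weighted.
- by apply: emeasurable_funD => //; exact: measurable_funeM.
- move=> x _; rewrite -EFinM -EFinD lee_fin -mulrDl ler_wpM2r//.
  have := osc x; have := ler_normD (G x - F x) (F x).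
  rewrite subrK distrC; lra.
Qed.

Section compactly_supported.
Context {R : realType} {n : nat}.
Local Notation L := (rV_lebesgue R n).

Lemma compact_supp_bounded (f : 'rV[R]_n -> R) K : continuous f -> compact K ->
  (forall x, f x != 0 -> K x) -> @bounded_measurable _ L R f.
Proof.
move=> cf cK fK; split; first exact: continuous_lebesgue_measurable.
have cfK : compact (f @` K) by apply: continuous_compact => //; exact: continuous_subspaceT.
have [M [_ HM]] := compact_bounded cfK.
exists (`|M| + 1) => x; have [->|/fK Kx] := eqVneq (f x) 0; first by rewrite normr0 addr_ge0.
by apply: (HM (`|M| + 1)); [rewrite (le_lt_trans (ler_norm _))// ltrDl|exists x].
Qed.

Lemma borel_fun_lebesgue (gam : borel_rV R n -> R) : measurable_fun [set: borel_rV R n] gam ->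
  measurable_fun [set: L] (gam : L -> R).
Proof.
move=> mgam _ Y mY; rewrite setTI; apply: borel_lebesgue_measurable.
by rewrite -[X in measurable X]setTI; exact: mgam.
Qed.

End compactly_supported.

Lemma integral_itv_cst (R : realType) (a b : R) (c : \bar R) : a <= b ->
  (\int[lebesgue_measure]_(s in (`[a, b[%classic : set (measurableTypeR R))) c = (b - a)%R%:E * c)%E.
Proof.
move=> ab; rewrite integral_cst//.
have := @lebesgue_measure_itv R (`[a, b[); rewrite /= lte_fin => ->.
rewrite muleC; case: ltP => [_|ba]; first by rewrite EFinB.
by rewrite (_ : b = a) ?subrr//; apply/le_anti; rewrite ab ba.
Qed.

Section line_integrals.
Context {R : realType} {n : nat}.
Local Notation L := (rV_lebesgue R n).
Local Notation mu := (@lebesgue_rV R n).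
Variables (gam : borel_rV R n -> R) (e : 'rV[R]_n).
Hypotheses (mgam : measurable_fun [set: borel_rV R n] gam) (gam0 : forall x, 0 <= gam x).
Hypothesis Igam : (\int[mu]_x (gam x)%:E < +oo)%E.

Definition line_slice (psi : L -> R) (s : measurableTypeR R) : \bar R :=
  (\int[mu]_x (`|psi x| * gam ((x : 'rV[R]_n) + s *: e)%R)%:E)%E.

Lemma line_slice_ge0 psi s : (0 <= line_slice psi s)%E.
Proof. by apply: integral_ge0 => x _; rewrite lee_fin mulr_ge0. Qed.

Let shifted (psi : L -> R) (s : R) : L -> R := fun x => psi ((x : 'rV[R]_n) - s *: e).

Let measurable_shifted (psi : L -> R) s : measurable_fun [set: L] psi ->
  measurable_fun [set: L] (shifted psi s).
Proof. move=> mpsi; exact: (measurableT_comp mpsi (measurable_rV_shift (- (s *: e)))). Qed.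

(** Translation invariance moves the shift from [gam], which is merely measurable, to [psi]. The
    uniform continuity of [psi] then makes the slices vary little with [s], with no continuity of
    translations in L^1. *)
Lemma line_sliceE (psi : L -> R) s : measurable_fun [set: L] psi ->
  line_slice psi s = weighted_norm mu (gam : L -> R) (shifted psi s).
Proof.
move=> mpsi; rewrite /line_slice.
have H := measurable_weighted (borel_fun_lebesgue mgam) (measurable_shifted s mpsi).
rewrite /weighted_norm -(ge0_integral_rV_shift (s *: e) H); last by move=> x; rewrite lee_fin mulr_ge0.
by apply: eq_integral => x _; rewrite /shifted addrK.
Qed.

Lemma line_slice_osc (psi : L -> R) (eps : R) s t : measurable_fun [set: L] psi -> 0 <= eps ->
  (forall x : 'rV[R]_n, `|psi (x - s *: e) - psi (x - t *: e)| <= eps) ->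
  (line_slice psi t <= line_slice psi s + eps%:E * \int[mu]_x (gam x)%:E)%E.
Proof.
move=> mpsi eps0 osc; rewrite !line_sliceE//.
exact: (le_weighted_norm_osc mu (borel_fun_lebesgue mgam) gam0 (measurable_shifted s mpsi)
  (measurable_shifted t mpsi) eps0 osc).
Qed.

Lemma line_slice_unif (psi : 'rV[R]_n -> R) K : `|e| <= 1 -> continuous psi -> compact K ->
  (forall x, psi x != 0 -> K x) -> forall eps : R, 0 < eps -> exists2 del : R, 0 < del &
  forall s t, `|s - t| < del ->
  (line_slice psi t <= line_slice psi s + eps%:E * \int[mu]_x (gam x)%:E)%E.
Proof.
move=> e1 cpsi cK psiK eps eps0; have [del del0 H] := compact_supp_unif cpsi cK psiK eps0.
exists del => // s t st; apply: line_slice_osc; [exact: continuous_lebesgue_measurable|exact: ltW|].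
move=> x; apply/ltW/H; rewrite opprD addrACA subrr add0r -opprD normrN -scalerBl normrZ.
by apply: le_lt_trans st; rewrite ler_piMr.
Qed.

Lemma measurable_line_slice (psi : L -> R) (a b : R) : measurable_fun [set: L] psi ->
  measurable_fun (`[a, b[%classic : set (measurableTypeR R)) (line_slice psi).
Proof.
move=> mpsi.
have mpsi' : measurable_fun [set: L] (fun x => `|psi x|) by exact: measurableT_comp.
exact: (measurable_slice (@lebesgue_rV_sigma_finite R n) (measurable_add_line e mgam)
  (fun z => gam0 _) (measurable_itv _) mpsi' (fun x => normr_ge0 _)).
Qed.

Definition line_average (h : R) (x : L) : \bar R :=
  average (fun z : L * measurableTypeR R => gam ((z.1 : 'rV[R]_n) + z.2 *: e)) `[0, h[%classic x.

Lemma measurable_line_average h : measurable_fun [set: L] (line_average h).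
Proof.
exact: (measurable_average (measurable_add_line e mgam)
  (fun z => gam0 _) (measurable_itv _)).
Qed.

Lemma line_average_ge0 h x : (0 <= line_average h x)%E.
Proof. by apply: integral_ge0 => s _; rewrite lee_fin. Qed.

Lemma integral_line_average h (psi : L -> R) : measurable_fun [set: L] psi ->
  (\int[mu]_x (`|psi x|%:E * line_average h x) =
   \int[lebesgue_measure]_(s in `[0%R, h[) line_slice psi s)%E.
Proof.
move=> mpsi.
have mpsi' : measurable_fun [set: L] (fun x => `|psi x|) by exact: measurableT_comp.
exact: (integral_average (@lebesgue_rV_sigma_finite R n) (measurable_add_line e mgam)
  (fun z => gam0 _) (measurable_itv _) mpsi' (fun x => normr_ge0 _)).
Qed.

Let G := fine (\int[mu]_x (gam x)%:E).

Let GE : (\int[mu]_x (gam x)%:E = G%:E)%E.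
Proof. by rewrite fineK// ge0_fin_numE// integral_ge0// => x _; rewrite lee_fin. Qed.

Lemma le_line_slice_integral (psi : L -> R) (eps t eta : R) : measurable_fun [set: L] psi ->
  0 <= eps -> 0 <= eta ->
  (forall s, t <= s < t + eta -> (line_slice psi t <= line_slice psi s + eps%:E * \int[mu]_x (gam x)%:E)%E) ->
  (eta%:E * line_slice psi t <=
   \int[lebesgue_measure]_(s in `[t, (t + eta)%R[) line_slice psi s + (eta * eps * G)%R%:E)%E.
Proof.
move=> mpsi eps0 eta0 H; have G0 : 0 <= G.
  by rewrite fine_ge0// integral_ge0// => x _; rewrite lee_fin.
have I c : (\int[lebesgue_measure]_(s in `[t, (t + eta)%R[) c = eta%:E * c)%E.
  by rewrite integral_itv_cst ?lerDl// (addrC t) addrK.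
rewrite -I -mulrA EFinM -I -ge0_integralD//; last 3 first.
- by move=> s _; exact: line_slice_ge0.
- exact: measurable_line_slice.
- by move=> s _; rewrite lee_fin mulr_ge0.
apply: ge0_le_integral => //.
- by move=> s _; exact: line_slice_ge0.
- by apply: emeasurable_funD => //; exact: measurable_line_slice.
- move=> s /=; rewrite in_itv/= => ts; apply: (le_trans (H s ts)).
  by rewrite GE -EFinM.
Qed.

Lemma line_slice_integral_le (psi : L -> R) (eps h : R) : measurable_fun [set: L] psi ->
  0 <= eps -> 0 <= h ->
  (forall s, 0 <= s < h -> (line_slice psi s <= line_slice psi 0%R + eps%:E * \int[mu]_x (gam x)%:E)%E) ->
  (\int[lebesgue_measure]_(s in `[0%R, h[) line_slice psi s <=
   h%:E * (line_slice psi 0%R + (eps * G)%R%:E))%E.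
Proof.
move=> mpsi eps0 h0 H; have G0 : 0 <= G.
  by rewrite fine_ge0// integral_ge0// => x _; rewrite lee_fin.
have I c : (\int[lebesgue_measure]_(s in `[0%R, h[) c = h%:E * c)%E.
  by rewrite integral_itv_cst// subr0.
rewrite -I; apply: ge0_le_integral => //.
- by move=> s _; exact: line_slice_ge0.
- exact: measurable_line_slice.
- move=> s /=; rewrite in_itv/= => ts; apply: (le_trans (H s ts)).
  by rewrite GE -EFinM.
Qed.

End line_integrals.

Section fine_weights.
Context d (T : measurableType d) (R : realType) (mu : {measure set T -> \bar R}).
Variables (A : T -> \bar R) (U : set T).
Hypotheses (mA : measurable_fun [set: T] A) (A0 : forall x, (0 <= A x)%E).
Hypotheses (IA : (\int[mu]_x A x < +oo)%E) (mU : measurable U).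

(* [fine +oo = 0], so the weight vanishes where [A x = +oo]. *)
Definition fine_weight x := fine (A x) * \1_U x.

Lemma fine_weight_ge0 x : 0 <= fine_weight x.
Proof. by rewrite mulr_ge0 ?fine_ge0// indicE. Qed.

Lemma measurable_fine_weight : measurable_fun [set: T] fine_weight.
Proof.
apply: measurable_funM; last exact: measurable_indic.
by apply: measurableT_comp mA.
Qed.

Lemma fine_weight_le x : ((fine_weight x)%:E <= A x)%E.
Proof.
apply: (@le_trans _ _ (fine (A x))%:E).
  by rewrite lee_fin /fine_weight ler_piMr ?fine_ge0// indicE lern1 leq_b1.
by have := A0 x; case: (A x) => [a||]//; rewrite /= ?leey.
Qed.

(** An integrable [A] is finite almost everywhere, so the default value of [fine] at [+oo] is met on
    a null set only. This turns an extended-valued bound into the real weight required by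
    [test_dominated]. *)
Lemma weighted_norm_fine (psi : T -> R) : measurable_fun [set: T] psi -> (forall x, psi x != 0 -> U x) ->
  (\int[mu]_x (`|psi x|%:E * A x))%E = weighted_norm mu fine_weight psi.
Proof.
move=> mpsi psiU.
have iA : mu.-integrable setT A.
  apply/integrableP; split => //; under eq_integral do rewrite gee0_abs//.
  exact: IA.
have mpsi' : measurable_fun setT (fun x => `|psi x|%:E).
  by apply/measurable_EFinP; exact: measurableT_comp.
apply: ge0_ae_eq_integral => //.
- exact: emeasurable_funM.
- by apply: measurable_weighted => //; exact: measurable_fine_weight.
- by move=> x _; rewrite mule_ge0.
- by move=> x _; rewrite lee_fin mulr_ge0// fine_weight_ge0.
- have := integrable_ae measurableT iA; apply: filterS => x fx _.
  have [->|p0] := eqVneq (psi x) 0; first by rewrite normr0 mul0e mul0r.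
  rewrite /fine_weight indicE mem_set ?mulr1; last exact: psiU.
  by rewrite EFinM fineK//; exact: fx.
Qed.

Lemma integral_fine_weight_lty : (\int[mu]_x (fine_weight x)%:E < +oo)%E.
Proof.
apply: le_lt_trans IA; apply: ge0_le_integral => //.
- by move=> x _; rewrite lee_fin fine_weight_ge0.
- by apply/measurable_EFinP; exact: measurable_fine_weight.
- by move=> x _; exact: fine_weight_le.
Qed.

End fine_weights.

Lemma total_weight_lty d (T : measurableType d) (R : realType) (mu : {measure set T -> \bar R})
    (V : completeNormedModType R) (w : T -> V) (kap : T -> R) (A : set T) :
  measure_is_complete mu -> bochner_L1 mu setT w -> measurable_fun [set: T] kap ->
  (forall x, 0 <= kap x) -> (\int[mu]_x (kap x)%:E < +oo)%E -> measurable A ->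
  (\int[mu]_(x in A) (`|w x| + kap x)%:E < +oo)%E /\
  (weighted_norm mu (fun x => `|w x| + kap x)%R \1_A < +oo)%E.
Proof.
move=> mu_complete [sw woo] mkap kap0 kapoo mA.
have mw := strongly_measurable_norm mu_complete sw.
have mt : measurable_fun setT (fun x => `|w x| + kap x) by exact: measurable_funD.
have t0 x : 0 <= `|w x| + kap x by rewrite addr_ge0.
have H : (\int[mu]_(x in A) (`|w x| + kap x)%:E < +oo)%E.
  apply: (@le_lt_trans _ _ (\int[mu]_x (`|w x| + kap x)%:E)%E).
    apply: ge0_subset_integral => //; first exact/measurable_EFinP.
    by move=> x _; rewrite lee_fin.
  under eq_integral do rewrite EFinD.
  rewrite ge0_integralD//; last 3 first.
  - by apply/measurable_EFinP.
  - by move=> x _; rewrite lee_fin.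
  - by apply/measurable_EFinP.
  by rewrite lte_add_pinfty.
by split => //; apply: le_lt_trans H; exact: weighted_norm_indic_le.
Qed.

Lemma ae_imply d (T : measurableType d) (R : realType) (mu : {measure set T -> \bar R})
    (P Q : T -> Prop) : (forall x, P x -> Q x) ->
  {ae mu, forall x, P x} -> {ae mu, forall x, Q x}.
Proof. by move=> PQ; apply: filterS. Qed.

Lemma ae_eq_le d (T : measurableType d) (R : realType) (mu : {measure set T -> \bar R}) (f g : T -> R) :
  {ae mu, forall x, f x = g x} -> {ae mu, forall x, g x <= f x}.
Proof. by apply: ae_imply => x ->. Qed.

Lemma ae_integral_norm d (T : measurableType d) (R : realType) (mu : {measure set T -> \bar R})
    (V : completeNormedModType R) (w : T -> V) (gam : T -> R) : measure_is_complete mu ->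
  strongly_measurable mu setT w -> measurable_fun [set: T] gam -> (forall x, 0 <= gam x) ->
  {ae mu, forall x, gam x = `|w x|} ->
  (\int[mu]_x (gam x)%:E = \int[mu]_x `|w x|%:E)%E.
Proof.
move=> mu_complete sw mgam gam0 gw; apply: (ge0_ae_eq_integral measurableT).
- exact/measurable_EFinP.
- exact: (strongly_measurable_enorm mu_complete).
- by move=> x _; rewrite lee_fin.
- by move=> x _; rewrite lee_fin.
- by apply: filterS gw => x -> _.
Qed.

Section cut_off.
Context {R : realType} {n : nat} (V : completeNormedModType R).
Local Notation L := (rV_lebesgue R n).
Local Notation mu := (@lebesgue_rV R n).
Local Notation d j f := (@partial R n R^o j f).
Local Notation mu_complete := (@lebesgue_rV_complete R n).
Variables (Om K : set 'rV[R]_n).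
Hypotheses (cK : compact K) (KOm : K `<=` Om).

(** Translations act on integrals over the whole space, whereas [w] is only locally integrable on
    [Om]. A cut-off by an indicator, with no smoothness, is enough because the test functions paired
    with it are supported in [K]. *)
Definition cut_off (w : L -> V) : L -> V := fun x => \1_(K : set L) x *: w x.

Lemma bochner_L1_cut_off w : L1loc Om w -> bochner_L1 mu [set: L] (cut_off w).
Proof.
move=> [sw lw]; have [mK _] := lebesgue_compact cK; split.
  by apply: strongly_measurable_indic => //; exact: strongly_measurableS sw.
apply: le_lt_trans (lw K cK KOm); rewrite [leRHS]integral_mkcond.
rewrite le_eqVlt; apply/orP; left; apply/eqP; apply: eq_integral => x _.
rewrite patchE /cut_off indicE; case: ifPn => xK.
  by rewrite scale1r.
by rewrite scale0r normr0.
Qed.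

Lemma bochner_integral_cut_off (psi : 'rV[R]_n -> R) (w : L -> V) : open Om ->
  (forall x, psi x != 0 -> K x) ->
  bochner_integral mu [set: L] (fun x => psi x *: cut_off w x) =
  bochner_integral mu (Om : set L) (fun x => psi x *: w x).
Proof.
have mOm : open Om -> measurable (Om : set L).
  by move=> oOm; apply: borel_lebesgue_measurable; exact: open_borel.
move=> /mOm {}mOm psiK; rewrite [RHS](bochner_integral_restrict mu_complete _ mOm).
congr bochner_integral; apply/funext => x; rewrite /cut_off.
have [->|/psiK Kx] := eqVneq (psi x) 0; first by rewrite !scale0r scaler0.
by rewrite !indicE !mem_set ?scale1r//; exact: KOm.
Qed.

Lemma partial_compact_support j phi : smooth phi -> (forall x, phi x != 0 -> K x) ->
  forall x, d j phi x != 0 -> K x.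
Proof.
by move=> sphi; apply: partial_support => //; apply: compact_closed => //; exact: norm_hausdorff.
Qed.

Lemma cut_off_partial j (u g : L -> V) phi : open Om -> weak_partial Om j u g -> smooth phi ->
  (forall x, phi x != 0 -> K x) ->
  bochner_integral mu [set: L] (fun x => d j phi x *: cut_off u x) =
  - bochner_integral mu [set: L] (fun x => phi x *: cut_off g x).
Proof.
move=> oOm [_ _ wp] sphi phiK.
rewrite (bochner_integral_cut_off _ oOm (partial_compact_support sphi phiK)).
rewrite (bochner_integral_cut_off _ oOm phiK).
by apply: wp; apply/test_functionP; split => //; exists K.
Qed.

End cut_off.

Section weak_increments.
Context {R : realType} {n : nat} (V : completeNormedModType R).
Local Notation L := (rV_lebesgue R n).
Local Notation mu := (@lebesgue_rV R n).
Local Notation d j f := (@partial R n R^o j f).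
Local Notation mu_complete := (@lebesgue_rV_complete R n).
Variables (Om K : set 'rV[R]_n) (j : 'I_n) (u g : L -> V) (gam : borel_rV R n -> R).
Hypotheses (oOm : open Om) (cK : compact K) (KOm : K `<=` Om) (wp : weak_partial Om j u g).
Hypotheses (mgam : measurable_fun [set: borel_rV R n] gam) (gam0 : forall x, 0 <= gam x).
Hypothesis ggam : {ae mu, forall x, gam x = `|cut_off K g x|}.
Local Notation e := (delta_mx ord0 j : 'rV[R]_n).
Local Notation BI := (bochner_integral mu [set: L]).
Local Notation uK := (cut_off K u).
Local Notation gK := (cut_off K g).

Let Lu : bochner_L1 mu [set: L] uK.
Proof. by apply: (bochner_L1_cut_off cK KOm); case: wp. Qed.

Let Lg : bochner_L1 mu [set: L] gK.
Proof. by apply: (bochner_L1_cut_off cK KOm); case: wp. Qed.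

Lemma integral_gam_lty : (\int[mu]_x (gam x)%:E < +oo)%E.
Proof.
have [sg goo] := Lg; apply: le_lt_trans goo.
by rewrite (ae_integral_norm mu_complete sg (borel_fun_lebesgue mgam) gam0 ggam).
Qed.

Variables (U : set 'rV[R]_n) (h : R).
Hypotheses (oU : open U) (h0 : 0 < h).
Hypothesis UK : forall x t, U x -> 0 <= t <= h -> K (x + t *: e).

Let clK : closed K.
Proof. by apply: compact_closed => //; exact: norm_hausdorff. Qed.

(* The derivative of [t |-> \int psi(x - t e) u] is [\int psi(x - t e) g]: this is the fundamental
   theorem of calculus for [u] along [e], tested against [psi]. *)
Section translates.
Variables (psi : 'rV[R]_n -> R).
Hypothesis tpsi : test_function U psi.
Let psit t : 'rV[R]_n -> R := fun x => psi (x - t *: e).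

Let psiU x : psi x != 0 -> U x.
Proof. by have [_ [S [_ SU psiS]]] := (test_functionP _ _).1 tpsi => /psiS/SU. Qed.

Let psit_smooth t : smooth (psit t).
Proof. have [spsi _] := tpsi; apply/smoothP => k; exact: (Ck_shift (- (t *: e)) ((smoothP psi).1 spsi k)). Qed.

Let psitK t : 0 <= t <= h -> forall x, psit t x != 0 -> K x.
Proof. by move=> th x /psiU Ux; have := UK Ux th; rewrite subrK. Qed.

Let psit_bounded t : 0 <= t <= h -> @bounded_measurable _ L R (psit t).
Proof.
by move=> th; apply: (compact_supp_bounded (smooth_continuous (psit_smooth t)) cK (psitK th)).
Qed.

Let dpsit_bounded t : 0 <= t <= h -> @bounded_measurable _ L R (d j (psit t)).
Proof.
move=> th; apply: (compact_supp_bounded _ cK (partial_support (psit_smooth t) clK (psitK th))).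
exact: smooth_continuous (smooth_partial j (psit_smooth t)).
Qed.

Let q t : V := BI (fun x => psit t x *: uK x).
Let C := fine (\int[mu]_x `|uK x|%:E) + fine (\int[mu]_x (gam x)%:E).

(** Two errors of order [eta * eps] arise: the first-order remainder of [psi] paired with [u], and
    the replacement of [eta] times the slice at [t] by the integral of the slices over the step.
    Their coefficients add up to [C]. *)
Let q_increment (eps : R) : 0 < eps -> exists2 del : R, 0 < del &
  forall t eta : R, 0 <= t -> 0 <= eta -> eta < del -> t + eta <= h ->
  (`|q (t + eta) - q t|%:E <=
    \int[lebesgue_measure]_(s in `[t, (t + eta)%R[) line_slice gam e psi s + (eta * eps * C)%R%:E)%E.
Proof.
move=> eps0.
have spsi : smooth psi by case: tpsi.
have [_ [S [cS SU psiS]]] := (test_functionP _ _).1 tpsi.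
have [del1 del10 Hdel1] := uniform_difference_quotient j spsi cS psiS eps0.
have [del2 del20 Hdel2] := line_slice_unif mgam gam0 (rV_norm_delta_le j) (smooth_continuous spsi) cS psiS eps0.
exists (Num.min del1 del2); first by rewrite lt_min del10.
move=> t eta t0 eta0; rewrite lt_min => /andP[eta1 eta2] teta.
have th : 0 <= t <= h by rewrite t0/=; lra.
have th' : 0 <= t + eta <= h by rewrite teta andbT; lra.
(* [err] is the first-order remainder of the moving test function. The weak derivative trades
   [- eta * d j (psit t)] against [u] for [eta * psit t] against [g], so the increment of [q] is
   [eta] times a pairing with [g], plus the pairing of [err] with [u]. *)
pose err := fun x : L => eta * d j (psit t) x + (-1 * psit t x + psit (t + eta) x).
have berr : bounded_measurable err.
  exact: (bounded_measurable_lin eta (dpsit_bounded th)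
    (bounded_measurable_lin (-1) (psit_bounded th) (psit_bounded th'))).
have err_le x : `|err x| <= eta * eps.
  have := Hdel1 (x - (t + eta) *: e) eta eta _ eta1; rewrite eta0 lexx => /(_ isT).
  have -> : x - (t + eta) *: e + eta *: e = x - t *: e.
    by rewrite scalerDl opprD addrA subrK.
  rewrite /err (_ : d j (psit t) x = d j psi (x - t *: e)); last exact: partial_shift.
  rewrite -normrN; congr (`|_| <= _); rewrite /psit; ring.
have qE : q (t + eta) - q t = BI (fun x => err x *: uK x) + eta *: BI (fun x => psit t x *: gK x).
  have <- : BI (fun x => (1 * err x + (- eta * d j (psit t) x + psit t x)) *: uK x) = q (t + eta).
    congr bochner_integral; apply/funext => x; congr (_ *: _); rewrite /err; ring.
  have b1 : bounded_measurable (fun x : L => - eta * d j (psit t) x + psit t x).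
    exact: (bounded_measurable_lin (- eta) (dpsit_bounded th) (psit_bounded th)).
  rewrite (bochner_integral_scale_linear mu_complete 1 berr b1 Lu).
  rewrite (bochner_integral_scale_linear mu_complete (- eta) (dpsit_bounded th) (psit_bounded th) Lu).
  rewrite (cut_off_partial cK KOm oOm wp (psit_smooth t) (psitK th)).
  by rewrite scale1r scaleNr scalerN opprK addrA addrK.
have I1 : (`|BI (fun x => err x *: uK x)|%:E <= (eta * eps)%:E * \int[mu]_x `|uK x|%:E)%E.
  exact: (le_bochner_integral_bounded mu_complete berr Lu err_le).
have I2 : (`|BI (fun x => psit t x *: gK x)|%:E <= line_slice gam e psi t)%E.
  rewrite line_sliceE//; last by apply: continuous_lebesgue_measurable; exact: smooth_continuous.
  apply: (le_bochner_integral_scale mu_complete (psit_bounded th) Lg (borel_fun_lebesgue mgam)) => //.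
  exact: ae_eq_le ggam.
have I3 : (eta%:E * line_slice gam e psi t <=
   \int[lebesgue_measure]_(s in `[t, (t + eta)%R[) line_slice gam e psi s +
   (eta * eps * fine (\int[mu]_x (gam x)%:E))%R%:E)%E.
  apply: (le_line_slice_integral mgam gam0 integral_gam_lty _ (ltW eps0) eta0).
    by apply: continuous_lebesgue_measurable; exact: smooth_continuous.
  by move=> s /andP[ts st]; apply: Hdel2; rewrite ger0_norm; lra.
rewrite qE; apply: (@le_trans _ _ (`|BI (fun x => err x *: uK x)|%:E +
   eta%:E * `|BI (fun x => psit t x *: gK x)|%:E)%E).
  rewrite -EFinM -EFinD lee_fin; apply: le_trans (ler_normD _ _) _.
  by rewrite normrZ (ger0_norm eta0).
have I4 : (eta%:E * `|BI (fun x => psit t x *: gK x)|%:E <= eta%:E * line_slice gam e psi t)%E.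
  by apply: lee_wpmul2l I2; rewrite lee_fin.
apply: (le_trans (leeD I1 (le_trans I4 I3))).
rewrite addeCA leeD2l// /C mulrDr EFinD leeD2r// [X in (_ <= X)%E]EFinM fineK//.
rewrite ge0_fin_numE; first by case: Lu.
by apply: integral_ge0 => x _; rewrite lee_fin.
Qed.

Let increment x : V := uK ((x : 'rV[R]_n) + h *: e) - uK x.

Let L1_shift : bochner_L1 mu [set: L] (fun x : L => uK ((x : 'rV[R]_n) + h *: e)).
Proof.
exact: (bochner_integral_preserving mu_complete (measurable_rV_shift (h *: e))
  (fun A _ => lebesgue_rV_shift (h *: e) A) Lu).1.
Qed.

Let q_increment_total : BI (fun x => psi x *: increment x) = q h - q 0.
Proof.
have h01 : 0 <= h <= h by rewrite lexx ltW.
have h00 : (0:R) <= 0 <= h by rewrite lexx ltW.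
have -> : q h = BI (fun x => psi x *: uK ((x : 'rV[R]_n) + h *: e)).
  have := (bochner_integral_preserving mu_complete (measurable_rV_shift (h *: e))
    (fun A _ => lebesgue_rV_shift (h *: e) A)
    (bochner_L1_scale mu_complete (psit_bounded h01) Lu)).2.
  rewrite /q => <-; congr bochner_integral; apply/funext => x /=.
  by rewrite /psit addrK.
have psi0 : psit 0 = psi by apply/funext => x; rewrite /psit scale0r subr0.
have bpsi : @bounded_measurable _ L R psi by rewrite -psi0; exact: psit_bounded.
have -> : q 0 = BI (fun x => psi x *: uK x) by rewrite /q psi0.
rewrite addrC -scaleN1r -(bochner_integral_linear mu_complete); [|exact: (bochner_L1_scale mu_complete)..].
congr bochner_integral; apply/funext => x.
by rewrite /increment scalerBr scaleN1r addrC.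
Qed.

Lemma test_increment_le :
  (`|BI (fun x => psi x *: increment x)|%:E <=
   \int[lebesgue_measure]_(s in `[0%R, h[) line_slice gam e psi s)%E.
Proof.
rewrite q_increment_total.
apply: (increment_le_integral h0 (line_slice_ge0 e gam0 psi) _ q_increment).
apply: (measurable_line_slice e mgam gam0).
by apply: continuous_lebesgue_measurable; apply: smooth_continuous; case: tpsi.
Qed.

End translates.

(** By Tonelli, [test_increment_le] bounds the increment of [u] tested against any [psi] by the norm
    of [psi] weighted by the line integral. [test_dominated] turns these bounds into a pointwise
    one, the increment being cut to [U], where its translates stay in [K]. *)
Lemma weak_increment_dominated : {ae mu, forall x : L, U x ->
  (`|uK ((x : 'rV[R]_n) + h *: e) - uK x|%:E <= line_average gam e h x)%E}.
Proof.
have mU : measurable (U : set L) by apply: borel_lebesgue_measurable; exact: open_borel.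
have LD : bochner_L1 mu [set: L] (fun x : L => uK ((x : 'rV[R]_n) + h *: e) - uK x).
  have := bochner_L1_linear mu_complete (-1) Lu
    (bochner_integral_preserving mu_complete (measurable_rV_shift (h *: e))
      (fun A _ => lebesgue_rV_shift (h *: e) A) Lu).1.
  by congr (bochner_L1 _ _ _); apply/funext => x; rewrite scaleN1r addrC.
have LUD := bochner_L1_indic mu_complete mU LD.
set D := (X in bochner_L1 mu setT X) in LUD.
have mA := measurable_line_average e mgam gam0 h.
have A0 := line_average_ge0 e gam0 h.
have IA : (\int[mu]_x line_average gam e h x < +oo)%E.
  (* Testing with the constant 1: by translation invariance all slices equal the integral of [gam],
     so the line integral has total mass [h] times that. *)
  have m1 : measurable_fun [set: L] (cst 1 : L -> R) by exact: measurable_cst.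
  have := integral_line_average e mgam gam0 h m1.
  under eq_integral do rewrite normr1 mul1e.
  move=> ->.
  rewrite (eq_integral (fun=> \int[mu]_x (gam x)%:E)%E); last first.
    move=> s _; rewrite line_sliceE//; apply: eq_integral => x _.
    by rewrite normr1 mul1r.
  rewrite integral_itv_cst ?ltW// lte_mul_pinfty// ?lee_fin ?subr_ge0 ?ltW//.
  exact: integral_gam_lty.
have mk := measurable_fine_weight mA mU.
have k0 := fine_weight_ge0 (U : set L) A0.
have [sD Doo] := LUD.
have mD := strongly_measurable_norm mu_complete sD.
suff : {ae mu, forall x, `|D x| <= fine_weight (line_average gam e h) (U : set L) x}.
  apply: ae_imply => x Dx Ux.
  apply: le_trans (fine_weight_le (U : set L) A0 x).
  by rewrite lee_fin; apply: le_trans Dx; rewrite /D indicE mem_set// scale1r.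
pose tot := fun x => `|D x| + fine_weight (line_average gam e h) (U : set L) x.
have mtot : measurable_fun [set: L] tot by exact: measurable_funD.
have tot0 x : 0 <= tot x by rewrite addr_ge0.
have Ikap : (\int[mu]_x (fine_weight (line_average gam e h) (U : set L) x)%:E < +oo)%E.
  exact: (integral_fine_weight_lty mA A0 IA mU).
have Itot A mA' := total_weight_lty mu_complete LUD mk k0 Ikap (A := A) mA'.
apply: (test_dominated mu_complete (tst := test_function U) (@test_function_measurable _ _ _) LUD mk k0).
- move=> A mA'; apply: (test_function_dense oU mtot tot0).
  + move=> x; apply: contra_neqP => Ux.
    by rewrite /tot /D /fine_weight indicE memNset// scale0r mulr0 normr0 addr0.
  + move=> S cS _; have [mS _] := lebesgue_compact cS.
    exact: (Itot _ mS).1.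
  + exact: measurable_indic.
  + exact: (Itot _ mA').2.
move=> psi tpsi.
have [_ [S [_ SU psiS]]] := (test_functionP _ _).1 tpsi.
rewrite -(weighted_norm_fine mA A0 IA mU (test_function_measurable tpsi)); last by move=> x /psiS/SU.
rewrite (integral_line_average e mgam gam0 h (test_function_measurable tpsi)).
apply: le_trans (test_increment_le tpsi).
rewrite lee_fin le_eqVlt; apply/orP; left; apply/eqP; congr (`|bochner_integral _ _ _|).
apply/funext => x; have [->|/psiS/SU Ux] := eqVneq (psi x) 0; first by rewrite !scale0r.
by rewrite /D indicE mem_set// scale1r.
Qed.

End weak_increments.

Section ae_comparison.
Context d (T : measurableType d) (R : realType) (mu : {measure set T -> \bar R}).

Lemma le_bochner_integral_scale_ereal (V : completeNormedModType R) (psi : T -> R) (w : T -> V)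
    (M : R) (A : T -> \bar R) : measure_is_complete mu -> bounded_measurable psi ->
  bochner_L1 mu setT w -> 0 <= M -> measurable_fun [set: T] A -> (forall x, (0 <= A x)%E) ->
  {ae mu, forall x, psi x != 0 -> (`|w x|%:E <= M%:E * A x)%E} ->
  (`|bochner_integral mu setT (fun x => psi x *: w x)|%:E <=
   M%:E * \int[mu]_x (`|psi x|%:E * A x))%E.
Proof.
move=> mu_complete bpsi Lw M0 mA A0 wA; have Lpw := bochner_L1_scale mu_complete bpsi Lw.
have [mpsi _] := bpsi.
have mpA : measurable_fun setT (fun x => (`|psi x|%:E * A x)%E).
  by apply: emeasurable_funM => //; apply/measurable_EFinP; exact: measurableT_comp.
apply: le_trans (le_bochner_integral_norm mu_complete Lpw) _.
rewrite -ge0_integralZl//; last by move=> x _; rewrite mule_ge0.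
apply: ae_ge0_le_integral => //.
- by apply: (strongly_measurable_enorm mu_complete); case: Lpw.
- by move=> x _; rewrite !mule_ge0.
- exact: measurable_funeM.
- apply: filterS wA => x wA _; rewrite normrZ.
  have [->|p0] := eqVneq (psi x) 0; first by rewrite normr0 mul0r mul0e mule0.
  by rewrite EFinM muleCA lee_wpmul2l// wA.
Qed.

Lemma ae_weighted_norm (k k' psi : T -> R) :
  measurable_fun [set: T] k -> measurable_fun [set: T] k' -> measurable_fun [set: T] psi ->
  (forall x, 0 <= k x) -> (forall x, 0 <= k' x) ->
  {ae mu, forall x, psi x != 0 -> k x = k' x} -> weighted_norm mu k psi = weighted_norm mu k' psi.
Proof.
move=> mk mk' mpsi k0 k'0 kk'; apply: ge0_ae_eq_integral => //; try exact: measurable_weighted.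
- by move=> x _; rewrite lee_fin mulr_ge0.
- by move=> x _; rewrite lee_fin mulr_ge0.
- apply: filterS kk' => x kk' _; have [->|p0] := eqVneq (psi x) 0; first by rewrite normr0 !mul0r.
  by rewrite kk'.
Qed.

End ae_comparison.

(** Leaves room for difference quotients: a function tested on [U] is evaluated only inside [K],
    even after a translation of length at most [r]. *)
Lemma compact_margin {R : realType} {n : nat} (Om S : set 'rV[R]_n) : open Om -> compact S -> S `<=` Om ->
  exists K U (r : R), [/\ compact K, K `<=` Om, open U, S `<=` U &
    0 < r /\ forall x y, U x -> `|y| <= r -> K (x + y)].
Proof.
move=> oOm cS SOm.
have [|del del0 H] := compact_uniform_radius (P := fun _ y => Om y) cS.
  move=> x Sx.
  have /nbhs_ballP[r /= r0 xr] : nbhs x Om by apply: open_nbhs_nbhs; split => //; exact: SOm.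
  by exists r => // x' y _ xy; apply: xr; rewrite -ball_normE.
(* Points of [U] are within [r] of [S] and translations add at most [r], so boxes of half-side
   [r + r] around [S] suffice; [del / 4] keeps these within distance [del] of [S]. *)
pose r := del / 4; have r0 : 0 < r by rewrite divr_gt0.
pose B := closed_box (const_mx (- (r + r)) : 'rV[R]_n) (const_mx (r + r)).
exists ((fun z : 'rV[R]_n * 'rV[R]_n => z.1 + z.2) @` (S `*` B)), (\bigcup_(x in S) ball x r), r; split.
- apply: continuous_compact; last by apply: compact_setX => //; exact: compact_closed_box.
  by apply: continuous_subspaceT => z; exact: add_continuous.
- move=> _ [[x y] /= [Sx By] <-]; apply: (H x Sx).
  rewrite opprD addrA subrr add0r normrN; apply/rV_norm_ltP => // i.
  have := By i; rewrite !mxE => /andP[y1 y2]; rewrite ltr_norml; apply/andP; split; rewrite /r in y1 y2; lra.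
- by apply: bigcup_open => x _; exact: ball_open.
- by move=> x Sx; exists x => //; exact: ballxx.
- split => // x y [z Sz]; rewrite -ball_normE/= => zx yr.
  exists (z, (x - z) + y); last by rewrite /= addrA (addrC z) subrK.
  split => //= i; rewrite !mxE.
  have h1 := le_trans (rV_coord_le y i) yr; have := rV_coord_le (x - z) i.
  rewrite !mxE distrC in zx *; move: h1; rewrite !ler_norml => /andP[h1 h2] /andP[h3 h4].
  by apply/andP; split; lra.
Qed.

Section lipschitz_partial.
Context {R : realType} {n : nat} (V Z : completeNormedModType R).
Local Notation L := (rV_lebesgue R n).
Local Notation mu := (@lebesgue_rV R n).
Local Notation d j f := (@partial R n R^o j f).
Local Notation mu_complete := (@lebesgue_rV_complete R n).
Variables (Om : set 'rV[R]_n) (j : 'I_n) (u g : L -> V) (v : L -> Z) (M : R).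
Hypotheses (oOm : open Om) (wp : weak_partial Om j u g) (lv : L1loc Om v) (M0 : 0 <= M).
Hypothesis uv : forall x y, `|v x - v y| <= M * `|u x - u y|.
Local Notation e := (delta_mx ord0 j : 'rV[R]_n).

Section compact_support.
Variables (K U : set 'rV[R]_n) (r : R) (gam : borel_rV R n -> R) (phi : 'rV[R]_n -> R).
Hypotheses (cK : compact K) (KOm : K `<=` Om) (oU : open U) (r0 : 0 < r).
Hypothesis UK : forall x y, U x -> `|y| <= r -> K (x + y).
Hypotheses (mgam : measurable_fun [set: borel_rV R n] gam) (gam0 : forall x, 0 <= gam x).
Hypothesis ggam : {ae mu, forall x, gam x = `|cut_off K g x|}.
Hypothesis tphi : test_function U phi.
Local Notation BI := (bochner_integral mu [set: L]).
Local Notation vK := (cut_off K v).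
Local Notation uK := (cut_off K u).

Let Lv : bochner_L1 mu [set: L] vK.
Proof. exact: (bochner_L1_cut_off cK KOm). Qed.

Let sphi : smooth phi. Proof. by case: tphi. Qed.

Let phiU x : phi x != 0 -> U x.
Proof. by have [_ [S [_ SU phiS]]] := (test_functionP _ _).1 tphi => /phiS/SU. Qed.

Let mphi : measurable_fun [set: L] (phi : L -> R).
Proof. exact: test_function_measurable tphi. Qed.

Let cut_offE (W : completeNormedModType R) (w : L -> W) x (h : R) : U x -> 0 <= h <= r ->
  cut_off K w ((x : 'rV[R]_n) + h *: e) = w ((x : 'rV[R]_n) + h *: e).
Proof.
move=> Ux /andP[h0 hr]; rewrite /cut_off indicE mem_set ?scale1r//.
apply: UK => //; apply: le_trans hr; rewrite normrZ (ger0_norm h0) ler_piMr//.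
exact: rV_norm_delta_le.
Qed.

Let bounded_test (f : 'rV[R]_n -> R) : test_function setT f -> @bounded_measurable _ L R f.
Proof.
move=> tf; have [sf [S [cS _ fS]]] := (test_functionP _ _).1 tf.
exact: compact_supp_bounded (smooth_continuous sf) cS fS.
Qed.

(** The estimate at a fixed [h], already divided by [h]. Its two errors come from the difference
    quotient of [phi], paired with [v], and from replacing each slice with [s < h] by the slice at
    0, which is the weighted norm of [phi]. *)
Let lipschitz_step (eps h : R) : 0 < eps -> 0 < h -> h <= r ->
  (forall x, `|phi x - phi (x - h *: e) - h * d j phi x| <= h * eps) ->
  (forall s, 0 <= s < h -> (line_slice gam e phi s <=
     line_slice gam e phi 0%R + eps%:E * \int[mu]_x (gam x)%:E)%E) ->
  (`|BI (fun x => d j phi x *: vK x)|%:E <=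
   M%:E * (line_slice gam e phi 0%R + (eps * fine (\int[mu]_x (gam x)%:E))%R%:E) +
   eps%:E * \int[mu]_x `|vK x|%:E)%E.
Proof.
move=> eps0 h0 hr Hdq Hslice.
have tT : test_function setT phi by exact: test_function_sub tphi.
have bphi := bounded_test tT.
have bphih : @bounded_measurable _ L R (fun x : L => phi ((x : 'rV[R]_n) - h *: e)).
  by apply: bounded_test; exact: (test_function_shift (U := setT)).
have bdphi : @bounded_measurable _ L R (d j phi).
  have [_ [S [cS _ phiS]]] := (test_functionP _ _).1 tT.
  have clS : closed S by apply: compact_closed => //; exact: norm_hausdorff.
  exact: (compact_supp_bounded (smooth_continuous (smooth_partial j sphi)) cS (partial_support sphi clS phiS)).
pose psi x := -1 * phi (x - h *: e) + phi x.
have bpsi : @bounded_measurable _ L R psi by exact: (bounded_measurable_lin (-1) bphih bphi).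
pose err x := - h * d j phi x + psi x.
have berr : @bounded_measurable _ L R err by exact: (bounded_measurable_lin (- h) bdphi bpsi).
have err_le x : `|err x| <= h * eps.
  by have := Hdq x; congr (`|_| <= _); rewrite /err /psi; ring.
have L1_shift := bochner_integral_preserving mu_complete (measurable_rV_shift (h *: e))
  (fun A _ => lebesgue_rV_shift (h *: e) A).
pose D x := -1 *: vK ((x : 'rV[R]_n) + h *: e) + vK x.
have LD : bochner_L1 mu [set: L] D.
  exact: (bochner_L1_linear mu_complete (-1) (L1_shift _ _ Lv).1 Lv).
(* Summation by parts: a translation by [h *: e] in one of the two terms moves the difference from
   [phi] to [v]. *)
have psiE : BI (fun x => psi x *: vK x) = BI (fun x => phi x *: D x).
  rewrite (bochner_integral_scale_linear mu_complete (-1) bphih bphi Lv).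
  rewrite -(L1_shift _ _ (bochner_L1_scale mu_complete bphih Lv)).2.
  have -> : ((fun x => phi (x - h *: e) *: vK x) \o (fun x : 'rV[R]_n => x + h *: e)) =
      (fun x => phi x *: vK ((x : 'rV[R]_n) + h *: e)).
    by apply/funext => x /=; rewrite addrK.
  rewrite -(bochner_integral_linear mu_complete); [|exact: (bochner_L1_scale mu_complete bphi (L1_shift _ _ Lv).1)|exact: (bochner_L1_scale mu_complete bphi Lv)].
  congr bochner_integral; apply/funext => x; rewrite /D scalerDr.
  by rewrite !scaleN1r scalerN.
have hE : h *: BI (fun x => d j phi x *: vK x) = BI (fun x => phi x *: D x) - BI (fun x => err x *: vK x).
  rewrite (bochner_integral_scale_linear mu_complete (- h) bdphi bpsi Lv) -psiE.
  by rewrite scaleNr opprD opprK addrCA subrr addr0.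
have Ierr : (`|BI (fun x => err x *: vK x)|%:E <= (h * eps)%:E * \int[mu]_x `|vK x|%:E)%E.
  exact: (le_bochner_integral_bounded mu_complete berr Lv err_le).
have ID : (`|BI (fun x => (phi x : R) *: D x)|%:E <=
    M%:E * \int[lebesgue_measure]_(s in `[0%R, h[) line_slice gam e phi s)%E.
  rewrite -(integral_line_average e mgam gam0 h mphi).
  have mA := measurable_line_average e mgam gam0 h.
  have A0 := line_average_ge0 e gam0 h.
  have UK' x t : U x -> 0 <= t <= h -> K (x + t *: e).
    move=> Ux /andP[t0 th]; apply: UK => //; rewrite normrZ (ger0_norm t0).
    by apply: le_trans (le_trans th hr); rewrite ler_piMr//; exact: rV_norm_delta_le.
  have wid := weak_increment_dominated oOm cK KOm wp mgam gam0 ggam oU h0 UK'.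
  apply: (le_bochner_integral_scale_ereal mu_complete bphi LD M0 mA A0).
  apply: ae_imply wid => x H /phiU Ux; have {}H := H Ux.
  have h00 : (0:R) <= 0 <= r by rewrite lexx ltW.
  have hh : 0 <= h <= r by rewrite (ltW h0).
  have E (W : completeNormedModType R) (w : L -> W) : cut_off K w x = w x.
    by have := cut_offE w Ux h00; rewrite scale0r addr0.
  apply: le_trans (lee_wpmul2l _ H); rewrite ?lee_fin//.
  rewrite /D !E !cut_offE// scaleN1r addrC distrC.
  exact: uv.
rewrite -(@lee_pmul2l _ h%:E); [|by []|by rewrite lte_fin].
apply: (@le_trans _ _ (`|BI (fun x => phi x *: D x)|%:E + `|BI (fun x => err x *: vK x)|%:E)%E).
  by rewrite -EFinM -EFinD lee_fin -[X in X * _](gtr0_norm h0) -normrZ hE ler_normB.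
apply: (le_trans (leeD ID Ierr)).
have Il := line_slice_integral_le mgam gam0 (integral_gam_lty cK KOm wp mgam gam0 ggam) mphi (ltW eps0) (ltW h0) Hslice.
rewrite [X in (_ <= X)%E]ge0_muleDr; last 2 first.
- apply: mule_ge0; first by rewrite lee_fin.
  apply: adde_ge0; first exact: line_slice_ge0.
  rewrite lee_fin; apply: mulr_ge0; first exact: ltW.
  by apply: fine_ge0; apply: integral_ge0 => x _; rewrite lee_fin.
- apply: mule_ge0; first by rewrite lee_fin ltW.
  by apply: integral_ge0 => x _; rewrite lee_fin.
rewrite (EFinM h eps) -muleA; apply: leeD; last exact: lexx.
by rewrite muleCA; apply: lee_wpmul2l; [rewrite lee_fin|exact: Il].
Qed.

Lemma lipschitz_partial_le_compact :
  (`|BI (fun x => d j phi x *: vK x)|%:E <= M%:E * weighted_norm mu (gam : L -> R) phi)%E.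
Proof.
have Ig := integral_gam_lty cK KOm wp mgam gam0 ggam.
pose G := fine (\int[mu]_x (gam x)%:E); pose C := fine (\int[mu]_x `|vK x|%:E).
have G0 : 0 <= G by apply: fine_ge0; apply: integral_ge0 => x _; rewrite lee_fin.
have C0 : 0 <= C by apply: fine_ge0; apply: integral_ge0 => x _; rewrite lee_fin.
have CE : (\int[mu]_x `|vK x|%:E = C%:E)%E.
  rewrite fineK// ge0_fin_numE; first by case: Lv.
  by apply: integral_ge0 => x _; rewrite lee_fin.
have [_ [S [cS _ phiS]]] := (test_functionP _ _).1 tphi.
have r00 : line_slice gam e phi 0%R = weighted_norm mu (gam : L -> R) phi.
  by rewrite line_sliceE//; congr weighted_norm; apply/funext => x; rewrite scale0r subr0.
apply/lee_addgt0Pr => eta eta0.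
(* The errors of [lipschitz_step] total [eps * (M * G + C)], which is thus at most [eta]. *)
pose eps := eta / (M * G + C + 1).
have D0 : 0 < M * G + C + 1 by rewrite ltr_wpDl// addr_ge0// mulr_ge0.
have eps0 : 0 < eps by rewrite divr_gt0.
have [del1 del10 Hdel1] := uniform_difference_quotient j sphi cS phiS eps0.
have [del2 del20 Hdel2] := line_slice_unif mgam gam0 (rV_norm_delta_le j) (smooth_continuous sphi) cS phiS eps0.
(* Halving keeps [h] strictly below the margin and both radii of uniformity. *)
pose h := Num.min r (Num.min del1 del2) / 2.
have h0 : 0 < h by rewrite divr_gt0// !lt_min r0 del10.
have hlt : h < Num.min r (Num.min del1 del2) by rewrite /h ltr_pdivrMr// ltr_pMr ?ltr1n// !lt_min r0 del10.
move: hlt; rewrite !lt_min => /and3P[hr h1 h2].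
have := lipschitz_step eps0 h0 (ltW hr) _ _; rewrite r00 => H.
apply: le_trans (H _ _) _.
- move=> x; have := Hdel1 (x - h *: e) h h _ h1; rewrite lexx (ltW h0) => /(_ isT).
  by rewrite subrK.
- by move=> s /andP[s0 sh]; rewrite -r00; apply: Hdel2; rewrite sub0r normrN ger0_norm//; lra.
rewrite CE ge0_muleDr; last 2 first.
- by apply: integral_ge0 => x _; rewrite lee_fin mulr_ge0.
- by rewrite lee_fin; apply: mulr_ge0 => //; exact: ltW.
rewrite -addeA -/G; apply: leeD; first exact: lexx.
rewrite -!EFinM -EFinD lee_fin.
have -> : M * (eps * G) + eps * C = eps * (M * G + C) by ring.
by rewrite /eps -mulrA ger_pMr// ler_pdivrMl// mulr1 lerDl.
Qed.

End compact_support.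
(** [K] and the Borel weight [gam] depend on [phi], but on the support of [phi] the weight is the
    norm of [g] almost everywhere. The resulting bound has one weight for all test functions, as the
    extension of the functional requires. *)
Lemma lipschitz_partial_le phi : test_function Om phi ->
  (`|bochner_integral mu (Om : set L) (fun x => d j phi x *: v x)|%:E <=
   M%:E * weighted_norm mu (fun x : L => `|\1_(Om : set L) x *: g x|%R) phi)%E.
Proof.
move=> tphi; have [sphi [S [cS SOm phiS]]] := (test_functionP _ _).1 tphi.
have [K [U [r [cK KOm oU SU [r0 UK]]]]] := compact_margin oOm cS SOm.
have Lg : bochner_L1 mu [set: L] (cut_off K g) by apply: (bochner_L1_cut_off cK KOm); case: wp.
have [sg _] := Lg.
have [gam [mgam gam0 ggam]] := borel_representative (strongly_measurable_norm mu_complete sg)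
  (fun x => normr_ge0 _).
have tU : test_function U phi by apply/test_functionP; split => //; exists S.
have SK x : S x -> K x.
  move=> /SU Ux; have := UK x 0 Ux; rewrite normr0 addr0; apply; exact: ltW.
have := lipschitz_partial_le_compact cK KOm oU r0 UK mgam gam0 ggam tU.
have phiK x : phi x != 0 -> K x by move=> /phiS/SK.
rewrite (bochner_integral_cut_off KOm _ oOm (partial_compact_support cK sphi phiK)).
have mOm : measurable (Om : set L) by apply: borel_lebesgue_measurable; exact: open_borel.
have sOm : strongly_measurable mu [set: L] (fun x => \1_(Om : set L) x *: g x).
  by apply: strongly_measurable_indic => //; case: wp => _ [].
have mk := strongly_measurable_norm mu_complete sOm.
rewrite (ae_weighted_norm (borel_fun_lebesgue mgam) mk (test_function_measurable tphi) gam0 (fun=> normr_ge0 _))//.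
apply: ae_imply ggam => x -> /phiK Kx; congr (`|_|).
by rewrite /cut_off !indicE !mem_set//; exact: KOm.
Qed.

End lipschitz_partial.

(** * Functionals on weighted L^1 *)

Section extension.
Context d (T : measurableType d) (R : realType) (mu : {measure set T -> \bar R}).
Variables (Z : completeNormedModType R) (k : T -> R) (tst : (T -> R) -> Prop) (Lam : (T -> R) -> Z) (M : R).
Hypotheses (mk : measurable_fun [set: T] k) (k0 : forall x, 0 <= k x) (M0 : 0 <= M).
Local Notation N := (weighted_norm mu k).
Local Notation mfun F := (measurable_fun [set: T] (F : T -> R)).
Hypothesis tst_measurable : forall psi, tst psi -> mfun psi.
Hypothesis tst_lin : forall a phi psi, tst phi -> tst psi -> tst (fun x => a * phi x + psi x).
Hypothesis tst_dense : forall F, mfun F -> (N F < +oo)%E -> approximable mu k tst F.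
Hypothesis Lam_lin : forall a phi psi, tst phi -> tst psi ->
  Lam (fun x => a * phi x + psi x) = a *: Lam phi + Lam psi.
Hypothesis Lam_le : forall phi, tst phi -> (`|Lam phi|%:E <= M%:E * N phi)%E.

Let NB F G : mfun F -> mfun G -> (N (fun x => F x - G x)%R <= N F + N G)%E.
Proof.
move=> mF mG.
have mG' : mfun (fun x => -1 * G x) by exact: measurable_funM.
apply: le_trans (_ : (N (fun x => F x + -1 * G x)%R <= _)%E).
  by rewrite le_eqVlt; apply/orP; left; apply/eqP; congr weighted_norm; apply/funext => x; rewrite mulN1r.
apply: le_trans (weighted_normD mu mk k0 mF mG') _.
by rewrite (weighted_normZ mu mk k0)// normrN1 mul1e.
Qed.

Let N_dist F G H : mfun F -> mfun G -> mfun H ->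
  (N (fun x => F x - H x)%R <= N (fun x => F x - G x)%R + N (fun x => H x - G x)%R)%E.
Proof.
move=> mF mG mH.
rewrite (_ : (fun x => F x - H x) = (fun x => (F x - G x) - (H x - G x))); last first.
  by apply/funext => x; rewrite opprB addrA subrK.
by apply: NB; exact: measurable_funB.
Qed.

Let N_lin a F G : mfun F -> mfun G -> (N (fun x => a * F x + G x)%R <= `|a|%:E * N F + N G)%E.
Proof.
move=> mF mG; have maF : mfun (fun x => a * F x) by exact: measurable_funM.
by apply: le_trans (weighted_normD mu mk k0 maF mG) _; rewrite (weighted_normZ mu mk k0).
Qed.

(** The closure of the graph of [Lam], for the weighted norm in the first variable. As a relation it
    needs no choice of an approximating sequence, and linearity and the bound pass to it
    directly. *)
Definition extends_to (F : T -> R) (z : Z) := forall e : R, 0 < e ->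
  exists psi, [/\ tst psi, (N (fun x => F x - psi x)%R < e%:E)%E & `|Lam psi - z| < e].

Let Lam_dist phi psi (e : R) : tst phi -> tst psi ->
  (N (fun x => phi x - psi x)%R <= e%:E)%E -> `|Lam phi - Lam psi| <= M * e.
Proof.
move=> tp ts pe.
have -> : Lam phi - Lam psi = Lam (fun x => -1 * psi x + phi x).
  by rewrite Lam_lin// scaleN1r addrC.
rewrite -lee_fin; apply: le_trans (Lam_le _) _; first exact: tst_lin.
rewrite EFinM lee_wpmul2l//.
by move: pe; congr (_ <= _)%E; congr weighted_norm; apply/funext => x; rewrite mulN1r addrC.
Qed.

Lemma extension_exists F : mfun F -> (N F < +oo)%E -> exists z, extends_to F z.
Proof.
move=> mF Foo.
have /choice[psi Hpsi] (m : nat) : exists psi, tst psi /\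
    (N (fun x => F x - psi x)%R < (m.+1%:R^-1)%:E)%E.
  by have [|psi tp pe] := tst_dense mF Foo (e := m.+1%:R^-1); [rewrite invr_gt0|exists psi].
have small (e : R) : 0 < e -> \forall m \near \oo, m.+1%:R^-1 < e.
  by move=> e0; exact: (near_infty_natSinv_lt (PosNum e0)).
have M1 : 0 < M + 1 by rewrite ltr_wpDl.
have : cvg (Lam (psi m) @[m --> \oo]).
  apply: cauchy_seq_cvg => e e0.
  have e1 : 0 < e / (2 * (M + 1)) by rewrite divr_gt0// mulr_gt0.
  have [K _ HK] := small _ e1; exists K => i j Ki Kj.
  have [[ti Fi] [tj Fj]] := (Hpsi i, Hpsi j).
  have H : (N (fun x => psi i x - psi j x)%R <= (e / (M + 1))%:E)%E.
    apply: (@le_trans _ _ ((e / (2 * (M + 1)))%:E + (e / (2 * (M + 1)))%:E)%E); last first.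
      rewrite -EFinD lee_fin le_eqVlt; apply/orP; left; apply/eqP; field; rewrite gt_eqF//.
    have N_sym G H : N (fun x => G x - H x)%R = N (fun x => H x - G x)%R.
      by apply: eq_integral => x _; rewrite distrC.
    apply: le_trans (N_dist (tst_measurable ti) mF (tst_measurable tj)) _.
    rewrite N_sym (N_sym (psi j)); apply: leeD; apply: ltW.
      by apply: lt_trans Fi _; rewrite lte_fin; exact: HK.
    by apply: lt_trans Fj _; rewrite lte_fin; exact: HK.
  apply: le_lt_trans (Lam_dist ti tj H) _.
  by rewrite mulrCA gtr_pMr// ltr_pdivrMr// mul1r ltrDl.
move=> /cvg_ex[z zc]; exists z => e e0.
have [m [me mz]] : exists m, m.+1%:R^-1 < e /\ `|Lam (psi m) - z| < e.
  have zn : \forall m \near \oo, `|Lam (psi m) - z| < e.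
    by have /cvgrPdist_lt/(_ e e0) := zc; apply: filterS => m; rewrite distrC.
  by have [m] := filter_ex (filterI (small _ e0) zn); exists m.
have [tm Fm] := Hpsi m; exists (psi m); split => //.
by apply: lt_trans Fm _; rewrite lte_fin.
Qed.

Lemma extension_linear a F G z y : mfun F -> mfun G ->
  extends_to F z -> extends_to G y -> extends_to (fun x => a * F x + G x) (a *: z + y).
Proof.
move=> mF mG Fz Gy e e0.
have e1 : 0 < e / (`|a| + 2) by rewrite divr_gt0// ltr_wpDl.
have eE : `|a| * (e / (`|a| + 2)) + e / (`|a| + 2) < e.
  rewrite -[X in _ + X]mul1r -mulrDl mulrCA gtr_pMr// ltr_pdivrMr ?ltr_wpDl// mul1r ltrD2l.
  by rewrite ltr1n.
have [[phi [tp Fp zp]] [psi [ts Gs ys]]] := (Fz _ e1, Gy _ e1).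
exists (fun x => a * phi x + psi x); split; first exact: tst_lin.
  have -> : (fun x => a * F x + G x - (a * phi x + psi x)) =
      (fun x => a * (F x - phi x) + (G x - psi x)).
    by apply/funext => x; ring.
  apply: le_lt_trans (N_lin a _ _) _.
  - by apply: measurable_funB => //; exact: tst_measurable.
  - by apply: measurable_funB => //; exact: tst_measurable.
  apply: (@le_lt_trans _ _ (`|a| * (e / (`|a| + 2)) + e / (`|a| + 2))%R%:E); last by rewrite lte_fin.
  by rewrite EFinD EFinM; apply: leeD; [apply: lee_wpmul2l => //|]; exact: ltW.
rewrite Lam_lin// opprD addrACA -scalerBr; apply: le_lt_trans (ler_normD _ _) _.
by apply: le_lt_trans eE; rewrite normrZ lerD// ?ler_wpM2l//; exact: ltW.
Qed.

Lemma extension_le F z : mfun F -> extends_to F z -> (`|z|%:E <= M%:E * N F)%E.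
Proof.
move=> mF Fz; apply/lee_addgt0Pr => e e0.
have e1 : 0 < e / (M + 1) by rewrite divr_gt0// ltr_wpDl.
have [phi [tp Fp zp]] := Fz _ e1; have mp := tst_measurable tp.
apply: (@le_trans _ _ (`|Lam phi|%:E + (e / (M + 1))%:E)%E).
  rewrite -EFinD lee_fin; have := ler_normB (Lam phi) (Lam phi - z).
  by rewrite opprB addrCA subrr addr0 => H; apply: le_trans H _; rewrite lerD2l ltW.
have H : (N phi <= N F + (e / (M + 1))%:E)%E.
  have mF' := measurable_funB mF mp.
  apply: le_trans (_ : (N (fun x => F x - (F x - phi x))%R <= _)%E).
    rewrite le_eqVlt; apply/orP; left; apply/eqP; congr weighted_norm.
    by apply/funext => x; rewrite opprB addrC subrK.
  by apply: le_trans (NB mF mF') _; apply: leeD => //; exact: ltW.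
apply: (le_trans (leeD (le_trans (Lam_le tp) (lee_wpmul2l _ H)) (lexx _))); first by rewrite lee_fin.
have N0 : (0 <= N F)%E by apply: integral_ge0 => x _; rewrite lee_fin mulr_ge0.
rewrite ge0_muleDr//; last by rewrite lee_fin ltW.
rewrite -addeA; apply: leeD; first exact: lexx.
rewrite -EFinM -EFinD lee_fin.
by rewrite -[X in _ + X]mul1r -mulrDl mulrCA mulfV ?mulr1// gt_eqF// ltr_wpDl.
Qed.

(** By linearity [y - z] is a value at [F - F], whose weighted norm is 0, and [extension_le] makes
    it vanish. *)
Lemma extension_unique F z y : mfun F -> extends_to F z -> extends_to F y -> z = y.
Proof.
move=> mF Fz Fy; have mZ : mfun (fun x => -1 * F x + F x).
  by apply: measurable_funD => //; exact: measurable_funM.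
have := extension_le mZ (extension_linear (-1) mF mF Fz Fy).
have -> : N (fun x => -1 * F x + F x) = 0%E.
  by apply: integral0_eq => x _; rewrite mulN1r addNr normr0 mul0r.
rewrite mule0 lee_fin normr_le0 scaleN1r addrC subr_eq0 => /eqP ->.
by [].
Qed.

Lemma extension_test phi : tst phi -> extends_to phi (Lam phi).
Proof.
move=> tp e e0; exists phi; split => //; last by rewrite subrr normr0.
rewrite [X in (X < _)%E](_ : _ = 0%E) ?lte_fin//.
by apply: integral0_eq => x _; rewrite subrr normr0 mul0r.
Qed.

(* Junk value [0] when [F] has infinite weighted norm. *)
Definition extension F : Z := xget 0 [set z | extends_to F z].

Lemma extensionP F : mfun F -> (N F < +oo)%E -> extends_to F (extension F).
Proof.
move=> mF Foo; have [z Fz] := extension_exists mF Foo.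
by rewrite /extension; case: xgetP => [y -> //|/(_ z)].
Qed.

Lemma extensionE F z : mfun F -> extends_to F z -> extension F = z.
Proof.
move=> mF Fz; rewrite /extension; case: xgetP => [y -> Fy|/(_ z)//].
exact: extension_unique Fy Fz.
Qed.

Lemma extension_lin a F G : mfun F -> mfun G -> (N F < +oo)%E -> (N G < +oo)%E ->
  extension (fun x => a * F x + G x) = a *: extension F + extension G.
Proof.
move=> mF mG Foo Goo; apply: extensionE.
  by apply: measurable_funD => //; exact: measurable_funM.
by apply: extension_linear => //; exact: extensionP.
Qed.

Lemma norm_extension_le F : mfun F -> (N F < +oo)%E -> (`|extension F|%:E <= M%:E * N F)%E.
Proof. by move=> mF Foo; apply: extension_le => //; exact: extensionP. Qed.

End extension.

(** A diagonal choice: the [m]-th simple function uses the [m]-th approximations on the first [m]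
    pieces. Each point lies in at most one piece, and that piece is eventually included. *)
Lemma strongly_measurable_patch d (T : measurableType d) (R : realType)
    (mu : {measure set T -> \bar R}) (V : completeNormedModType R) (D : nat -> set T) (f : nat -> T -> V) :
  (forall i, measurable (D i)) -> trivIset setT D -> (forall i, strongly_measurable mu setT (f i)) ->
  exists w, [/\ strongly_measurable mu setT w, forall i x, D i x -> w x = f i x &
    forall x, (forall i, ~ D i x) -> w x = 0].
Proof.
move=> mD tD /choice[s Hs].
have /choice[w wE] (x : T) : exists y : V, (forall i, D i x -> y = f i x) /\
    ((forall i, ~ D i x) -> y = 0).
  case: (pselect (exists i, D i x)) => [[i Dix]|Dx]; last by exists 0; split => // i Di; case: Dx; exists i.
  exists (f i x); split => [l Dlx|/(_ i)//].
  by congr f; apply: (tD i l I I); exists x.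
exists w; split; [|by move=> i x; exact: (wE x).1|by move=> x; exact: (wE x).2].
exists (fun m x => \sum_(i < m) (\1_(D i) x : R) *: s i m x); split.
  move=> m.
  have H l : simple_fun (fun x => \sum_(i < l) (\1_(D i) x : R) *: s i m x).
    elim: l => [|l IH].
      have := simple_fun_scale_indic measurable0 ((Hs 0%N).1 0%N).
      by congr simple_fun; apply/funext => x; rewrite big_ord0 indic0 scale0r.
    have := simple_fun_comp2 +%R IH (simple_fun_scale_indic (mD l) ((Hs l).1 m)).
    by congr simple_fun; apply/funext => x; rewrite big_ord_recr.
  exact: H.
have : {ae mu, forall x, forall i, s i ^~ x @ \oo --> f i x}.
  by apply: ae_foralln => i; apply: ae_imply (Hs i).2 => x; apply.
apply: ae_imply => x sx _.
case: (pselect (exists i, D i x)) => [[i Dix]|Dx].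
  rewrite ((wE x).1 i Dix); apply: cvg_trans (sx i).
  apply: near_eq_cvg; near=> m.
  have im : (i < m)%N by near: m; exact: nbhs_infty_gt.
  rewrite (bigD1 (Ordinal im))//= big1 ?addr0; first by rewrite indicE mem_set ?scale1r.
  move=> l li; rewrite indicE memNset ?scale0r// => Dl; move/eqP: li; apply.
  by apply: val_inj => /=; apply: (tD l i I I); exists x.
rewrite (wE x).2; last by move=> i Di; apply: Dx; exists i.
apply: cvg_near_cst; apply: nearW => m; rewrite big1// => i _.
by rewrite indicE memNset ?scale0r// => Di; apply: Dx; exists (nat_of_ord i).
Unshelve. all: by end_near. Qed.

Section density_representation.
Context d (T : measurableType d) (R : realType) (mu : {measure set T -> \bar R}).
Variables (Z : completeNormedModType R) (k : T -> R) (E : (T -> R) -> Z) (M : R).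
Hypotheses (mu_complete : measure_is_complete mu) (mu_sf : sigma_finite setT mu).
Hypothesis rnp : radon_nikodym_property Z.
Hypotheses (mk : measurable_fun [set: T] k) (k0 : forall x, 0 <= k x) (M0 : 0 <= M).
Local Notation N := (weighted_norm mu k).
Local Notation mfun F := (measurable_fun [set: T] (F : T -> R)).
Hypothesis E_lin : forall a F G, mfun F -> mfun G -> (N F < +oo)%E -> (N G < +oo)%E ->
  E (fun x => a * F x + G x) = a *: E F + E G.
Hypothesis E_le : forall F, mfun F -> (N F < +oo)%E -> (`|E F|%:E <= M%:E * N F)%E.

Section piece.
Variable D : set T.
Hypotheses (mD : measurable D) (Doo : (N \1_D < +oo)%E).
Let nu (A : set T) : Z := E \1_(A `&` D).

Let mAD A : measurable A -> mfun \1_(A `&` D).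
Proof. by move=> mA; apply: measurable_indic; exact: measurableI. Qed.

Let N_lty A : measurable A -> (N \1_(A `&` D) < +oo)%E.
Proof.
move=> mA; apply: le_lt_trans Doo; apply: le_weighted_norm => //.
- exact: mAD.
- by move=> x _; rewrite !indicE in_setI; case: (x \in A) => //=; rewrite normr0.
Qed.

(** Finite additivity is the linearity of [E]. Countable additivity comes from the bound on [E]: the
    indicators of the remainders tend to 0 in the weighted norm, because [D] has finite weight. *)
Let nu_vector_measure : vector_measure nu.
Proof.
move=> F mF tF.
pose U m := \big[setU/set0]_(i < m) F i.
have mU m : measurable (U m) by apply: bigsetU_measurable.
have mUF : measurable (\bigcup_i F i) by exact: bigcup_measurable.
have sumE m : \sum_(i < m) nu (F i) = nu (U m).
  elim: m => [|m IH].
    have := E_lin (-1) (mAD measurable0) (mAD measurable0) (N_lty measurable0) (N_lty measurable0).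
    rewrite scaleN1r addNr big_ord0 /nu /U big_ord0 => <-; congr E.
    by apply/funext => x; rewrite set0I indic0 mulr0 addr0.
  rewrite big_ord_recr/= IH.
  have := E_lin 1 (mAD (mU m)) (mAD (mF m)) (N_lty (mU m)) (N_lty (mF m)).
  rewrite scale1r -/(nu _) -/(nu _) => <-; congr E; apply/funext => x; rewrite mul1r.
  have /disj_setPS UF : [disjoint U m & F m].
    by apply/disj_setPS => y; rewrite /U -bigcup_mkord => -[[i /= im Fi] Fm];
      have := tF i m I I (ex_intro _ y (conj Fi Fm)) => im'; move: im; rewrite im' ltnn.
  rewrite /U big_ord_recr/= -/(U m) !indicE !in_setI in_setU.
  case: (boolP (x \in D)) => xD; rewrite ?andbF ?addr0// !andbT.
  case: (boolP (x \in U m)) => xU; case: (boolP (x \in F m)) => xF //=; rewrite ?addr0 ?add0r//.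
  by have := UF x (conj (set_mem xU) (set_mem xF)).
apply/cvgrPdist_lt => e e0.
have cv : N (fun x => \1_(\bigcup_i F i `&` D) x - \1_(U m `&` D) x) @[m --> \oo] --> 0%E.
  apply: weighted_dominated => //; [by move=> m; exact: mAD|exact: mAD|exact: N_lty| |].
    move=> m x _; rewrite !indicE !in_setI; case: (x \in D); rewrite ?andbF ?subr0// !andbT.
    case: (boolP (x \in U m)) => xU; rewrite ?subr0//.
    rewrite mem_set ?subrr ?normr0//.
    by move: xU; rewrite inE /U -bigcup_mkord => -[i _ Fi]; exists i.
  move=> x _; case: (pselect (exists i, F i x)) => [[i Fix]|Fx].
    apply: cvg_near_cst; near=> m.
    have xU : U m x.
      by rewrite /U -bigcup_mkord; exists i => //=; near: m; exact: nbhs_infty_gt.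
    have xF : (\bigcup_i F i) x by exists i.
    by rewrite !indicE !in_setI (mem_set xU) (mem_set xF).
  apply: cvg_near_cst; apply: nearW => m.
  rewrite !indicE !in_setI [x \in U m]memNset ?[x \in \bigcup_i _]memNset//.
    by move=> [i _ Fi]; apply: Fx; exists i.
  by rewrite /U -bigcup_mkord => -[i _ Fi]; apply: Fx; exists i.
have M1 : 0 < M + 1 by rewrite ltr_wpDl.
have e1 : 0 < e / (M + 1) by rewrite divr_gt0.
have := cvge0_lt cv e1; apply: filterS => m Hm; rewrite sumE.
have mdiff := measurable_funB (mAD mUF) (mAD (mU m)).
have -> : nu (\bigcup_i F i) - nu (U m) =
    E (fun x => \1_(\bigcup_i F i `&` D) x - \1_(U m `&` D) x).
  have := E_lin (-1) (mAD (mU m)) (mAD mUF) (N_lty (mU m)) (N_lty mUF).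
  rewrite scaleN1r addrC /nu => <-; congr E; apply/funext => x; ring.
rewrite -lte_fin; apply: le_lt_trans (E_le mdiff _) _.
  by apply: lt_trans Hm _; rewrite ltry.
apply: (@le_lt_trans _ _ (M%:E * (e / (M + 1))%:E)%E).
  by apply: lee_wpmul2l; [rewrite lee_fin|exact: ltW].
by rewrite -EFinM lte_fin mulrCA gtr_pMr// ltr_pdivrMr// mul1r ltrDl.
Unshelve. all: by end_near. Qed.

Let nu_le A : measurable A -> (`|nu A|%:E <= M%:E * N \1_(A `&` D))%E.
Proof. by move=> mA; apply: E_le; [exact: mAD|exact: N_lty]. Qed.

(** Disjointness makes the weighted norms of the pieces sum to at most that of the indicator of
    [D]. *)
Let nu_bounded_variation : bounded_variation_measure nu.
Proof.
apply: (@le_lt_trans _ _ (M%:E * N \1_D)%E); last by rewrite lte_mul_pinfty.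
apply: ub_ereal_sup => _ [m [F [mF tF _ ->]]].
apply: (@le_trans _ _ (\sum_(i < m) M%:E * N \1_(F i `&` D))%E).
  by rewrite -sumEFin; apply: lee_sum => i _; exact: nu_le.
rewrite -ge0_sume_distrr; last first.
  by move=> i _; apply: integral_ge0 => x _; rewrite lee_fin mulr_ge0.
apply: lee_wpmul2l; first by rewrite lee_fin.
rewrite -ge0_integral_sum//; last 2 first.
- by move=> i; apply: measurable_weighted => //; exact: mAD.
- by move=> i x _; rewrite lee_fin mulr_ge0.
apply: ge0_le_integral => //.
- by move=> x _; apply: sume_ge0 => i _; rewrite lee_fin mulr_ge0.
- by apply: emeasurable_sum => i; apply: measurable_weighted => //; exact: mAD.
- by apply: measurable_weighted => //; exact: measurable_indic.
- move=> x _; rewrite sumEFin lee_fin -mulr_suml ler_wpM2r//.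
  case: (pselect (exists i, F i x)) => [[i Fix]|Fx]; last first.
    rewrite big1// => i _; rewrite indicE in_setI memNset ?normr0//.
    by move=> Fi; apply: Fx; exists i.
  rewrite (bigD1 i)//= big1 ?addr0.
    by rewrite !indicE in_setI; case: (x \in F i) => //=; rewrite normr0.
  move=> l li; rewrite indicE in_setI memNset ?normr0// => Fl.
  by move/eqP: li; apply; apply: tF => //; exists x.
Qed.

Let nu_abs_continuous : vector_abs_continuous nu mu.
Proof.
move=> A mA A0; apply/eqP; rewrite -normr_le0 -lee_fin; apply: le_trans (nu_le mA) _.
rewrite (_ : N \1_(A `&` D) = 0%E) ?mule0// /weighted_norm.
rewrite (@ge0_ae_eq_integral _ _ _ mu setT _ (cst 0%E)) ?integral0//.
- by apply: measurable_weighted => //; exact: mAD.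
- by move=> x _; rewrite lee_fin mulr_ge0.
- exists A; split => // x xA; apply: contrapT => Ax; apply: xA => _.
  by rewrite indicE in_setI memNset// normr0 mul0r.
Qed.

(** The bound on [E] over indicators is the hypothesis of [bochner_integral_dominated] with [M * k]
    cut to [D]. Keeping the indicator of [D] in the bound forces [f] to vanish almost everywhere off
    [D], which the patching needs. *)
Lemma extension_density : exists f : T -> Z, [/\ bochner_L1 mu setT f,
  forall A, measurable A -> E \1_(A `&` D) = bochner_integral mu setT (fun x => \1_A x *: f x) &
  {ae mu, forall x, `|f x| <= M * k x * \1_D x}].
Proof.
have [f [Lf fE]] := rnp mu_sf mu_complete nu_vector_measure nu_bounded_variation nu_abs_continuous.
have fE' A : measurable A -> E \1_(A `&` D) = bochner_integral mu setT (fun x => \1_A x *: f x).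
  by move=> mA; rewrite -(bochner_integral_restrict mu_complete)// -fE.
exists f; split => //.
have mkap : mfun (fun x => M * k x * \1_D x).
  by apply: measurable_funM; [exact: measurable_funM|exact: measurable_indic].
have kap0 x : 0 <= M * k x * \1_D x by rewrite !mulr_ge0// indicE.
have := bochner_integral_dominated mu_complete Lf mkap.
have H A : measurable A ->
    (`|bochner_integral mu setT (fun x => \1_A x *: f x)|%:E <= \int[mu]_(x in A) `|M * k x * \1_D x|%:E)%E.
  move=> mA; rewrite -fE'//; apply: le_trans (nu_le mA) _.
  have mw : measurable_fun setT (fun x => (`|\1_(A `&` D) x| * k x)%:E).
    by apply: measurable_weighted => //; exact: mAD.
  rewrite /weighted_norm -ge0_integralZl//; last by move=> x _; rewrite lee_fin mulr_ge0.
  rewrite [leRHS]integral_mkcond le_eqVlt; apply/orP; left; apply/eqP; apply: eq_integral => x _.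
  rewrite patchE -EFinM !indicE in_setI; case: (x \in A) => /=; last by rewrite normr0 mul0r mulr0.
  by rewrite [in RHS]ger0_norm ?mulr_ge0// [in LHS]ger0_norm// mulrA mulrAC.
by move=> /(_ H); apply: ae_imply => x; rewrite (ger0_norm (kap0 x)).
Qed.

End piece.
Lemma weighted_L1_scale (w : T -> Z) (F : T -> R) : strongly_measurable mu setT w ->
  {ae mu, forall x, `|w x| <= M * k x} -> mfun F -> (N F < +oo)%E ->
  bochner_L1 mu setT (fun x => F x *: w x) /\
  (`|bochner_integral mu setT (fun x => F x *: w x)|%:E <= M%:E * N F)%E.
Proof.
move=> sw wk mF Foo.
have sFw : strongly_measurable mu setT (fun x => F x *: w x).
  by apply: strongly_measurableZ => //; exact: measurable_strongly_measurable.
have I : (\int[mu]_x `|F x *: w x|%:E <= M%:E * N F)%E.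
  rewrite /weighted_norm -ge0_integralZl//; last 2 first.
  - exact: measurable_weighted.
  - by move=> x _; rewrite lee_fin mulr_ge0.
  apply: ae_ge0_le_integral => //.
  - exact: (strongly_measurable_enorm mu_complete).
  - by move=> x _; rewrite -EFinM lee_fin !mulr_ge0.
  - by apply: measurable_funeM; exact: measurable_weighted.
  - apply: ae_imply wk => x wx _; rewrite -EFinM lee_fin normrZ mulrCA.
    by rewrite ler_wpM2l.
have L : bochner_L1 mu setT (fun x => F x *: w x).
  by split => //; apply: le_lt_trans I _; rewrite lte_mul_pinfty.
by split => //; apply: le_trans (le_bochner_integral_norm mu_complete L) I.
Qed.

(** The sets are made disjoint by [seqDU] so that the densities on them can be patched. The
    functional and the integral against [w] then agree on indicators inside each piece, and both are
    linear and bounded by [M] times the weighted norm, so they agree everywhere. *)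
Lemma density_representation (B : nat -> set T) : (forall i, measurable (B i)) ->
  (forall x, k x != 0 -> exists i, B i x) -> (forall i, (N \1_(B i) < +oo)%E) ->
  exists w : T -> Z, [/\ strongly_measurable mu setT w, {ae mu, forall x, `|w x| <= M * k x} &
    forall F, mfun F -> (N F < +oo)%E -> E F = bochner_integral mu setT (fun x => F x *: w x)].
Proof.
move=> mB Bk Boo; pose D := seqDU B.
have mD i : measurable (D i) by exact: (seqDU_measurable mB).
have Doo i : (N \1_(D i) < +oo)%E.
  apply: le_lt_trans (Boo i); apply: le_weighted_norm => //.
  move=> x _; rewrite !indicE; case: (boolP (x \in D i)) => xD; last by rewrite normr0.
  by rewrite mem_set//; have [] := set_mem xD.
have /choice[f Hf] i := extension_density (mD i) (Doo i).
have sf i : strongly_measurable mu setT (f i) by case: (Hf i) => -[].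
have [w [sw wf w0]] := strongly_measurable_patch mD (trivIset_seqDU B) sf.
have fk : {ae mu, forall x, forall i, `|f i x| <= M * k x * \1_(D i) x}.
  by apply: ae_foralln => i; case: (Hf i).
have wk : {ae mu, forall x, `|w x| <= M * k x}.
  apply: ae_imply fk => x fx; case: (pselect (exists i, D i x)) => [[i Dix]|Dx].
    by rewrite (wf i)//; have := fx i; rewrite indicE mem_set// mulr1.
  rewrite w0 ?normr0 ?mulr_ge0// => i Di; by apply: Dx; exists i.
exists w; split => //.
pose BIw F := bochner_integral mu setT (fun x => (F x : R) *: w x).
have BIw_lin a F G : mfun F -> mfun G -> (N F < +oo)%E -> (N G < +oo)%E ->
    BIw (fun x => a * F x + G x) = a *: BIw F + BIw G.
  move=> mF mG Foo Goo; have [LF _] := weighted_L1_scale sw wk mF Foo.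
  have [LG _] := weighted_L1_scale sw wk mG Goo.
  rewrite /BIw -(bochner_integral_linear mu_complete a LF LG); congr bochner_integral.
  by apply/funext => x; rewrite scalerDl scalerA.
apply: (weighted_induction mk k0 (P := fun F => E F = BIw F) _ _ mD _ Doo).
- by move=> a F G mF mG Foo Goo EF EG; rewrite (E_lin a mF mG Foo Goo) (BIw_lin a F G mF mG Foo Goo) EF EG.
- move=> F mF Foo HF; apply/eqP; rewrite -subr_eq0 -normr_le0; apply/ler_addgt0Pr => e e0.
  (* The difference of the two functionals is bounded by [2 * M] times the weighted norm; adding 1
     keeps the divisor positive. *)
  have M1 : 0 < 2 * M + 1 by rewrite ltr_wpDl// mulr_ge0.
  have [G [mG Goo EG FG]] := HF (e / (2 * M + 1)) (divr_gt0 e0 M1).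
  rewrite add0r.
  pose H x := -1 * G x + F x.
  have mH : mfun H by apply: measurable_funD => //; exact: measurable_funM.
  have HE : N H = N (fun x => F x - G x)%R.
    by congr weighted_norm; apply/funext => x; rewrite /H mulN1r addrC.
  have Hoo : (N H < +oo)%E by rewrite HE; apply: lt_trans FG _; rewrite ltry.
  have -> : E F - BIw F = E H - BIw H.
    by rewrite /H (E_lin (-1) mG mF Goo Foo) (BIw_lin (-1) G F mG mF Goo Foo) EG opprD addrACA subrr add0r.
  rewrite -lee_fin; apply: (@le_trans _ _ (M%:E * N H + M%:E * N H)%E).
    apply: (@le_trans _ _ (`|E H|%:E + `|BIw H|%:E)%E).
      by rewrite -EFinD lee_fin ler_normB.
    by apply: leeD; [exact: E_le|exact: (weighted_L1_scale sw wk mH Hoo).2].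
  have HN : (M%:E * N H <= M%:E * (e / (2 * M + 1))%:E)%E.
    by apply: lee_wpmul2l; [rewrite lee_fin|rewrite HE; exact: ltW].
  apply: le_trans (leeD HN HN) _; rewrite -EFinM -EFinD lee_fin.
  have -> : M * (e / (2 * M + 1)) + M * (e / (2 * M + 1)) = (2 * M) / (2 * M + 1) * e by ring.
  by rewrite ger_pMl// ler_pdivrMr// mul1r lerDl; exact: ler01.
- move=> x /Bk[i Bi]; have : (\bigcup_i D i) x by rewrite -seqDU_bigcup_eq; exists i.
  by move=> [l _ Dl]; exists l.
- move=> A i mA; have [Lf fE fi] := Hf i; rewrite (fE A mA).
  (* Off [D i] the density [f i] vanishes almost everywhere, and on [D i] it is [w]; so [f i] on [A]
     and [w] on the intersection with [D i] have the same integral. *)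
  have := ae_bochner_integral mu_complete (w := fun x => \1_(A `&` D i) x *: w x) _
    (bochner_L1_indic mu_complete mA Lf).
  move=> -[|_ ->//]; apply: ae_imply fi => x; rewrite !indicE in_setI.
  case: (boolP (x \in D i)) => xD; first by rewrite andbT (wf i)//; exact: set_mem.
  by rewrite mulr0 andbF normr_le0 => /eqP ->; rewrite scaler0 scale0r.
Qed.

End density_representation.

(** * Weak derivatives of Lipschitz compositions *)

Section lipschitz_weak_derivative.
Context {R : realType} {n : nat} (V Z : completeNormedModType R).
Local Notation L := (rV_lebesgue R n).
Local Notation mu := (@lebesgue_rV R n).
Local Notation d j f := (@partial R n R^o j f).
Local Notation mu_complete := (@lebesgue_rV_complete R n).

Lemma partial_lin j (a : R) (phi psi : 'rV[R]_n -> R) x : smooth phi -> smooth psi ->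
  d j (fun x => a * phi x + psi x) x = a * d j phi x + d j psi x.
Proof.
move=> sphi spsi; have dphi := derivableP (@smooth_derivable R n phi j x sphi).
have dpsi := derivableP (@smooth_derivable R n psi j x spsi).
exact: (partialE (is_deriveD (is_deriveZ a dphi) dpsi)).
Qed.

Variables (Om : set 'rV[R]_n) (j : 'I_n) (u g : L -> V) (v : L -> Z) (M : R).
Hypotheses (oOm : open Om) (wp : weak_partial Om j u g) (lv : L1loc Om v) (M0 : 0 <= M).
Hypothesis uv : forall x y, `|v x - v y| <= M * `|u x - u y|.
Hypothesis rnp : radon_nikodym_property Z.

Let k : L -> R := fun x => `|\1_(Om : set L) x *: g x|.
Let Lam (phi : L -> R) : Z := - bochner_integral mu (Om : set L) (fun x => d j phi x *: v x).

Let mOm : measurable (Om : set L).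
Proof. by apply: borel_lebesgue_measurable; exact: open_borel. Qed.

Let mk : measurable_fun [set: L] k.
Proof.
apply: (strongly_measurable_norm mu_complete (u := fun x : L => \1_(Om : set L) x *: g x)).
by apply: strongly_measurable_indic => //; case: wp => _ [].
Qed.

Let k0 x : 0 <= k x. Proof. exact: normr_ge0. Qed.

Let kOm x : k x != 0 -> Om x.
Proof.
apply: contra_neqP => Omx.
by rewrite /k indicE memNset// scale0r normr0.
Qed.

Let kloc (K : set 'rV[R]_n) : compact K -> K `<=` Om -> (\int[mu]_(x in K) (k x)%:E < +oo)%E.
Proof.
move=> cK KOm; have [_ [_ lg] _] := wp; apply: le_lt_trans (lg K cK KOm).
rewrite le_eqVlt; apply/orP; left; apply/eqP; apply: eq_integral => x /set_mem Kx.
by rewrite /k indicE mem_set ?scale1r//; exact: KOm.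
Qed.

Let test_lty phi : test_function Om phi -> (weighted_norm mu k phi < +oo)%E.
Proof.
move=> tphi; have [sphi [S [cS SOm phiS]]] := (test_functionP _ _).1 tphi.
have [mS _] := lebesgue_compact cS.
have [mphi [C phiC]] := compact_supp_bounded (smooth_continuous sphi) cS phiS.
have C0 : 0 <= C by apply: le_trans (phiC 0).
have mC : measurable_fun [set: L] (fun x : L => C * \1_(S : set L) x).
  by apply: measurable_funM; [exact: measurable_cst|exact: measurable_indic].
apply: (@le_lt_trans _ _ (weighted_norm mu k (fun x : L => C * \1_(S : set L) x)%R)).
  apply: (le_weighted_norm mu mk k0 mphi mC) => x _.
  have [->|/phiS Sx] := eqVneq (phi x) 0; first by rewrite normr0.
  by rewrite indicE mem_set// mulr1 (ger0_norm C0).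
rewrite (weighted_normZ mu mk k0); last exact: measurable_indic.
apply: lte_mul_pinfty => //.
exact: le_lt_trans (weighted_norm_indic_le mu mk k0 mS mS (@subset_refl _ _)) (kloc cS SOm).
Qed.

Let Lam_lin (a : R) phi psi : test_function Om phi -> test_function Om psi ->
  Lam (fun x => a * phi x + psi x) = a *: Lam phi + Lam psi.
Proof.
move=> tphi tpsi; have [sphi [S [cS SOm phiS]]] := (test_functionP _ _).1 tphi.
have [spsi [S' [cS' S'Om psiS']]] := (test_functionP _ _).1 tpsi.
have cK : compact (S `|` S') by exact: compactU.
have KOm : S `|` S' `<=` Om by move=> x [/SOm|/S'Om].
have phiK x : phi x != 0 -> (S `|` S') x by move=> /phiS; left.
have psiK x : psi x != 0 -> (S `|` S') x by move=> /psiS'; right.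
have dphiK := partial_compact_support cK sphi phiK (j := j).
have dpsiK := partial_compact_support cK spsi psiK (j := j).
have bphi := compact_supp_bounded (smooth_continuous (smooth_partial j sphi)) cK dphiK.
have bpsi := compact_supp_bounded (smooth_continuous (smooth_partial j spsi)) cK dpsiK.
have Lv := bochner_L1_cut_off cK KOm lv.
rewrite /Lam -(bochner_integral_cut_off KOm v oOm dphiK) -(bochner_integral_cut_off KOm v oOm dpsiK).
have E : d j (fun x => a * phi x + psi x) = (fun x => a * d j phi x + d j psi x).
  by apply/funext => x; exact: partial_lin.
have EK x : a * d j phi x + d j psi x != 0 -> (S `|` S') x.
  apply: contra_neqP => Kx; have [-> ->] : d j phi x = 0 /\ d j psi x = 0.
    by split; apply: contra_notP Kx => /eqP; [exact: dphiK|exact: dpsiK].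
  by rewrite mulr0 addr0.
rewrite E -(bochner_integral_cut_off KOm v oOm EK).
by rewrite (bochner_integral_scale_linear mu_complete a bphi bpsi Lv) opprD scalerN.
Qed.

Let Lam_le phi : test_function Om phi -> (`|Lam phi|%:E <= M%:E * weighted_norm mu k phi)%E.
Proof. by move=> tphi; rewrite /Lam normrN; exact: (lipschitz_partial_le oOm wp lv M0 uv tphi). Qed.

(** The boxes covering [Om] supply the sets of finite weight on which the density is built. The
    pointwise bound by [M] times the norm of [g], kept along with the weak derivative, is what later
    places [w] in the function space. *)
Lemma lipschitz_weak_partial : exists w : L -> Z, [/\ strongly_measurable mu [set: L] w,
  {ae mu, forall x, `|w x| <= M * `|\1_(Om : set L) x *: g x| } &
  forall phi, test_function Om phi ->
    bochner_integral mu (Om : set L) (fun x => d j phi x *: v x) =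
    - bochner_integral mu (Om : set L) (fun x => phi x *: w x)].
Proof.
have [B [BP BOm]] := open_box_cover oOm.
pose E := extension mu k (test_function Om) Lam.
have tm := @test_function_measurable R n Om.
have tl := @test_function_lin R n Om.
have dense := test_function_dense oOm mk k0 kOm kloc.
have E_lin := extension_lin mk k0 M0 tm tl dense Lam_lin Lam_le.
have E_le := norm_extension_le mk k0 M0 tm tl dense Lam_lin Lam_le.
have mB i : measurable (B i : set L).
  by case: (BP i) => [->//|[a [b [-> _]]]]; exact: measurable_open_box_lebesgue.
have Bk x : k x != 0 -> exists i, B i x by move=> /kOm; rewrite -BOm => -[i _ Bix]; exists i.
have Boo i : (weighted_norm mu k \1_(B i : set L) < +oo)%E.
  case: (BP i) => [->|[a [b [-> abU]]]]; last exact: (weighted_norm_box_lty mk k0 kloc).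
  rewrite /weighted_norm; under eq_integral do rewrite indic0 normr0 mul0r.
  by rewrite integral0.
have [w [sw wk Ew]] := density_representation mu_complete (@lebesgue_rV_sigma_finite R n) rnp
  mk k0 M0 E_lin E_le mB Bk Boo.
exists w; split => // phi tphi.
have := Ew phi (tm _ tphi) (test_lty tphi).
(* At a test function, which approximates itself, the extension takes the original value
   [Lam phi]. *)
rewrite /E (extensionE mk k0 M0 tm tl Lam_lin Lam_le (tm _ tphi) (extension_test _ _ _ tphi)).
rewrite /Lam => /eqP; rewrite eqr_oppLR => /eqP ->; congr (- _).
rewrite [RHS](bochner_integral_restrict mu_complete _ mOm); congr bochner_integral.
apply/funext => x; have [_ [S [_ SOm phiS]]] := (test_functionP _ _).1 tphi.
have [->|/phiS/SOm Omx] := eqVneq (phi x) 0; first by rewrite scale0r scaler0.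
by rewrite indicE mem_set// scale1r.
Qed.

End lipschitz_weak_derivative.

(** * Membership in the function space, and Lipschitz composition *)

Section bfs_valued_functions.
Context {R : realType} {n : nat} (Om : set 'rV[R]_n) (X : banach_function_space Om).
Local Notation L := (rV_lebesgue R n).
Local Notation mu := (@lebesgue_rV R n).
Local Notation OmL := (Om : set L).
Local Notation mu_complete := (@lebesgue_rV_complete R n).
Hypothesis oOm : open Om.

Let mOm : measurable OmL.
Proof. by apply: borel_lebesgue_measurable; exact: open_borel. Qed.

Lemma strongly_measurable_norm_on (W : completeNormedModType R) (w : L -> W) :
  strongly_measurable mu OmL w -> measurable_fun OmL (fun x => `|w x|).
Proof.
move=> sw.
have s1 : strongly_measurable mu [set: L] (fun x => \1_OmL x *: w x).
  exact: strongly_measurable_indic.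
have m1 := strongly_measurable_norm mu_complete s1.
apply: eq_measurable_fun (measurable_funS measurableT (@subsetT _ OmL) m1).
by move=> x Omx; rewrite indicE Omx scale1r.
Qed.

Lemma bfs_valued_dominated (W : completeNormedModType R) (w : L -> W) (G : L -> R) :
  strongly_measurable mu OmL w -> bfs_set X G -> ae_on Om (fun x => `|w x| <= G x) ->
  bfs_valued X w.
Proof.
move=> sw XG wG; split => //.
apply: (bfs_ideal (strongly_measurable_norm_on sw) XG _).1.
by apply: ae_imply wG => x H Omx; rewrite normr_id; exact: H.
Qed.

(** The local embedding [bfs_L1] applied on [K]; its right-hand side is finite because the ideal
    property keeps the norm of [w] cut to [K] in the space. Weak derivatives are only defined
    between locally integrable functions, so this is needed for [f o u] and for its candidate
    derivative. *)
Lemma bfs_valued_L1loc (W : completeNormedModType R) (w : L -> W) : bfs_valued X w -> L1loc Om w.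
Proof.
move=> [sw Xw]; split => // K cK KOm; have [mK Koo] := lebesgue_compact cK.
have [C C0 HC] := bfs_L1 X mK KOm Koo.
have XK : bfs_set X (fun x => `|w x| * \1_(K : set L) x).
  apply: (bfs_ideal _ Xw _).1.
    apply: measurable_funM; first exact: strongly_measurable_norm_on.
    by apply: measurable_funTS; exact: measurable_indic.
  apply: aeW => x _; rewrite normrM normr_id ler_piMr// indicE.
  by case: (x \in _); rewrite ?normr1 ?normr0.
have := HC _ Xw; rewrite /extended_norm asboolT//.
under eq_integral do rewrite normr_id.
by move=> /le_lt_trans; apply; rewrite -EFinM ltry.
Qed.

(** The dichotomy on the measure of [Om]: constants belong to the space when it is finite, and only
    0 is asked for otherwise. Applied to the norm of [f 0]. *)
Lemma bfs_cst (c : R) : (mu OmL = +oo%E -> c = 0) -> bfs_set X (fun=> 0) ->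
  bfs_set X (fun x : L => c * \1_OmL x).
Proof.
move=> c0 X0; have [Omoo|] := ltP (mu OmL) +oo%E.
  have := bfs_linear c (bfs_indic X mOm (@subset_refl _ _) Omoo) X0.
  by congr (bfs_set X _); apply/funext => x; rewrite addr0.
rewrite leye_eq => /eqP/c0 ->; move: X0; congr (bfs_set X _).
by apply/funext => x; rewrite mul0r.
Qed.

End bfs_valued_functions.

Theorem theorem4p1 (R : realType) (n : nat) (Om : set 'rV[R]_n)
    (V Z : completeNormedModType R) (X : banach_function_space Om)
    (f : V -> Z) :
  open Om ->
  radon_nikodym_property Z ->
  lipschitz f ->
  (lebesgue_rV n Om = +oo%E -> f 0 = 0) ->
  forall u : 'rV[R]_n -> V, W1 X u -> W1 X (f \o u).
Proof.
move=> oOm rnp lipf f0 u [Xu Du].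
(* [lipschitz] states the inequality for all sufficiently large constants; a nonnegative one is
   picked. *)
have [M M0 lipM] : exists2 M, 0 <= M & forall x y, `|f x - f y| <= M * `|x - y|.
  have [M [M0 lM]] := @filter_ex _ _ _ _ (filterI (nbhs_pinfty_ge (num_real (0 : R))) lipf).
  by exists M => // x y; exact: (lM (x, y)).
have cf : continuous f.
  move=> x; apply/cvgrPdist_lt => e e0.
  have M1 : 0 < M + 1 by rewrite ltr_wpDl.
  near=> y; apply: le_lt_trans (lipM _ _) _.
  apply: (@le_lt_trans _ _ ((M + 1) * `|x - y|)); first by rewrite ler_wpM2r// lerDl.
  rewrite -ltr_pdivlMl//; near: y.
  by apply: (@cvgr_dist_lt _ _ _ _ _ id); [exact: cvg_id|rewrite mulr_gt0// invr_gt0].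
have [su Xnu] := Xu.
have X0 : bfs_set X (fun=> 0).
  have := bfs_linear (-1) Xnu Xnu; congr (bfs_set X _).
  by apply/funext => x; rewrite mulN1r addNr.
have Xfu : bfs_valued X (f \o u).
  (* The term by which the norm of [f o u] may exceed [M] times that of [u]; the hypothesis on [f 0]
     enters here. *)
  have Xc : bfs_set X (fun x : rV_lebesgue R n => `|f 0| * \1_(Om : set (rV_lebesgue R n)) x).
    by apply: bfs_cst => // /f0 ->; rewrite normr0.
  apply: (bfs_valued_dominated oOm _ (bfs_linear M Xnu Xc)).
    exact: strongly_measurable_comp.
  apply: aeW => x Omx; rewrite indicE mem_set// mulr1 /=.
  have := lipM (u x) 0; rewrite subr0 => H.
  have := ler_normD (f (u x) - f 0) (f 0); rewrite subrK => /le_trans; apply.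
  by rewrite lerD2r.
split => // j; have [g wp Xg] := Du j; have [sg Xng] := Xg.
have lv := bfs_valued_L1loc oOm Xfu.
have [w [sw wM wE]] := lipschitz_weak_partial oOm wp lv M0 (fun x y => lipM (u x) (u y)) rnp.
have Xw : bfs_valued X w.
  apply: (bfs_valued_dominated oOm _ (bfs_linear M Xng X0)).
    exact: strongly_measurableS sw.
  by apply: ae_imply wM => x wx Omx; move: wx; rewrite indicE mem_set// scale1r addr0.
by exists w => //; split => //; exact: (bfs_valued_L1loc oOm Xw).
Unshelve. all: by end_near. Qed.
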